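(* Let $f(z)=z+\sum_{n\ge 2}a_nz^n$ belong to the class $C$ of normalized convex univalent functions. Then $f'\in H^p$ for all $0<p<\frac{1}{1+|a_2|}$ and $f\in H^q$ for all $0<q<\frac{1}{|a_2|}$. Both estimates are sharp: for every $\alpha\in[0,1]$ there exists $f\in C$ with $|a_2|=\alpha$ such that $f'\notin H^{1/(1+\alpha)}$, and there exists $f\in C$ with $|a_2|=\alpha$ such that $f\notin H^{1/\alpha}$.
   Context: $\mathbb{D}$ is the open unit disk. $S$ is the class of univalent (injective holomorphic) functions $f(z)=z+\sum_{n=2}^\infty a_nz^n$ in $\mathbb{D}$. $C\subset S$ consists of those $f\in S$ whose range $f(\mathbb{D})$ is a convex set; for $f\in C$ one has $|a_2|\le 1$. For $0<p<\infty$, $M_p(r,f)=\left\{\frac1{2\pi}\int_0^{2\pi}|f(re^{i\theta})|^p\,d\theta\right\}^{1/p}$, and $M_\infty(r,f)=\max_{|z|=r}|f(z)|$; for $0<p\le\infty$ the Hardy space $H^p$ is the set of holomorphic $f$ in $\mathbb{D}$ with $\sup_{r<1}M_p(r,f)<\infty$. Convention: $1/0=\infty$. *)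

(* Defs.v *)
From Stdlib Require Import Reals.
From Coquelicot Require Import Coquelicot.
Open Scope R_scope.

Definition disk (z : C) : Prop := Cmod z < 1.

(* Complex differentiability at every point of the disk; a function is a total
   map C -> C, but only its values on the disk matter. *)
Definition holomorphic_disk (f : C -> C) : Prop :=
  forall z : C, disk z -> @ex_derive C_AbsRing C_NormedModule f z.

Definition univalent (f : C -> C) : Prop :=
  holomorphic_disk f /\
  (forall z w : C, disk z -> disk w -> f z = f w -> z = w).

(* f(z) = sum_n a_n z^n on the disk *)
Definition has_expansion (f : C -> C) (a : nat -> C) : Prop :=
  forall z : C, disk z -> @is_pseries C_AbsRing C_NormedModule a z (f z).

(* The class S, a function being given together with its (uniquely determined)
   sequence of Taylor coefficients at 0. *)
Definition class_S (f : C -> C) (a : nat -> C) : Prop :=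
  univalent f /\ has_expansion f a /\ a 0%nat = RtoC 0 /\ a 1%nat = RtoC 1.

Definition convex_set (E : C -> Prop) : Prop :=
  forall (u v : C) (t : R), E u -> E v -> 0 <= t <= 1 ->
    E (RtoC (1 - t) * u + RtoC t * v)%C.

Definition disk_image (f : C -> C) (w : C) : Prop :=
  exists z : C, disk z /\ f z = w.

Definition class_C (f : C -> C) (a : nat -> C) : Prop :=
  class_S f a /\ convex_set (disk_image f).

(* x^p for x >= 0 and p > 0. Rpower alone would give Rpower 0 p = 1, because
   ln 0 = 0 by convention. *)
Definition pos_power (x p : R) : R :=
  if Rle_dec x 0 then 0 else Rpower x p.

(* r e^{i theta} *)
Definition polar (r theta : R) : C := (r * cos theta, r * sin theta).

(* M_p(r, f) for 0 < p <= +oo. For p = +oo this is the least upper bound of |f|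
   on the circle |z| = r, which is the maximum when f is continuous there.
   The value at -oo is a dummy. *)
Definition integral_mean (p : Rbar) (r : R) (f : C -> C) : Rbar :=
  match p with
  | Finite p =>
      Finite (pos_power
        (/ (2 * PI) *
           RInt (fun theta => pos_power (Cmod (f (polar r theta))) p)
                0 (2 * PI))
        (/ p))
  | p_infty => Lub_Rbar (fun x => exists z : C, Cmod z = r /\ x = Cmod (f z))
  | m_infty => Finite 0
  end.

(* f belongs to H^p, to be used for 0 < p <= +oo *)
Definition hardy (p : Rbar) (f : C -> C) : Prop :=
  holomorphic_disk f /\
  exists B : R, forall r : R, 0 <= r < 1 -> Rbar_le (integral_mean p r f) (Finite B).

(* 1/x for x >= 0 with 1/0 = +oo, whereas Rbar_inv gives 0 at 0 *)
Definition recip_ext (x : R) : Rbar :=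
  if Req_EM_T x 0 then p_infty else Finite (/ x).

(* Main.v *)
Require Import Defs.
From Stdlib Require Import Reals.
From Coquelicot Require Import Coquelicot.
From Stdlib Require Import Lra Lia Psatz ClassicalEpsilon.
Open Scope R_scope.

(* Let f be convex.  If |c| <= 1 and 0 <= s <= 1, then z |-> (1 - s) f(z) + s f(cz) is subordinate
   to f, so the Schwarz lemma, differentiated at s = 0, gives Re ((f(z) - f(cz)) / (z f'(z))) >= 0.
   Taking c = 0 yields Re (z f'/f) >= 0, and the second order term at c = e^{it}, t -> 0, yields
   Re (1 + z f''/f') >= 0.  Hence phi = f'' / (2 f' + z f'') maps the disk into its closure and
   phi(0) = a_2; with alpha = |a_2|, Schwarz-Pick gives (1 - |z|) |f''| <= (1 + alpha) |f'|, so that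
   |f'| <= (1 - r)^{-(1 + alpha)} and |f| = O((1 - r)^{-b}) for every b >= alpha, b > 0.
   For g = f or g = f', with k = 0 or k = 1, the function k + z g'/g has nonnegative real part and
   constant circle means, so r d/dr (mean of |g|^p) = p mean (|g|^p Re (z g'/g)) is at most a
   constant times (max |g|)^p, which is integrable up to r = 1 in the stated range of p.
   Sharpness is witnessed by the solution of (1 - z^2) f' = 1 + 2 alpha f, f(0) = 0, that is
   1 + 2 alpha f = ((1 + z) / (1 - z))^alpha, or f = log ((1 + z) / (1 - z)) / 2 when alpha = 0. *)

(** * Continuity and differentiability of complex functions *)

(** The complex analysis rests on one fact: the circle mean of Re F about c is constant on an
    annulus where F is C1. On the boundary circles continuity suffices, so an exceptional point is
    absorbed by placing it at the centre or on a circle separating two annuli; this is how quotients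
    such as F(w)/w and (z - w)/(f z - f w) are treated without a removable singularity theorem. The
    resulting bound for the value at the centre yields Schwarz's lemma, the nonvanishing of f' and
    the open mapping property of injective functions. For the Hardy bounds the point is positivity:
    |g|^p may be replaced by its maximum on the circle in front of a nonnegative density of constant
    total mass, and integrating in r then gains one power of 1 - r over bounding |g|^p directly. The
    extremal function enters through its Taylor coefficients because membership in the class
    requires them. Its differential equation links them to the closed form, and the coordinate L
    with z = tanh(L/2) replaces the logarithm of (1 + z)/(1 - z), so no branch has to be
    differentiated. *)

Definition is_Cderive (F : C -> C) (z l : C) : Prop :=
  @is_derive C_AbsRing C_NormedModule F z l.
Notation cont F z := (@continuous C_UniformSpace C_UniformSpace F z).

(* [ring] does not recognize C behind the carriers of Coquelicot's structures. *)
Ltac Cring := lazymatch goal with |- @eq _ ?a ?b => change (@eq C a b) end; ring.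

Lemma continuous_C_iff {U : UniformSpace} (F : U -> C) (x : U) :
  @continuous U C_UniformSpace F x <->
  continuous (fun u => Re (F u)) x /\ continuous (fun u => Im (F u)) x.
Proof.
split.
- intros H; split.
  + apply (continuous_comp F (fun p : R * R => fst p)); [exact H|].
    apply (@continuous_fst R_UniformSpace R_UniformSpace).
  + apply (continuous_comp F (fun p : R * R => snd p)); [exact H|].
    apply (@continuous_snd R_UniformSpace R_UniformSpace).
- intros [H1 H2] P [eps HP].
  unfold continuous, filterlim, filter_le, filtermap in *.
  specialize (H1 (ball (Re (F x)) eps) (locally_ball _ _)).
  specialize (H2 (ball (Im (F x)) eps) (locally_ball _ _)).
  generalize (filter_and _ _ H1 H2); apply filter_imp.
  intros u [h1 h2]; apply HP; split; assumption.
Qed.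

Lemma cont_eps (F : C -> C) (z : C) :
  cont F z <-> forall eps, 0 < eps -> exists d, 0 < d /\
    forall y, Cmod (y - z) < d -> Cmod (F y - F z) < eps.
Proof.
split.
- intros H eps He.
  (* Balls of [C_UniformSpace] are squares; the one of radius eps / sqrt 2 fits into the disk of
     radius eps. *)
  assert (He2 : 0 < eps / sqrt 2) by (apply Rdiv_lt_0_compat; [lra|apply sqrt_lt_R0; lra]).
  destruct (H _ (locally_ball (F z) (mkposreal _ He2))) as [d Hd].
  exists d; split; [apply cond_pos|]; intros y Hy.
  apply C_NormedModule_mixin_compat1 in Hy.
  apply Hd in Hy.
  apply (C_NormedModule_mixin_compat2 (F z) (F y) (mkposreal _ He2)) in Hy.
  replace eps with (sqrt 2 * (mkposreal _ He2)); [exact Hy|].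
  simpl; field; apply Rgt_not_eq, sqrt_lt_R0; lra.
- intros H P [eps HP].
  destruct (H eps (cond_pos eps)) as [d [Hd H1]].
  assert (Hd2 : 0 < d / sqrt 2) by (apply Rdiv_lt_0_compat; [lra|apply sqrt_lt_R0; lra]).
  exists (mkposreal _ Hd2); intros y Hy; apply HP.
  apply C_NormedModule_mixin_compat1, H1.
  apply (C_NormedModule_mixin_compat2 z y (mkposreal _ Hd2)) in Hy.
  replace d with (sqrt 2 * (mkposreal _ Hd2)); [exact Hy|].
  simpl; field; apply Rgt_not_eq, sqrt_lt_R0; lra.
Qed.

Lemma Cderive_eps (F : C -> C) (z l : C) :
  is_Cderive F z l <-> forall eps, 0 < eps -> exists d, 0 < d /\
    forall y, Cmod (y - z) < d -> Cmod (F y - F z - (y - z) * l) <= eps * Cmod (y - z).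
Proof.
split.
- intros [_ H] eps He.
  destruct (H z (fun P HP => HP) (mkposreal eps He)) as [d Hd].
  exists d; split; [apply cond_pos|]; intros y Hy.
  exact (Hd y Hy).
- intros H; split.
  { apply is_linear_scal_l. }
  intros x Hx eps.
  apply (@is_filter_lim_locally_unique C_AbsRing (AbsRing_NormedModule C_AbsRing)) in Hx.
  subst x.
  destruct (H eps (cond_pos eps)) as [d [Hd H1]].
  exists (mkposreal d Hd); intros y Hy; exact (H1 y Hy).
Qed.

(** * Continuity rules for C-valued maps on C, on an angle, or on polar coordinates *)

Section ContinuousC.
Context {U : UniformSpace}.
Implicit Types F G : U -> C.
Local Notation contU F x := (@continuous U C_UniformSpace F x).

Lemma contC_plus F G x : contU F x -> contU G x -> contU (fun u => F u + G u)%C x.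
Proof.
intros [a1 a2]%continuous_C_iff [b1 b2]%continuous_C_iff; apply continuous_C_iff; split; cbn;
apply (@continuous_plus U R_AbsRing R_NormedModule); assumption.
Qed.

Lemma contC_minus F G x : contU F x -> contU G x -> contU (fun u => F u - G u)%C x.
Proof.
intros [a1 a2]%continuous_C_iff [b1 b2]%continuous_C_iff; apply continuous_C_iff; split; cbn;
apply (@continuous_minus U R_AbsRing R_NormedModule); assumption.
Qed.

Lemma contC_mult F G x : contU F x -> contU G x -> contU (fun u => F u * G u)%C x.
Proof.
intros [a1 a2]%continuous_C_iff [b1 b2]%continuous_C_iff; apply continuous_C_iff; split; cbn.
- apply (@continuous_minus U R_AbsRing R_NormedModule); apply (@continuous_mult U R_AbsRing); assumption.
- apply (@continuous_plus U R_AbsRing R_NormedModule); apply (@continuous_mult U R_AbsRing); assumption.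
Qed.

Lemma contC_const (c : C) x : contU (fun _ => c) x.
Proof. apply continuous_const. Qed.

Lemma continuous_Cmod F x : contU F x -> continuous (fun u => Cmod (F u)) x.
Proof.
intros [a1 a2]%continuous_C_iff; unfold Cmod.
apply (continuous_comp (fun u => fst (F u) ^ 2 + snd (F u) ^ 2) sqrt).
- apply (@continuous_plus U R_AbsRing R_NormedModule); cbn;
  repeat (apply (@continuous_mult U R_AbsRing); try assumption; try apply continuous_const).
- apply continuous_sqrt.
Qed.

Lemma contC_inv F x : contU F x -> F x <> 0%C -> contU (fun u => / F u)%C x.
Proof.
intros HF H0; pose proof HF as [a1 a2]%continuous_C_iff.
assert (Hd : fst (F x) ^ 2 + snd (F x) ^ 2 <> 0).
{ intros E; apply H0, Cmod_eq_0; unfold Cmod; rewrite E; apply sqrt_0. }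
assert (Hn : continuous (fun u => fst (F u) ^ 2 + snd (F u) ^ 2) x).
{ apply (@continuous_plus U R_AbsRing R_NormedModule); cbn;
  repeat (apply (@continuous_mult U R_AbsRing); try assumption; try apply continuous_const). }
assert (Hi : continuous (fun u => / (fst (F u) ^ 2 + snd (F u) ^ 2)) x).
{ apply (continuous_comp (fun u => fst (F u) ^ 2 + snd (F u) ^ 2) Rinv); [exact Hn|].
  now apply continuous_Rinv. }
apply continuous_C_iff; split; cbn; unfold Rdiv.
- apply (@continuous_mult U R_AbsRing); assumption.
- apply (@continuous_mult U R_AbsRing); [|assumption].
  apply (@continuous_opp U R_AbsRing R_NormedModule); assumption.
Qed.

Lemma contC_comp (F : U -> C) (G : C -> C) x :
  contU F x -> cont G (F x) -> contU (fun u => G (F u)) x.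
Proof. apply (continuous_comp F G). Qed.
End ContinuousC.

Lemma contC_id (z : C) : cont (fun z : C => z) z.
Proof. apply continuous_id. Qed.

Lemma contC_div {U : UniformSpace} (F G : U -> C) x :
  @continuous U C_UniformSpace F x -> @continuous U C_UniformSpace G x -> G x <> 0%C ->
  @continuous U C_UniformSpace (fun u => F u / G u)%C x.
Proof. intros; apply contC_mult; [|apply contC_inv]; assumption. Qed.

Lemma Cminus_neq0 (a b : C) : a <> b -> (a - b)%C <> 0%C.
Proof. intros H E; apply H; replace a with (a - b + b)%C by ring; rewrite E; ring. Qed.

(** Carathéodory's form of differentiability: the difference quotient is a total function continuous
    at z, so the product, chain and inverse rules reduce to algebra. The same q later serves as the
    continuous extension of a quotient across its singular point. *)
Lemma caratheodory (F : C -> C) (z l : C) :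
  is_Cderive F z l <->
  exists q : C -> C, cont q z /\ q z = l /\ forall y, (F y - F z)%C = (q y * (y - z))%C.
Proof.
split.
- intros H; rewrite Cderive_eps in H.
  exists (fun y => if excluded_middle_informative (y = z) then l else (F y - F z) / (y - z))%C.
  split; [|split].
  + apply cont_eps; intros eps He.
    destruct (H (eps / 2)) as [d [Hd H1]]; [lra|].
    exists d; split; [exact Hd|]; intros y Hy.
    destruct (excluded_middle_informative (z = z)) as [_|n]; [|now elim n].
    destruct (excluded_middle_informative (y = z)) as [->|n].
    { replace (l - l)%C with (RtoC 0) by ring; rewrite Cmod_0; exact He. }
    assert (Hn := Cminus_neq0 _ _ n).
    assert (Hp := proj1 (Cmod_gt_0 _) Hn).
    replace ((F y - F z) / (y - z) - l)%C with ((F y - F z - (y - z) * l) / (y - z))%C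
      by (field; exact Hn).
    rewrite Cmod_div by exact Hn.
    specialize (H1 y Hy).
    apply Rle_lt_trans with (eps / 2); [|lra].
    apply (Rmult_le_reg_r (Cmod (y - z))); [exact Hp|].
    unfold Rdiv; rewrite Rmult_assoc, Rinv_l by lra; lra.
  + destruct (excluded_middle_informative (z = z)) as [_|n]; [reflexivity|now elim n].
  + intros y; destruct (excluded_middle_informative (y = z)) as [->|n]; [ring|].
    field; now apply Cminus_neq0.
- intros [q [Hq [<- E]]]; apply Cderive_eps; intros eps He.
  rewrite cont_eps in Hq; destruct (Hq eps He) as [d [Hd H1]].
  exists d; split; [exact Hd|]; intros y Hy.
  rewrite E; replace (q y * (y - z) - (y - z) * q z)%C with ((q y - q z) * (y - z))%C by ring.
  rewrite Cmod_mult; apply Rmult_le_compat_r; [apply Cmod_ge_0|].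
  left; now apply H1.
Qed.

Lemma Cderive_cont (F : C -> C) (z l : C) : is_Cderive F z l -> cont F z.
Proof.
intros [q [Hq [_ E]]]%caratheodory.
apply (continuous_ext (fun y => F z + q y * (y - z))%C).
{ intros y; rewrite <- E; Cring. }
apply contC_plus; [apply contC_const|]; apply contC_mult; [exact Hq|].
apply contC_minus; [apply contC_id|apply contC_const].
Qed.

Lemma Cderive_ext_loc (F G : C -> C) (z l : C) d :
  0 < d -> (forall y, Cmod (y - z) < d -> F y = G y) -> is_Cderive F z l -> is_Cderive G z l.
Proof.
intros Hd E H; rewrite Cderive_eps in H |- *; intros eps He.
destruct (H eps He) as [d' [Hd' H1]].
exists (Rmin d d'); split; [now apply Rmin_pos|]; intros y Hy.
rewrite <- E by (apply Rlt_le_trans with (1 := Hy), Rmin_l).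
rewrite <- (E z); [|replace (z - z)%C with (RtoC 0) by ring; rewrite Cmod_0; exact Hd].
apply H1, Rlt_le_trans with (1 := Hy), Rmin_r.
Qed.

Lemma Cderive_const (c z : C) : is_Cderive (fun _ => c) z 0%C.
Proof.
apply caratheodory; exists (fun _ => 0%C); split; [apply contC_const|split;[reflexivity|intros; ring]].
Qed.

Lemma Cderive_id (z : C) : is_Cderive (fun z : C => z) z 1%C.
Proof.
apply caratheodory; exists (fun _ => 1%C); split; [apply contC_const|split;[reflexivity|intros; ring]].
Qed.

Lemma Cderive_plus (F G : C -> C) (z f g : C) :
  is_Cderive F z f -> is_Cderive G z g -> is_Cderive (fun z => F z + G z)%C z (f + g)%C.
Proof. apply (@is_derive_plus C_AbsRing C_NormedModule). Qed.

Lemma Cderive_minus (F G : C -> C) (z f g : C) :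
  is_Cderive F z f -> is_Cderive G z g -> is_Cderive (fun z => F z - G z)%C z (f - g)%C.
Proof. apply (@is_derive_minus C_AbsRing C_NormedModule). Qed.

Lemma Cderive_mult (F G : C -> C) (z f g : C) :
  is_Cderive F z f -> is_Cderive G z g ->
  is_Cderive (fun z => F z * G z)%C z (f * G z + F z * g)%C.
Proof.
intros HF HG; pose proof (Cderive_cont _ _ _ HG) as cG.
apply caratheodory in HF; apply caratheodory in HG.
destruct HF as [p [Hp [<- Ep]]], HG as [q [Hq [<- Eq]]].
apply caratheodory; exists (fun y => p y * G y + F z * q y)%C; split; [|split].
- apply contC_plus; apply contC_mult; auto; apply contC_const.
- reflexivity.
- intros y; replace (F y * G y - F z * G z)%C with ((F y - F z) * G y + F z * (G y - G z))%C by ring.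
  rewrite Ep, Eq; ring.
Qed.

Lemma Cderive_comp (F G : C -> C) (z f g : C) :
  is_Cderive F (G z) f -> is_Cderive G z g -> is_Cderive (fun z => F (G z)) z (f * g)%C.
Proof.
intros HF HG; pose proof (Cderive_cont _ _ _ HG) as cG.
apply caratheodory in HF; apply caratheodory in HG.
destruct HF as [p [Hp [<- Ep]]], HG as [q [Hq [<- Eq]]].
apply caratheodory; exists (fun y => p (G y) * q y)%C; split; [|split].
- apply contC_mult; [|exact Hq]; now apply (contC_comp G p).
- reflexivity.
- intros y; rewrite Ep, Eq; ring.
Qed.

Lemma cont_neq0 (F : C -> C) (z : C) : cont F z -> F z <> 0%C ->
  exists d, 0 < d /\ forall y, Cmod (y - z) < d -> F y <> 0%C.
Proof.
intros H H0; rewrite cont_eps in H.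
destruct (H (Cmod (F z))) as [d [Hd H1]]; [now apply Cmod_gt_0|].
exists d; split; [exact Hd|]; intros y Hy E.
specialize (H1 y Hy); rewrite E in H1.
replace (0 - F z)%C with (- F z)%C in H1 by ring; rewrite Cmod_opp in H1; lra.
Qed.

Lemma Cderive_Cinv (z : C) : z <> 0%C -> is_Cderive Cinv z (- / (z * z))%C.
Proof.
intros H0; destruct (cont_neq0 _ _ (contC_id z) H0) as [d [Hd H1]].
(* The value at [y = 0] is changed so that the difference quotient identity holds everywhere. *)
apply (Cderive_ext_loc (fun y : C => if excluded_middle_informative (y = 0%C) then / z - (y-z)/(z*z) else / y)%C _ _ _ d Hd).
{ intros y Hy; destruct (excluded_middle_informative (y = 0%C)); [|reflexivity].
  now elim (H1 y Hy). }
apply caratheodory.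
exists (fun y : C => if excluded_middle_informative (y = 0%C) then - / (z * z) else - / (y * z))%C.
split; [|split].
- assert (cont (fun y : C => - / (y * z))%C z).
  { apply (continuous_ext (fun y : C => (0 - / (y * z)))%C); [intros; Cring|].
    apply contC_minus; [apply contC_const|].
    apply (contC_inv (fun y : C => y * z)%C).
    - apply contC_mult; [apply contC_id|apply contC_const].
    - now apply Cmult_neq_0. }
  apply continuous_ext_loc with (2 := H).
  assert (Hd2 : 0 < d / sqrt 2) by (apply Rdiv_lt_0_compat; [lra|apply sqrt_lt_R0; lra]).
  exists (mkposreal _ Hd2); intros y Hy.
  apply (C_NormedModule_mixin_compat2 z y (mkposreal _ Hd2)) in Hy.
  change C in y; destruct (excluded_middle_informative (y = 0%C)); [|reflexivity].
  elim (H1 y); [|assumption].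
  replace d with (sqrt 2 * (mkposreal _ Hd2)); [exact Hy|].
  simpl; field; apply Rgt_not_eq, sqrt_lt_R0; lra.
- destruct (excluded_middle_informative (z = 0%C)); [contradiction|reflexivity].
- intros y; destruct (excluded_middle_informative (z = 0%C)); [contradiction|].
  destruct (excluded_middle_informative (y = 0%C)); field; auto.
Qed.

Lemma Cderive_inv (F : C -> C) (z f : C) :
  is_Cderive F z f -> F z <> 0%C -> is_Cderive (fun z => / F z)%C z (- f / (F z * F z))%C.
Proof.
intros HF H0.
replace (- f / (F z * F z))%C with ((- / (F z * F z)) * f)%C by (field; exact H0).
apply (Cderive_comp Cinv F); [now apply Cderive_Cinv|exact HF].
Qed.

(* Continuity of the derivative is what lets one differentiate under the integral sign, so that
   Goursat's theorem is never needed. *)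
Definition C1 (F : C -> C) (z : C) : Prop :=
  (exists d, 0 < d /\ forall y, Cmod (y - z) < d -> is_Cderive F y (C_derive F y)) /\
  cont (C_derive F) z.

Lemma C1_intro (F F' : C -> C) (z : C) (d : R) : 0 < d ->
  (forall y, Cmod (y - z) < d -> is_Cderive F y (F' y)) -> cont F' z -> C1 F z.
Proof.
intros Hd H Hc.
assert (E : forall y, Cmod (y - z) < d -> C_derive F y = F' y).
{ intros y Hy; now apply is_C_derive_unique, H. }
split.
- exists d; split; [exact Hd|]; intros y Hy; rewrite E by exact Hy; now apply H.
- rewrite cont_eps in *; intros eps He; destruct (Hc eps He) as [d' [Hd' H1]].
  exists (Rmin d d'); split; [now apply Rmin_pos|]; intros y Hy.
  rewrite !E; [apply H1, Rlt_le_trans with (1 := Hy), Rmin_r| |apply Rlt_le_trans with (1 := Hy), Rmin_l].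
  replace (z - z)%C with (RtoC 0) by ring; rewrite Cmod_0; exact Hd.
Qed.

Lemma C1_derive (F : C -> C) (z : C) : C1 F z -> is_Cderive F z (C_derive F z).
Proof.
intros [[d [Hd H]] _]; apply H.
replace (z - z)%C with (RtoC 0) by ring; rewrite Cmod_0; exact Hd.
Qed.

Lemma C1_cont (F : C -> C) (z : C) : C1 F z -> cont F z.
Proof. intros H; exact (Cderive_cont _ _ _ (C1_derive _ _ H)). Qed.

Lemma C1_ext_loc (F G : C -> C) (z : C) (d : R) : 0 < d ->
  (forall y, Cmod (y - z) < d -> F y = G y) -> C1 F z -> C1 G z.
Proof.
intros Hd E [[d' [Hd' K]] c].
(* Half the radius, so that a whole disk about each such y stays in the region where F and G
   agree. *)
apply (C1_intro _ (C_derive F) _ (Rmin (d / 2) d')).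
- apply Rmin_pos; lra.
- intros y Hy.
  assert (h1 : Cmod (y - z) < d / 2) by apply (Rlt_le_trans _ _ _ Hy (Rmin_l _ _)).
  apply (Cderive_ext_loc F _ _ _ (d / 2)); [lra| |].
  + intros v Hv; apply E; replace (v - z)%C with ((v - y) + (y - z))%C by ring.
    apply Rle_lt_trans with (1 := Cmod_triangle _ _); lra.
  + apply K, (Rlt_le_trans _ _ _ Hy (Rmin_r _ _)).
- exact c.
Qed.

Lemma C1_const c z : C1 (fun _ => c) z.
Proof.
apply (C1_intro _ (fun _ => 0%C) _ 1); [lra|intros; apply Cderive_const|apply contC_const].
Qed.

Lemma C1_id (z : C) : C1 (fun z : C => z) z.
Proof.
apply (C1_intro _ (fun _ => 1%C) _ 1); [lra|intros; apply Cderive_id|apply contC_const].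
Qed.

Lemma C1_plus (F G : C -> C) (z : C) : C1 F z -> C1 G z -> C1 (fun z => F z + G z)%C z.
Proof.
intros [[d [Hd H]] c] [[d' [Hd' H']] c'].
apply (C1_intro _ (fun z => C_derive F z + C_derive G z)%C _ (Rmin d d')).
- now apply Rmin_pos.
- intros y Hy; apply Cderive_plus; [apply H|apply H'];
  apply Rlt_le_trans with (1 := Hy); [apply Rmin_l|apply Rmin_r].
- now apply contC_plus.
Qed.

Lemma C1_mult (F G : C -> C) (z : C) : C1 F z -> C1 G z -> C1 (fun z => F z * G z)%C z.
Proof.
intros HF HG; pose proof (C1_cont _ _ HF); pose proof (C1_cont _ _ HG).
destruct HF as [[d [Hd HF]] c], HG as [[d' [Hd' HG]] c'].
apply (C1_intro _ (fun z => C_derive F z * G z + F z * C_derive G z)%C _ (Rmin d d')).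
- now apply Rmin_pos.
- intros y Hy; apply Cderive_mult; [apply HF|apply HG];
  apply Rlt_le_trans with (1 := Hy); [apply Rmin_l|apply Rmin_r].
- apply contC_plus; now apply contC_mult.
Qed.

Lemma C1_comp (F G : C -> C) (z : C) : C1 F (G z) -> C1 G z -> C1 (fun z => F (G z)) z.
Proof.
intros HF HG; pose proof (C1_cont _ _ HG) as cG.
destruct HF as [[d [Hd HF]] c], HG as [[d' [Hd' HG]] c'].
pose proof cG as cG'; rewrite cont_eps in cG'; destruct (cG' d Hd) as [d2 [Hd2 H2]].
apply (C1_intro _ (fun z => C_derive F (G z) * C_derive G z)%C _ (Rmin d' d2)).
- now apply Rmin_pos.
- intros y Hy; apply Cderive_comp; [apply HF, H2|apply HG];
  apply Rlt_le_trans with (1 := Hy); [apply Rmin_r|apply Rmin_l].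
- apply contC_mult; [|exact c']; now apply (contC_comp G (C_derive F)).
Qed.

Lemma C1_inv (F : C -> C) (z : C) : C1 F z -> F z <> 0%C -> C1 (fun z => / F z)%C z.
Proof.
intros HF H0; pose proof (C1_cont _ _ HF) as cF.
destruct (cont_neq0 _ _ cF H0) as [d' [Hd' H1]].
destruct HF as [[d [Hd HF]] c].
apply (C1_intro _ (fun z => (0 - C_derive F z) / (F z * F z))%C _ (Rmin d d')).
- now apply Rmin_pos.
- intros y Hy.
  replace (0 - C_derive F y)%C with (- C_derive F y)%C by ring.
  apply Cderive_inv; [apply HF|apply H1];
  apply Rlt_le_trans with (1 := Hy); [apply Rmin_l|apply Rmin_r].
- apply contC_div; [|now apply contC_mult|now apply Cmult_neq_0].
  apply contC_minus; [apply contC_const|exact c].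
Qed.

Lemma C1_minus (F G : C -> C) (z : C) : C1 F z -> C1 G z -> C1 (fun z => F z - G z)%C z.
Proof.
intros [[d [Hd H]] c] [[d' [Hd' H']] c'].
apply (C1_intro _ (fun z => C_derive F z - C_derive G z)%C _ (Rmin d d')).
- now apply Rmin_pos.
- intros y Hy; apply Cderive_minus; [apply H|apply H'];
  apply Rlt_le_trans with (1 := Hy); [apply Rmin_l|apply Rmin_r].
- now apply contC_minus.
Qed.

Lemma C1_div (F G : C -> C) (z : C) : C1 F z -> C1 G z -> G z <> 0%C -> C1 (fun z => F z / G z)%C z.
Proof. intros; apply C1_mult; [|apply C1_inv]; assumption. Qed.

(** * Circle means *)

Lemma is_derive_R_eps (u : R -> R) (t l : R) :
  is_derive u t l <-> forall eps, 0 < eps -> exists d, 0 < d /\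
    forall y, Rabs (y - t) < d -> Rabs (u y - u t - (y - t) * l) <= eps * Rabs (y - t).
Proof.
split.
- intros [_ H] eps He.
  destruct (H t (fun P HP => HP) (mkposreal eps He)) as [d Hd].
  exists d; split; [apply cond_pos|]; intros y Hy; exact (Hd y Hy).
- intros H; split.
  { apply is_linear_scal_l. }
  intros x Hx eps.
  apply (@is_filter_lim_locally_unique R_AbsRing R_NormedModule) in Hx.
  subst x; destruct (H eps (cond_pos eps)) as [d [Hd H1]].
  exists (mkposreal d Hd); intros y Hy; exact (H1 y Hy).
Qed.

(** Componentwise, so that each component can be handed to the real mean value theorem and to
    [RInt]. *)
Definition is_curve_derive (g : R -> C) (t : R) (l : C) : Prop :=
  is_derive (fun s => Re (g s)) t (Re l) /\ is_derive (fun s => Im (g s)) t (Im l).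

Lemma curve_derive_eps (g : R -> C) (t : R) (l : C) :
  is_curve_derive g t l <-> forall eps, 0 < eps -> exists d, 0 < d /\
    forall s, Rabs (s - t) < d -> Cmod (g s - g t - RtoC (s - t) * l) <= eps * Rabs (s - t).
Proof.
assert (Er : forall s, Re (g s - g t - RtoC (s - t) * l)%C = Re (g s) - Re (g t) - (s - t) * Re l).
{ intros s; unfold Re, Im; cbn; ring. }
assert (Ei : forall s, Im (g s - g t - RtoC (s - t) * l)%C = Im (g s) - Im (g t) - (s - t) * Im l).
{ intros s; unfold Re, Im; cbn; ring. }
split.
- intros [H1 H2]; rewrite is_derive_R_eps in H1, H2; intros eps He.
  destruct (H1 (eps / 2)) as [d1 [Hd1 h1]]; [lra|].
  destruct (H2 (eps / 2)) as [d2 [Hd2 h2]]; [lra|].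
  exists (Rmin d1 d2); split; [now apply Rmin_pos|]; intros s Hs.
  specialize (h1 s (Rlt_le_trans _ _ _ Hs (Rmin_l _ _))).
  specialize (h2 s (Rlt_le_trans _ _ _ Hs (Rmin_r _ _))).
  apply Rle_trans with (1 := Cmod_2Rmax _).
  rewrite <- Er in h1; rewrite <- Ei in h2.
  assert (sqrt 2 <= 2).
  { rewrite <- (sqrt_Rsqr 2) at 2 by lra; apply sqrt_le_1_alt; unfold Rsqr; lra. }
  assert (0 <= sqrt 2) by apply sqrt_pos.
  assert (Hm : Rmax (Rabs (fst (g s - g t - RtoC (s - t) * l)%C))
     (Rabs (snd (g s - g t - RtoC (s - t) * l)%C)) <= eps / 2 * Rabs (s - t)).
  { apply Rmax_lub; assumption. }
  assert (0 <= eps / 2 * Rabs (s - t)).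
  { apply Rmult_le_pos; [lra|apply Rabs_pos]. }
  nra.
- intros H; split; apply is_derive_R_eps; intros eps He; destruct (H eps He) as [d [Hd h]];
  (exists d; split; [exact Hd|]); intros s Hs; specialize (h s Hs);
  apply Rle_trans with (2 := h).
  + rewrite <- Er; apply re_le_Cmod.
  + rewrite <- Ei; apply Rle_trans with (2 := Rmax_Cmod _), Rmax_r.
Qed.

Lemma curve_derive_comp (F : C -> C) (g : R -> C) (t : R) (l v : C) :
  is_Cderive F (g t) l -> is_curve_derive g t v -> is_curve_derive (fun s => F (g s)) t (l * v).
Proof.
intros HF Hg; apply curve_derive_eps; intros eps He.
rewrite Cderive_eps in HF; rewrite curve_derive_eps in Hg.
(* A dominates both 1 + |v|, a Lipschitz constant of g near t, and the factor |l|; each of the two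
   error terms then receives at most half of eps. *)
set (A := 1 + Cmod v + Cmod l).
assert (HA : 1 <= A) by (unfold A; generalize (Cmod_ge_0 v) (Cmod_ge_0 l); lra).
assert (HeA : 0 < eps / (2 * A)) by (apply Rdiv_lt_0_compat; lra).
destruct (HF _ HeA) as [d1 [Hd1 h1]].
destruct (Hg (Rmin 1 (eps / (2 * A)))) as [d2 [Hd2 h2]].
{ apply Rmin_pos; [lra|exact HeA]. }
exists (Rmin d2 (d1 / A)); split.
{ apply Rmin_pos; [exact Hd2|apply Rdiv_lt_0_compat; lra]. }
intros s Hs.
specialize (h2 s (Rlt_le_trans _ _ _ Hs (Rmin_l _ _))).
assert (Hs1 : Rabs (s - t) < d1 / A) by apply (Rlt_le_trans _ _ _ Hs (Rmin_r _ _)).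
assert (P := Rabs_pos (s - t)).
assert (B : Cmod (g s - g t) <= A * Rabs (s - t)).
{ replace (g s - g t)%C with ((g s - g t - RtoC (s - t) * v) + RtoC (s - t) * v)%C by ring.
  apply Rle_trans with (1 := Cmod_triangle _ _).
  rewrite Cmod_mult, Cmod_R.
  assert (Rmin 1 (eps / (2 * A)) * Rabs (s - t) <= 1 * Rabs (s - t)).
  { apply Rmult_le_compat_r; [exact P|apply Rmin_l]. }
  assert (0 <= Cmod l) by apply Cmod_ge_0.
  unfold A; nra. }
assert (B1 : Cmod (g s - g t) < d1).
{ apply Rle_lt_trans with (1 := B).
  apply (Rmult_lt_compat_l A) in Hs1; [|lra].
  replace d1 with (A * (d1 / A)) by (field; lra); exact Hs1. }
specialize (h1 _ B1).
replace (F (g s) - F (g t) - RtoC (s - t) * (l * v))%C with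
  ((F (g s) - F (g t) - (g s - g t) * l) + (g s - g t - RtoC (s - t) * v) * l)%C by ring.
apply Rle_trans with (1 := Cmod_triangle _ _).
rewrite Cmod_mult.
assert (E1 : eps / (2 * A) * Cmod (g s - g t) <= eps / 2 * Rabs (s - t)).
{ replace (eps / 2 * Rabs (s - t)) with (eps / (2 * A) * (A * Rabs (s - t))) by (field; lra).
  apply Rmult_le_compat_l; lra. }
assert (E2 : Cmod (g s - g t - RtoC (s - t) * v) * Cmod l <= eps / 2 * Rabs (s - t)).
{ apply Rle_trans with (eps / (2 * A) * Rabs (s - t) * A).
  - apply Rmult_le_compat; [apply Cmod_ge_0|apply Cmod_ge_0| |].
    + apply Rle_trans with (1 := h2), Rmult_le_compat_r; [exact P|apply Rmin_r].
    + unfold A; generalize (Cmod_ge_0 v); lra.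
  - right; field; lra. }
lra.
Qed.

(** * Polar coordinates and integrals depending on a parameter *)

Lemma polar_mult (r th : R) : polar r th = (RtoC r * polar 1 th)%C.
Proof. unfold polar; apply injective_projections; cbn; ring. Qed.

Lemma Cmod_polar (r th : R) : 0 <= r -> Cmod (polar r th) = r.
Proof.
intros Hr; unfold Cmod, polar; cbn [fst snd].
replace ((r * cos th) ^ 2 + (r * sin th) ^ 2) with (r ^ 2 * (Rsqr (sin th) + Rsqr (cos th)))
  by (unfold Rsqr; ring).
rewrite sin2_cos2, Rmult_1_r; replace (r ^ 2) with (r * r) by ring; now apply sqrt_square.
Qed.

Lemma polar_radial (c : C) (r th : R) :
  is_curve_derive (fun s => c + polar s th)%C r (polar 1 th).
Proof. split; cbn; auto_derive; trivial; ring. Qed.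

Lemma polar_angular (c : C) (r th : R) :
  is_curve_derive (fun s => c + polar r s)%C th (Ci * polar r th).
Proof. split; cbn; auto_derive; trivial; ring. Qed.

Lemma polar_cont (c : C) (r th : R) :
  @continuous (prod_UniformSpace R_UniformSpace R_UniformSpace) C_UniformSpace
    (fun p => c + polar (fst p) (snd p))%C (r, th).
Proof.
apply continuous_C_iff; split; cbn;
(apply (@continuous_plus _ R_AbsRing R_NormedModule); [apply continuous_const|]);
apply (@continuous_mult _ R_AbsRing);
try apply (@continuous_fst R_UniformSpace R_UniformSpace).
- apply (continuous_comp (fun p : R * R => snd p) cos); [apply (@continuous_snd R_UniformSpace R_UniformSpace)|apply continuous_cos].
- apply (continuous_comp (fun p : R * R => snd p) sin); [apply (@continuous_snd R_UniformSpace R_UniformSpace)|apply continuous_sin].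
Qed.

Lemma polar_cont_angular (c : C) (r th : R) :
  @continuous R_UniformSpace C_UniformSpace (fun t => c + polar r t)%C th.
Proof.
apply continuous_C_iff; split; cbn;
(apply (@continuous_plus _ R_AbsRing R_NormedModule); [apply continuous_const|]);
(apply (@continuous_mult _ R_AbsRing); [apply continuous_const|]).
- apply continuous_cos.
- apply continuous_sin.
Qed.

Lemma continuity_2d_pt_section (G : R -> R -> R) (x t : R) :
  continuity_2d_pt G x t -> continuous (G x) t.
Proof.
intros H; apply continuity_2d_pt_filterlim in H.
apply (continuous_comp_2 (fun _ : R => x) (fun t : R => t) G).
- apply continuous_const.
- apply continuous_id.
- exact H.
Qed.

Lemma RInt_param_derive (G D : R -> R -> R) (a b x d : R) :
  0 < d ->
  (forall y, Rabs (y - x) < d -> forall t, is_derive (fun u => G u t) y (D y t) /\ continuous (G y) t) ->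
  (forall t, continuity_2d_pt D x t) ->
  is_derive (fun y => RInt (G y) a b) x (RInt (D x) a b).
Proof.
intros Hd H Hc.
assert (Hx : Rabs (x - x) < d) by (rewrite Rminus_diag, Rabs_R0; exact Hd).
replace (RInt (D x) a b) with (RInt (fun t => Derive (fun u => G u t) x) a b).
2:{ apply RInt_ext; intros t _; apply is_derive_unique, (H x Hx). }
apply is_derive_RInt_param.
- exists (mkposreal d Hd); intros y Hy t _; exists (D y t); apply (H y Hy).
- intros t _; apply continuity_2d_pt_ext_loc with (2 := Hc t).
  exists (mkposreal d Hd); intros u v Hu _; symmetry; apply is_derive_unique, (H u Hu).
- exists (mkposreal d Hd); intros y Hy; apply (@ex_RInt_continuous R_CompleteNormedModule).
  intros t _; apply (H y Hy).
Qed.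

Lemma RInt_param_cont (G : R -> R -> R) (a b x : R) : a <= b ->
  (forall y t, continuity_2d_pt G y t) -> continuous (fun y => RInt (G y) a b) x.
Proof.
intros Hab H.
assert (HI : forall y, ex_RInt (G y) a b).
{ intros y; apply (@ex_RInt_continuous R_CompleteNormedModule); intros t _; now apply continuity_2d_pt_section. }
apply filterlim_locally; intros eps.
(* The added 1 keeps the denominator positive when a = b and makes the final inequality strict. *)
assert (He : 0 < eps / (b - a + 1)) by (apply Rdiv_lt_0_compat; [apply cond_pos|lra]).
destruct (uniform_continuity_2d_1d' G a b x (fun t _ => H x t) (mkposreal _ He)) as [d Hd].
exists d; intros y Hy.
change (Rabs (RInt (G y) a b - RInt (G x) a b) < eps).
rewrite <- (@RInt_minus R_CompleteNormedModule) by auto.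
assert (Hd0 := cond_pos d); assert (He0 := cond_pos eps).
assert (Hy' : Rabs (y - x) < d) by exact Hy.
apply Rabs_def2 in Hy'.
apply Rle_lt_trans with ((b - a) * (eps / (b - a + 1))).
- apply abs_RInt_le_const; [exact Hab| |].
  + apply (@ex_RInt_minus R_CompleteNormedModule); auto.
  + intros t Ht; left; apply (Hd t x t y); try lra.
    rewrite Rminus_diag, Rabs_R0; lra.
- replace ((b - a) * (eps / (b - a + 1))) with (eps - eps / (b - a + 1)) by (field; lra).
  simpl in He; lra.
Qed.

Lemma Re_comp_continuity_2d (F : C -> C) (c : C) (r th : R) :
  cont F (c + polar r th)%C -> continuity_2d_pt (fun r th => Re (F (c + polar r th)%C)) r th.
Proof.
intros H; apply continuity_2d_pt_filterlim.
assert (K : @continuous (prod_UniformSpace R_UniformSpace R_UniformSpace) C_UniformSpace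
    (fun p => F (c + polar (fst p) (snd p)))%C (r, th)).
{ apply (contC_comp (fun p : prod_UniformSpace R_UniformSpace R_UniformSpace => c + polar (fst p) (snd p))%C F); [apply polar_cont|exact H]. }
apply continuous_C_iff in K; apply K.
Qed.

Lemma circle_cont (F : C -> C) (c : C) (r th : R) :
  cont F (c + polar r th)%C ->
  continuous (fun t => Re (F (c + polar r t)%C)) th /\ continuous (fun t => Im (F (c + polar r t)%C)) th.
Proof.
intros H; apply continuous_C_iff.
apply (contC_comp (fun t : R_UniformSpace => c + polar r t)%C F); [apply polar_cont_angular|exact H].
Qed.

Lemma polar_period (r : R) : polar r (2 * PI) = polar r 0.
Proof. unfold polar; now rewrite cos_2PI, sin_2PI, cos_0, sin_0. Qed.

(* d/dr of the mean over a circle is, by the Cauchy-Riemann equations, the integral of a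
   theta-derivative. *)
Lemma circle_mean_annulus (F : C -> C) (c : C) (a b : R) :
  0 <= a <= b ->
  (forall r th, a <= r <= b -> cont F (c + polar r th)%C) ->
  (forall r th, a < r < b -> C1 F (c + polar r th)%C) ->
  RInt (fun th => Re (F (c + polar a th)%C)) 0 (2 * PI) =
  RInt (fun th => Re (F (c + polar b th)%C)) 0 (2 * PI).
Proof.
intros [Ha Hab] Hc HC.
assert (HPI := PI_RGT_0).
(* Clamping the radius to [a, b] makes J continuous on the whole line although F is controlled on
   the closed annulus only; the derivative is computed strictly inside, where clamping is locally
   the identity. *)
set (cl := fun x => Rmax a (Rmin b x)).
assert (Hcl : forall x, a <= cl x <= b).
{ intros x; unfold cl; split; [apply Rmax_l|apply Rmax_lub; [exact Hab|apply Rmin_l]]. }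
assert (Ecl : forall x, a <= x <= b -> cl x = x).
{ intros x Hx; unfold cl; rewrite Rmin_right by lra; now rewrite Rmax_right by lra. }
set (G := fun x th => Re (F (c + polar (cl x) th)%C)).
set (J := fun x => RInt (G x) 0 (2 * PI)).
replace (RInt (fun th => Re (F (c + polar a th)%C)) 0 (2 * PI)) with (J a).
2:{ unfold J, G; rewrite Ecl by lra; reflexivity. }
replace (RInt (fun th => Re (F (c + polar b th)%C)) 0 (2 * PI)) with (J b).
2:{ unfold J, G; rewrite Ecl by lra; reflexivity. }
assert (HJc : forall x, continuous J x).
{ intros x; apply (RInt_param_cont G); [lra|]; intros y t; unfold G.
  apply continuity_2d_pt_filterlim.
  apply (continuous_comp_2 (fun p : R * R => cl (fst p)) (fun p : R * R => snd p)
     (fun r th => Re (F (c + polar r th)%C)) (y, t)).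
  - apply (continuous_comp (fun p : R * R => fst p) cl).
    + apply (@continuous_fst R_UniformSpace R_UniformSpace).
    + unfold cl, Rmax, Rmin; clear.
      apply continuity_pt_filterlim.
      intros eps He; exists eps; split; [exact He|]; intros x [_ Hx].
      simpl in *; unfold Rdist in *.
      apply Rle_lt_trans with (2 := Hx); unfold Rabs; clear.
      repeat (destruct Rle_dec || destruct Rcase_abs); lra.
  - apply (@continuous_snd R_UniformSpace R_UniformSpace).
  - apply (proj1 (continuity_2d_pt_filterlim (fun r th => Re (F (c + polar r th)%C)) (cl y) t)).
    apply (Re_comp_continuity_2d F), Hc, Hcl. }
assert (HJd : forall x, a < x < b -> is_derive J x 0).
{ intros x Hx.
  set (D := fun r th => Re (C_derive F (c + polar r th) * (0 + polar 1 th))%C).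
  assert (Ed : exists d, 0 < d /\ forall y, Rabs (y - x) < d -> a < y < b).
  { exists (Rmin (x - a) (b - x)); split; [apply Rmin_pos; lra|].
    intros y Hy; assert (h1 := Rmin_l (x - a) (b - x)); assert (h2 := Rmin_r (x - a) (b - x)).
    apply Rabs_def2 in Hy; lra. }
  destruct Ed as [d [Hd Hy]].
  assert (HG : is_derive (fun y => RInt (fun th => Re (F (c + polar y th)%C)) 0 (2 * PI)) x
     (RInt (D x) 0 (2 * PI))).
  { apply (RInt_param_derive (fun y th => Re (F (c + polar y th)%C)) D _ _ x d Hd).
    - intros y Hyd t; specialize (Hy y Hyd); split.
      + unfold D; rewrite Cplus_0_l.
        apply (curve_derive_comp F (fun s => c + polar s t)%C); [apply C1_derive, HC, Hy|apply polar_radial].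
      + apply circle_cont, Hc; lra.
    - intros t; unfold D; apply continuity_2d_pt_filterlim.
      destruct (HC x t Hx) as [_ K].
      assert (K2 : @continuous (prod_UniformSpace R_UniformSpace R_UniformSpace) C_UniformSpace
         (fun p => C_derive F (c + polar (fst p) (snd p)) * (0 + polar 1 (snd p)))%C (x, t)).
      { apply contC_mult.
        - apply (contC_comp (fun p : prod_UniformSpace R_UniformSpace R_UniformSpace => c + polar (fst p) (snd p))%C (C_derive F)); [apply polar_cont|exact K].
        - apply (continuous_comp (fun p : R * R => snd p) (fun t => 0 + polar 1 t)%C).
          + apply (@continuous_snd R_UniformSpace R_UniformSpace).
          + apply polar_cont_angular. }
      apply continuous_C_iff in K2; destruct K2 as [K2 _].
      exact K2. }
  assert (E0 : RInt (D x) 0 (2 * PI) = 0).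
  { apply is_RInt_unique.
    apply (is_RInt_ext (fun th => / x * Im (C_derive F (c + polar x th) * (Ci * polar x th))%C)).
    { intros t _; unfold D; rewrite Cplus_0_l, (polar_mult x).
      destruct (C_derive F _) as [u v]; cbn; field; lra. }
    replace 0 with (/ x * (Im (F (c + polar x (2 * PI))%C) - Im (F (c + polar x 0)%C))) at 2
      by (rewrite polar_period; ring).
    apply (@is_RInt_scal R_NormedModule).
    apply (is_RInt_derive (fun th => Im (F (c + polar x th)%C))).
    - intros t _; apply (curve_derive_comp F (fun s => c + polar x s)%C); [apply C1_derive, HC, Hx|apply polar_angular].
    - intros t _.
      assert (K2 : @continuous R_UniformSpace C_UniformSpace
         (fun t => C_derive F (c + polar x t) * (Ci * (0 + polar x t)))%C t).
      { apply contC_mult; [|apply contC_mult; [apply contC_const|apply polar_cont_angular]].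
        apply (contC_comp (fun t : R_UniformSpace => c + polar x t)%C (C_derive F)); [apply polar_cont_angular|].
        apply (HC x t Hx). }
      apply continuous_C_iff in K2; destruct K2 as [_ K2].
      eapply continuous_ext; [|exact K2]; intros p; cbv beta; f_equal; ring. }
  rewrite E0 in HG.
  apply is_derive_ext_loc with (2 := HG).
  exists (mkposreal d Hd); intros y Hyd; unfold J, G; rewrite Ecl; [reflexivity|].
  specialize (Hy y Hyd); lra. }
destruct (MVT_gen J a b (fun _ => 0)) as [x [_ Ex]].
- rewrite Rmin_left, Rmax_right by lra; exact HJd.
- intros x _; apply continuity_pt_filterlim, HJc.
- lra.
Qed.

(** * Mean value property and Schwarz lemma *)

Lemma polar_0 (th : R) : polar 0 th = 0%C.
Proof. unfold polar; apply injective_projections; cbn; ring. Qed.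

Lemma Cmod_lt_sqr (u v : C) : Cmod u ^ 2 < Cmod v ^ 2 -> Cmod u < Cmod v.
Proof. intros H; generalize (Cmod_ge_0 u) (Cmod_ge_0 v); intros; nra. Qed.

(** Turns a bound on real parts into a bound on a modulus: F is replaced by a rotation [la * F]
    whose value at the point of interest is a nonnegative real. *)
Lemma unimodular_phase (w : C) : exists la : C, Cmod la = 1 /\ Re (la * w)%C = Cmod w.
Proof.
destruct (excluded_middle_informative (w = 0%C)) as [->|E].
{ exists 1%C; rewrite Cmod_1, Cmod_0, Cmult_0_r; split; reflexivity. }
assert (Hm := proj1 (Cmod_gt_0 _) E).
exists (Cconj w / Cmod w)%C; split.
- rewrite Cmod_div, Cmod_conj, Cmod_R, Rabs_right; try lra.
  + field; lra.
  + intros K; apply (f_equal fst) in K; cbn -[Cmod] in K; lra.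
- assert (E2 : Cmod w ^ 2 = Re w ^ 2 + Im w ^ 2) by apply Cmod2_alt.
  set (m := Cmod w) in *; clearbody m.
  destruct w as [x y]; unfold Re, Im in *; cbn in *.
  apply (Rmult_eq_reg_r m); [|lra].
  transitivity (x * (x * 1) + y * (y * 1)); [|lra]; field; lra.
Qed.

(** The circle of radius 0 has mean F c, so constancy of the means compares F c with the circle of
    radius b. The radius r1 leaves room for a singular point on one inner circle: the annuli on its
    two sides are glued there by continuity. Taking r1 = 0 means that there is no such circle. *)
Lemma mean_value_le (F : C -> C) (c : C) (b r1 M : R) :
  0 < b ->
  (forall r th, 0 <= r <= b -> cont F (c + polar r th)%C) ->
  (forall r th, 0 < r < b -> r <> r1 -> C1 F (c + polar r th)%C) ->
  (forall th, 0 <= th <= 2 * PI -> Cmod (F (c + polar b th)%C) <= M) ->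
  Cmod (F c) <= M.
Proof.
intros Hb Hc HC HM.
assert (HPI := PI_RGT_0).
destruct (unimodular_phase (F c)) as [la [Hla HGc]]; set (m := Cmod (F c)) in *.
set (G := fun z => (la * F z)%C).
assert (cG : forall r th, 0 <= r <= b -> cont G (c + polar r th)%C).
{ intros; apply contC_mult; [apply contC_const|now apply Hc]. }
assert (CG : forall r th, 0 < r < b -> r <> r1 -> C1 G (c + polar r th)%C).
{ intros; apply C1_mult; [apply C1_const|now apply HC]. }
assert (HE : RInt (fun th => Re (G (c + polar 0 th)%C)) 0 (2 * PI) =
             RInt (fun th => Re (G (c + polar b th)%C)) 0 (2 * PI)).
{ destruct (excluded_middle_informative (0 < r1 < b)) as [Hr|Hr].
  - transitivity (RInt (fun th => Re (G (c + polar r1 th)%C)) 0 (2 * PI));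
    apply circle_mean_annulus; try lra; intros; (apply cG || apply CG); lra.
  - apply circle_mean_annulus; try lra; intros; (apply cG || apply CG); lra. }
assert (E0 : RInt (fun th => Re (G (c + polar 0 th)%C)) 0 (2 * PI) = 2 * PI * m).
{ rewrite (RInt_ext _ (fun _ => m)).
  - rewrite (@RInt_const R_CompleteNormedModule); unfold scal; cbn; unfold mult; cbn; ring.
  - intros t _; rewrite polar_0, Cplus_0_r; exact HGc. }
rewrite E0 in HE.
assert (Hle : RInt (fun th => Re (G (c + polar b th)%C)) 0 (2 * PI) <= 2 * PI * M).
{ replace (2 * PI * M) with (RInt (fun _ => M) 0 (2 * PI)).
  2:{ rewrite (@RInt_const R_CompleteNormedModule); unfold scal; cbn; unfold mult; cbn; ring. }
  apply RInt_le; [lra| |apply (@ex_RInt_const R_NormedModule)|].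
  - apply (@ex_RInt_continuous R_CompleteNormedModule); intros t _.
    apply circle_cont, cG; lra.
  - intros t Ht; apply Rle_trans with (1 := Rle_abs _), Rle_trans with (1 := re_le_Cmod _).
    unfold G; rewrite Cmod_mult, Hla, Rmult_1_l; apply HM; lra. }
rewrite <- HE in Hle; apply Rmult_le_reg_l in Hle; lra.
Qed.

(** * Disk automorphisms and Schwarz's lemma *)

Section Moebius.
Variable z : C.
Hypothesis Hz : disk z.
Let T (w : C) : C := ((w + z) / (1 + Cconj z * w))%C.

Lemma moebius_den (w : C) : Cmod w <= 1 -> 1 - Cmod z <= Cmod (1 + Cconj z * w).
Proof.
intros Hw; unfold disk in Hz.
assert (H : Cmod 1 <= Cmod (1 + Cconj z * w) + Cmod (- (Cconj z * w))).
{ replace (RtoC 1) with ((1 + Cconj z * w) + (- (Cconj z * w)))%C at 1 by ring; apply Cmod_triangle. }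
rewrite Cmod_opp, Cmod_mult, Cmod_conj, Cmod_1 in H.
generalize (Cmod_ge_0 z) (Cmod_ge_0 w); intros; nra.
Qed.

Lemma moebius_den_neq0 (w : C) : Cmod w <= 1 -> (1 + Cconj z * w)%C <> 0%C.
Proof.
intros Hw E; assert (H := moebius_den w Hw); rewrite E, Cmod_0 in H; unfold disk in Hz; lra.
Qed.

(** Comes from |1 + conj z w|^2 - |w + z|^2 = (1 - |w|^2)(1 - |z|^2). It shows that T preserves the
    disk and also quantifies how close to 1 the modulus of T w is when |w| is close to 1. *)
Lemma moebius_sqr (w : C) : Cmod w <= 1 ->
  (1 - Cmod (T w) ^ 2) * Cmod (1 + Cconj z * w) ^ 2 = (1 - Cmod w ^ 2) * (1 - Cmod z ^ 2).
Proof.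
intros Hw; assert (H := moebius_den_neq0 w Hw).
unfold T; rewrite Cmod_div by exact H.
transitivity (Cmod (1 + Cconj z * w) ^ 2 - Cmod (w + z) ^ 2).
- field; apply Cmod_gt_0 in H; lra.
- rewrite !Cmod2_alt; unfold Re, Im; cbn; ring.
Qed.

Lemma moebius_C1 (w : C) : Cmod w <= 1 -> C1 T w.
Proof.
intros Hw; apply C1_div.
- apply C1_plus; [apply C1_id|apply C1_const].
- apply C1_plus; [apply C1_const|apply C1_mult; [apply C1_const|apply C1_id]].
- now apply moebius_den_neq0.
Qed.

Lemma moebius_disk (w : C) : disk w -> disk (T w).
Proof.
intros Hw; unfold disk in *; assert (Hw' : Cmod w <= 1) by lra.
assert (H := moebius_sqr w Hw'); assert (H1 := moebius_den w Hw').
generalize (Cmod_ge_0 z) (Cmod_ge_0 w) (Cmod_ge_0 (T w)); intros h1 h2 h3.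
apply Rnot_le_lt; intros K.
assert (0 < (1 - Cmod w ^ 2) * (1 - Cmod z ^ 2)) by (apply Rmult_lt_0_compat; nra).
assert (0 < Cmod (1 + Cconj z * w) ^ 2) by (apply pow_lt; lra).
assert (1 - Cmod (T w) ^ 2 <= 0) by nra.
nra.
Qed.

(* [Phi o T] is holomorphic in the disk apart from [w = -z], and its mean over |w| = rho is
   [Phi z]; let rho tend to 1. *)
Lemma schwarz_quotient_at (Phi : C -> C) :
  (forall w : C, disk w -> cont Phi w) ->
  (forall w : C, disk w -> w <> 0%C -> C1 Phi w) ->
  (forall w : C, disk w -> Cmod w * Cmod (Phi w) <= 1) ->
  Cmod (Phi z) <= 1.
Proof.
intros Hc HC HB; apply Rnot_lt_le; intros Hm; unfold disk in Hz.
set (m := Cmod (Phi z)) in *; set (m' := (1 + m) / 2).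
assert (Hm' : 1 < m' < m) by (unfold m'; lra).
set (s := Cmod z) in *; assert (Hs : 0 <= s) by apply Cmod_ge_0.
(* x is 1 - rho^2. It solves x (1 + s)/(1 - s) = 1 - 1/m'^2, so [moebius_sqr] and [moebius_den] give
   |T w| >= 1/m' on |w| = rho, whence |Phi (T w)| <= m' < m. *)
set (x := (1 - / m' ^ 2) * ((1 - s) / (1 + s))).
assert (Hi : 0 < / m' ^ 2 < 1).
{ assert (1 < m' ^ 2) by nra.
  split; [apply Rinv_0_lt_compat; lra|rewrite <- Rinv_1; apply Rinv_lt_contravar; lra]. }
assert (Hq : 0 < (1 - s) / (1 + s) <= 1).
{ split; [apply Rdiv_lt_0_compat; lra|].
  apply (Rmult_le_reg_r (1 + s)); [lra|]; unfold Rdiv; rewrite Rmult_assoc, Rinv_l; lra. }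
assert (Hx : 0 < x < 1) by (unfold x; split; [apply Rmult_lt_0_compat; lra|nra]).
set (rho := sqrt (1 - x)).
assert (Hr2 : rho ^ 2 = 1 - x) by (unfold rho; simpl; rewrite Rmult_1_r; apply sqrt_sqrt; lra).
assert (Hr0 : 0 < rho) by (apply sqrt_lt_R0; lra).
assert (Hr1 : rho < 1) by nra.
assert (ET : T 0%C = z).
{ unfold T; field. }
assert (Hdisk : forall r th, 0 <= r <= rho -> disk (0 + polar r th)%C).
{ intros r th Hr; unfold disk; rewrite Cplus_0_l, Cmod_polar; lra. }
assert (K : Cmod (Phi (T 0%C)) <= m').
(* The exceptional radius is s = |z|, because T w = 0 forces w = - z. *)
{ apply (mean_value_le (fun w => Phi (T w)) 0%C rho s m').
  - exact Hr0.
  - intros r th Hr; assert (Hd := Hdisk r th Hr).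
    apply (contC_comp T Phi); [|now apply Hc, moebius_disk].
    apply C1_cont, moebius_C1; unfold disk in Hd; lra.
  - intros r th Hr Hrs; assert (Hd := Hdisk r th (conj (Rlt_le _ _ (proj1 Hr)) (Rlt_le _ _ (proj2 Hr)))).
    apply (C1_comp Phi T); [|apply moebius_C1; unfold disk in Hd; lra].
    apply HC; [now apply moebius_disk|].
    intros E; apply Hrs.
    assert (Hn : (1 + Cconj z * (0 + polar r th))%C <> 0%C) by (apply moebius_den_neq0; unfold disk in Hd; lra).
    assert (E2 : (polar r th = - z)%C).
    { rewrite Cplus_0_l in Hn, E.
      replace (polar r th) with (T (polar r th) * (1 + Cconj z * polar r th) - z)%C.
      - rewrite E; ring.
      - unfold T; field; exact Hn. }
    rewrite <- (Cmod_polar r th), E2, Cmod_opp by lra; reflexivity.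
  - intros th _; set (w := (0 + polar rho th)%C).
    assert (Hd : disk w) by (apply Hdisk; lra).
    assert (Hw : Cmod w = rho) by (unfold w; rewrite Cplus_0_l, Cmod_polar; lra).
    assert (Hw' : Cmod w <= 1) by lra.
    assert (H := moebius_sqr w Hw'); assert (H1 := moebius_den w Hw'); fold s in H, H1.
    rewrite Hw, Hr2 in H.
    assert (HT := HB _ (moebius_disk w Hd)).
    assert (HT2 : / m' ^ 2 <= Cmod (T w) ^ 2).
    { assert (H2 : (1 - s) ^ 2 <= Cmod (1 + Cconj z * w) ^ 2) by (apply pow_incr; lra).
      assert (E : (1 - (1 - x)) * (1 - s ^ 2) = (1 - / m' ^ 2) * (1 - s) ^ 2) by (unfold x; field; nra).
      rewrite E in H; apply Rnot_lt_le; intros K.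
      assert (0 < (1 - s) ^ 2) by (apply pow_lt; lra).
      nra. }
    assert (HT3 : 1 <= Cmod (T w) * m').
    { assert (0 <= Cmod (T w)) by apply Cmod_ge_0.
      apply (Rmult_le_compat_r (m' ^ 2)) in HT2; [|nra].
      rewrite Rinv_l in HT2 by nra.
      assert (1 <= (Cmod (T w) * m') ^ 2) by nra.
      assert (0 <= Cmod (T w) * m') by (apply Rmult_le_pos; lra).
      nra. }
    fold T.
    assert (0 <= Cmod (T w)) by apply Cmod_ge_0.
    assert (0 < Cmod (T w)) by nra.
    apply (Rmult_le_reg_l (Cmod (T w))); lra. }
rewrite ET in K; fold m in K; lra.
Qed.
End Moebius.

Lemma schwarz_quotient (Phi : C -> C) :
  (forall w : C, disk w -> cont Phi w) ->
  (forall w : C, disk w -> w <> 0%C -> C1 Phi w) ->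
  (forall w : C, disk w -> Cmod w * Cmod (Phi w) <= 1) ->
  forall z, disk z -> Cmod (Phi z) <= 1.
Proof. intros; now apply schwarz_quotient_at. Qed.

Lemma disk_open (z : C) : disk z -> exists d, 0 < d /\ forall y, Cmod (y - z) < d -> disk y.
Proof.
intros Hz; exists (1 - Cmod z); unfold disk in *; split; [lra|]; intros y Hy.
replace y with (z + (y - z))%C by ring.
apply Rle_lt_trans with (1 := Cmod_triangle _ _); lra.
Qed.

(** The Carathéodory quotient of F at 0 extends F(w)/w continuously to the origin, and this
    extension satisfies the hypotheses of [schwarz_quotient]. *)
Lemma schwarz (F : C -> C) :
  (forall w : C, disk w -> C1 F w) -> F 0%C = 0%C -> (forall w : C, disk w -> Cmod (F w) <= 1) ->
  forall z, disk z -> Cmod (F z) <= Cmod z.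
Proof.
intros HC H0 HB z Hz.
assert (D0 : disk 0%C) by (unfold disk; rewrite Cmod_0; lra).
destruct (proj1 (caratheodory _ _ _) (C1_derive _ _ (HC _ D0))) as [q [Hq [_ Eq]]].
set (Phi := fun w : C => if excluded_middle_informative (w = 0%C) then q 0%C else (F w / w)%C).
assert (EPhi : forall w, F w = (w * Phi w)%C).
{ intros w; unfold Phi; destruct (excluded_middle_informative (w = 0%C)) as [->|n].
  - rewrite H0; ring.
  - field; exact n. }
assert (Eloc : forall w : C, w <> 0%C -> exists d, 0 < d /\ forall y, Cmod (y - w) < d -> (F y / y)%C = Phi y).
{ intros w Hw; destruct (cont_neq0 _ _ (contC_id w) Hw) as [d [Hd H1]].
  exists d; split; [exact Hd|]; intros y Hy; unfold Phi.
  destruct (excluded_middle_informative (y = 0%C)) as [->|n]; [now elim (H1 _ Hy)|reflexivity]. }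
assert (CPhi : forall w : C, disk w -> w <> 0%C -> C1 Phi w).
{ intros w Dw Hw; destruct (Eloc w Hw) as [d [Hd E]].
  assert (K : C1 (fun y => F y / y)%C w) by (apply C1_div; [now apply HC|apply C1_id|exact Hw]).
  exact (C1_ext_loc _ _ _ _ Hd E K). }
assert (cPhi : forall w, disk w -> cont Phi w).
{ intros w Dw; destruct (excluded_middle_informative (w = 0%C)) as [->|n]; [|now apply C1_cont, CPhi].
  apply (continuous_ext q); [|exact Hq].
  intros w; change C in w; unfold Phi.
  destruct (excluded_middle_informative (w = 0%C)) as [->|n]; [reflexivity|].
  assert (E := Eq w); rewrite H0 in E.
  change (q w = F w / w)%C; replace (F w) with (F w - 0)%C by ring; rewrite E; field; exact n. }
assert (K : Cmod (Phi z) <= 1).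
2:{ rewrite EPhi, Cmod_mult; generalize (Cmod_ge_0 z); nra. }
apply (schwarz_quotient Phi); auto.
intros w Hw; rewrite <- Cmod_mult, <- EPhi; now apply HB.
Qed.

(** * Complex power series *)

Definition is_Cseries (c : nat -> C) (l : C) : Prop := @is_series C_AbsRing C_NormedModule c l.

Lemma sum_n_Re_Im (c : nat -> C) (n : nat) :
  @sum_n (NormedModule.AbelianMonoid C_AbsRing C_NormedModule) c n =
  (sum_n (fun k => Re (c k)) n, sum_n (fun k => Im (c k)) n).
Proof.
induction n as [|n IH].
- rewrite !sum_O; apply surjective_pairing.
- rewrite !sum_Sn, IH; reflexivity.
Qed.

Lemma is_Cseries_iff (c : nat -> C) (l : C) :
  is_Cseries c l <-> is_series (fun k => Re (c k)) (Re l) /\ is_series (fun k => Im (c k)) (Im l).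
Proof.
unfold is_Cseries, is_series; split.
- intros H; split.
  + apply (filterlim_ext (fun n => fst (@sum_n (NormedModule.AbelianMonoid C_AbsRing C_NormedModule) c n))).
    { intros n; now rewrite sum_n_Re_Im. }
    apply (filterlim_comp _ _ _ _ (fun p : R * R => fst p) _ _ _ H).
    destruct l as [x y]; apply (@continuous_fst R_UniformSpace R_UniformSpace).
  + apply (filterlim_ext (fun n => snd (@sum_n (NormedModule.AbelianMonoid C_AbsRing C_NormedModule) c n))).
    { intros n; now rewrite sum_n_Re_Im. }
    apply (filterlim_comp _ _ _ _ (fun p : R * R => snd p) _ _ _ H).
    destruct l as [x y]; apply (@continuous_snd R_UniformSpace R_UniformSpace).
- intros [H1 H2].
  apply (filterlim_ext (fun n => (sum_n (fun k => Re (c k)) n, sum_n (fun k => Im (c k)) n))).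
  { intros n; symmetry; apply sum_n_Re_Im. }
  intros P [eps HP].
  specialize (H1 (ball (Re l) eps) (locally_ball _ _)).
  specialize (H2 (ball (Im l) eps) (locally_ball _ _)).
  destruct H1 as [N1 H1], H2 as [N2 H2].
  exists (Nat.max N1 N2); intros n Hn; apply HP; split; [apply H1|apply H2]; lia.
Qed.

Lemma is_Cseries_unique (c : nat -> C) (l l' : C) : is_Cseries c l -> is_Cseries c l' -> l = l'.
Proof.
intros [h1 h2]%is_Cseries_iff [h3 h4]%is_Cseries_iff.
apply is_series_unique in h1, h2, h3, h4.
apply injective_projections; [rewrite h1 in h3; exact h3|rewrite h2 in h4; exact h4].
Qed.

Lemma is_Cseries_ext (c d : nat -> C) (l : C) : (forall n, c n = d n) -> is_Cseries c l -> is_Cseries d l.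
Proof. apply is_series_ext. Qed.

Lemma is_Cseries_plus (c d : nat -> C) (l m : C) :
  is_Cseries c l -> is_Cseries d m -> is_Cseries (fun n => c n + d n)%C (l + m)%C.
Proof. apply (@is_series_plus C_AbsRing C_NormedModule). Qed.

Lemma is_Cseries_scal (k : C) (c : nat -> C) (l : C) :
  is_Cseries c l -> is_Cseries (fun n => k * c n)%C (k * l)%C.
Proof. apply (@is_series_scal C_AbsRing C_NormedModule). Qed.

Lemma is_Cseries_shift (c : nat -> C) (l : C) :
  is_Cseries c l -> is_Cseries (fun n => c (S n)) (l - c 0%nat)%C.
Proof.
intros H; apply (@is_series_incr_1 C_AbsRing C_NormedModule).
match goal with |- is_series _ ?x => replace x with l; [exact H|] end.
change (l = (l - c 0%nat) + c 0%nat)%C; ring.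
Qed.

Lemma is_Cseries_unshift (c : nat -> C) (l : C) :
  is_Cseries (fun n => c (S n)) l -> is_Cseries c (l + c 0%nat)%C.
Proof.
intros H; apply (@is_series_decr_1 C_AbsRing C_NormedModule).
match goal with |- is_series _ ?x => replace x with l; [exact H|] end.
change (l = (l + c 0%nat) + - c 0%nat)%C; ring.
Qed.

Lemma ex_Cseries (c : nat -> C) (b : nat -> R) :
  (forall n, Cmod (c n) <= b n) -> ex_series b -> exists l, is_Cseries c l.
Proof.
intros H Hb.
destruct (@ex_series_le R_AbsRing R_CompleteNormedModule (fun k => Re (c k)) b) as [x Hx]; [|exact Hb|].
{ intros n; apply Rle_trans with (2 := H n), re_le_Cmod. }
destruct (@ex_series_le R_AbsRing R_CompleteNormedModule (fun k => Im (c k)) b) as [y Hy]; [|exact Hb|].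
{ intros n; apply Rle_trans with (2 := H n), Rle_trans with (2 := Rmax_Cmod _), Rmax_r. }
exists (x, y); apply is_Cseries_iff; split; assumption.
Qed.

Lemma Cmod_le_2 (c : C) (B : R) : Rabs (Re c) <= B -> Rabs (Im c) <= B -> Cmod c <= 2 * B.
Proof.
intros h1 h2; replace c with (RtoC (Re c) + Ci * RtoC (Im c))%C.
2:{ destruct c as [x y]; unfold Re, Im; apply injective_projections; cbn; ring. }
apply Rle_trans with (1 := Cmod_triangle _ _).
rewrite Cmod_mult, Cmod_Ci, !Cmod_R; lra.
Qed.

(** The factor 2 is the price of estimating real and imaginary parts separately; it is absorbed by
    the choice of radius when the bound is applied. *)
Lemma Cseries_bound (c : nat -> C) (l : C) (b : nat -> R) :
  is_Cseries c l -> (forall n, Cmod (c n) <= b n) -> ex_series b -> Cmod l <= 2 * Series b.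
Proof.
intros [h1 h2]%is_Cseries_iff H Hb.
assert (Hre : forall n, Rabs (Re (c n)) <= b n).
{ intros n; apply Rle_trans with (2 := H n), re_le_Cmod. }
assert (Him : forall n, Rabs (Im (c n)) <= b n).
{ intros n; apply Rle_trans with (2 := H n), Rle_trans with (2 := Rmax_Cmod _), Rmax_r. }
assert (K : forall u : nat -> R, (forall n, Rabs (u n) <= b n) -> Rabs (Series u) <= Series b).
{ intros u Hu; apply Rle_trans with (Series (fun n => Rabs (u n))).
  - apply Series_Rabs; apply (@ex_series_le R_AbsRing R_CompleteNormedModule _ b); [|exact Hb].
    intros n; unfold norm; cbn; unfold abs; cbn; rewrite Rabs_Rabsolu; apply Hu.
  - apply Series_le; [|exact Hb]; intros n; split; [apply Rabs_pos|apply Hu]. }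
apply Cmod_le_2.
- rewrite <- (is_series_unique _ _ h1); now apply K.
- rewrite <- (is_series_unique _ _ h2); now apply K.
Qed.

Lemma pow_n_Cpow (z : C) (n : nat) : @pow_n C_Ring z n = (z ^ n)%C.
Proof. induction n as [|n IH]; [reflexivity|]; simpl; rewrite IH; reflexivity. Qed.

Lemma has_expansion_iff (f : C -> C) (a : nat -> C) :
  has_expansion f a <-> forall z, disk z -> is_Cseries (fun n => a n * z ^ n)%C (f z).
Proof.
unfold has_expansion, is_pseries; split; intros H z Hz; specialize (H z Hz);
(eapply is_series_ext; [|exact H]); intros n; cbv beta; rewrite <- (pow_n_Cpow z n); apply Cmult_comm.
Qed.

(** Meant for moduli of complex coefficients, so that convergence radii and [PS_derive] of real
    power series become available. *)
Definition abs_conv (b : nat -> R) : Prop :=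
  forall r, 0 <= r < 1 -> ex_series (fun n => b n * r ^ n).

Lemma CV_radius_ge_1 (b : nat -> R) :
  (forall r, 0 <= r < 1 -> ex_series (fun n => b n * r ^ n)) -> Rbar_le 1 (CV_radius b).
Proof.
intros H; apply Rbar_not_lt_le; intros K.
assert (K0 := CV_radius_ge_0 b).
destruct (CV_radius b) as [x| |] eqn:E; cbn in *; try tauto.
assert (Hm : 0 <= (x + 1) / 2 < 1) by lra.
apply (CV_disk_outside b ((x + 1) / 2)).
- rewrite E; cbn; rewrite Rabs_right; lra.
- apply ex_series_lim_0, H, Hm.
Qed.

Lemma abs_conv_derive (b : nat -> R) : abs_conv b -> abs_conv (PS_derive b).
Proof.
intros H r Hr.
assert (K := CV_radius_ge_1 b H); rewrite <- CV_radius_derive in K.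
assert (L : Rbar_lt (Rabs r) (CV_radius (PS_derive b))).
{ apply Rbar_lt_le_trans with (2 := K); cbn; rewrite Rabs_right; lra. }
now apply ex_series_Rabs, CV_disk_inside.
Qed.

Lemma Cpow_R (x : R) (n : nat) : (RtoC x ^ n)%C = RtoC (x ^ n).
Proof. induction n as [|n IH]; [reflexivity|]; simpl; rewrite IH; now rewrite RtoC_mult. Qed.

(** Convergence at the points r of [0, 1) already gives the real series of Re a_n and of Im a_n a
    radius of at least 1, hence absolute convergence of both. *)
Lemma has_expansion_abs_conv (f : C -> C) (a : nat -> C) :
  has_expansion f a -> abs_conv (fun n => Cmod (a n)).
Proof.
intros H; rewrite has_expansion_iff in H.
assert (K : forall r, 0 <= r < 1 -> ex_series (fun n => Re (a n) * r ^ n) /\ ex_series (fun n => Im (a n) * r ^ n)).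
{ intros r Hr; assert (D : disk (RtoC r)) by (unfold disk; rewrite Cmod_R, Rabs_right; lra).
  specialize (H _ D); apply is_Cseries_iff in H; destruct H as [h1 h2].
  split; [exists (Re (f r))|exists (Im (f r))]; (eapply is_series_ext; [|eassumption]);
  intros n; cbv beta; rewrite Cpow_R; unfold Re, Im; destruct (a n); cbn; lra. }
intros r Hr.
assert (L1 : ex_series (fun n => Rabs (Re (a n) * r ^ n))).
{ apply CV_disk_inside; apply Rbar_lt_le_trans with 1.
  - cbn; rewrite Rabs_right; lra.
  - apply CV_radius_ge_1; intros s Hs; apply (K s Hs). }
assert (L2 : ex_series (fun n => Rabs (Im (a n) * r ^ n))).
{ apply CV_disk_inside; apply Rbar_lt_le_trans with 1.
  - cbn; rewrite Rabs_right; lra.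
  - apply CV_radius_ge_1; intros s Hs; apply (K s Hs). }
apply (@ex_series_le R_AbsRing R_CompleteNormedModule _
  (fun n => Rabs (Re (a n) * r ^ n) + Rabs (Im (a n) * r ^ n))).
2:{ apply (@ex_series_plus R_AbsRing R_NormedModule); assumption. }
intros n; unfold norm; cbn; unfold abs; cbn.
assert (Hp : 0 <= r ^ n) by (apply pow_le; lra).
rewrite !Rabs_mult, (Rabs_right (r ^ n)), <- Rmult_plus_distr_r by lra.
apply Rmult_le_compat_r; [exact Hp|].
rewrite Rabs_right by (apply Rle_ge, Cmod_ge_0).
replace (a n) with (RtoC (Re (a n)) + Ci * RtoC (Im (a n)))%C at 1.
2:{ destruct (a n) as [x y]; unfold Re, Im; apply injective_projections; cbn; ring. }
apply Rle_trans with (1 := Cmod_triangle _ _).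
rewrite Cmod_mult, Cmod_Ci, !Cmod_R; lra.
Qed.

(** First order Taylor remainder of the n-th power. At n = 0 the truncated [pred 0] is harmless
    because of the factor INR 0, so the remainder vanishes for n = 0 and n = 1. *)
Definition Cpow_rem (y z : C) (n : nat) : C := (y ^ n - z ^ n - INR n * z ^ (pred n) * (y - z))%C.

(** Induction on rem(m + 1) = y rem(m) + m z^(m - 1) (y - z)^2. The product of two INR factors is
    the one that [PS_derive] produces when applied twice. *)
Lemma Cpow_rem_bound (y z : C) (r : R) (n : nat) : Cmod y <= r -> Cmod z <= r ->
  Cmod (Cpow_rem y z (S (S n))) <= INR (S (S n)) * INR (S n) * r ^ n * Cmod (y - z) ^ 2.
Proof.
intros Hy Hz; assert (Hr : 0 <= r) by (apply Rle_trans with (2 := Hy), Cmod_ge_0).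
assert (H2 : 0 <= Cmod (y - z) ^ 2) by apply pow2_ge_0.
induction n as [|n IH].
- replace (Cpow_rem y z 2) with ((y - z) * (y - z))%C.
  + rewrite Cmod_mult; simpl; nra.
  + unfold Cpow_rem; simpl; rewrite RtoC_plus; ring.
- replace (Cpow_rem y z (S (S (S n)))) with
    (y * Cpow_rem y z (S (S n)) + INR (S (S n)) * z ^ (S n) * ((y - z) * (y - z)))%C.
  2:{ unfold Cpow_rem; rewrite (S_INR (S (S n))), RtoC_plus; simpl pred.
      change (y ^ S (S (S n)))%C with (y * y ^ S (S n))%C.
      change (z ^ S (S (S n)))%C with (z * (z * z ^ S n))%C.
      change (z ^ S (S n))%C with (z * z ^ S n)%C; ring. }
  apply Rle_trans with (1 := Cmod_triangle _ _).
  rewrite !Cmod_mult, Cmod_pow, Cmod_R.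
  assert (Hn := pos_INR n).
  assert (Hp : 0 <= r ^ n) by (apply pow_le; exact Hr).
  assert (E1 : Cmod y * Cmod (Cpow_rem y z (S (S n))) <=
     r * (INR (S (S n)) * INR (S n) * r ^ n * Cmod (y - z) ^ 2)).
  { apply Rmult_le_compat; [apply Cmod_ge_0|apply Cmod_ge_0|exact Hy|exact IH]. }
  assert (E2 : Cmod z ^ S n <= r ^ S n) by (apply pow_incr; split; [apply Cmod_ge_0|exact Hz]).
  rewrite Rabs_right by (apply Rle_ge, pos_INR).
  assert (E3 : INR (S (S n)) * Cmod z ^ S n * (Cmod (y - z) * Cmod (y - z)) <=
     INR (S (S n)) * r ^ S n * Cmod (y - z) ^ 2).
  { replace (Cmod (y - z) * Cmod (y - z)) with (Cmod (y - z) ^ 2) by ring.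
    apply Rmult_le_compat_r; [exact H2|apply Rmult_le_compat_l; [apply pos_INR|exact E2]]. }
  rewrite !S_INR in *; simpl pow in *.
  assert (0 <= r * r ^ n * (Cmod (y - z) * (Cmod (y - z) * 1))).
  { apply Rmult_le_pos; [apply Rmult_le_pos; assumption|exact H2]. }
  nra.
Qed.

(** Termwise differentiation: the sum of the remainders of a_n z^n is at most |y - z|^2 times twice
    the second derived series of the moduli at a radius r with |z| < r < 1. Outside the disk f1
    takes arbitrary chosen values. *)
Lemma has_expansion_derive (f : C -> C) (a : nat -> C) : has_expansion f a ->
  exists f1, has_expansion f1 (fun n => INR (S n) * a (S n))%C /\
    forall z, disk z -> is_Cderive f z (f1 z).
Proof.
intros H; assert (A := has_expansion_abs_conv f a H).
rewrite has_expansion_iff in H.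
assert (A1 := abs_conv_derive _ A); assert (A2 := abs_conv_derive _ A1).
assert (Ef : forall z, exists l, disk z -> is_Cseries (fun n => INR (S n) * a (S n) * z ^ n)%C l).
{ intros z; destruct (excluded_middle_informative (disk z)) as [Hz|Hz]; [|exists 0%C; tauto].
  destruct (ex_Cseries (fun n => INR (S n) * a (S n) * z ^ n)%C
    (fun n => PS_derive (fun n => Cmod (a n)) n * Cmod z ^ n)) as [l Hl].
  - intros n; rewrite !Cmod_mult, Cmod_pow, Cmod_R, Rabs_right by (apply Rle_ge, pos_INR); apply Rle_refl.
  - apply A1; split; [apply Cmod_ge_0|exact Hz].
  - exists l; intros _; exact Hl. }
apply choice in Ef; destruct Ef as [f1 Hf1]; exists f1; split; [now apply has_expansion_iff|].
intros z Hz; unfold disk in Hz.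
set (r := (1 + Cmod z) / 2).
assert (Hr : Cmod z < r < 1) by (unfold r; lra).
assert (Hz0 := Cmod_ge_0 z).
set (B := Rabs (Series (fun n => PS_derive (PS_derive (fun n => Cmod (a n))) n * r ^ n))).
assert (HB : ex_series (fun n => PS_derive (PS_derive (fun n => Cmod (a n))) n * r ^ n)) by (apply A2; lra).
assert (HB0 : 0 <= B).
{ apply Rabs_pos. }
apply Cderive_eps; intros eps He.
exists (Rmin (r - Cmod z) (eps / (2 * B + 1))); split.
{ apply Rmin_pos; [lra|apply Rdiv_lt_0_compat; lra]. }
intros y Hy.
assert (Hy1 := Rlt_le_trans _ _ _ Hy (Rmin_l _ _)).
assert (Hy2 := Rlt_le_trans _ _ _ Hy (Rmin_r _ _)).
assert (Hyr : Cmod y <= r).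
{ replace y with (z + (y - z))%C by ring; apply Rle_trans with (1 := Cmod_triangle _ _); lra. }
assert (Dy : disk y) by (unfold disk; lra).
assert (S1 : is_Cseries (fun n => INR n * a n * z ^ (pred n))%C (f1 z)).
{ replace (f1 z) with (f1 z + RtoC (INR 0) * a 0%nat * z ^ (pred 0))%C by (simpl; ring).
  apply (is_Cseries_unshift (fun n => INR n * a n * z ^ (pred n))%C); now apply Hf1. }
assert (S2 : is_Cseries (fun n => a n * Cpow_rem y z n)%C (f y - f z - (y - z) * f1 z)%C).
{ replace (f y - f z - (y - z) * f1 z)%C with (f y + ((- (1)) * f z + (- (y - z)) * f1 z))%C by ring.
  eapply is_Cseries_ext.
  2:{ apply is_Cseries_plus; [apply H, Dy|].
      apply is_Cseries_plus; apply is_Cseries_scal; [apply H; exact Hz|exact S1]. }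
  intros n; unfold Cpow_rem; simpl; ring. }
(* The two lowest remainders are zero; dropping them matches the index n + 2 of [Cpow_rem_bound]. *)
apply is_Cseries_shift, is_Cseries_shift in S2.
replace (f y - f z - (y - z) * f1 z - a 0%nat * Cpow_rem y z 0 - a 1%nat * Cpow_rem y z 1)%C
  with (f y - f z - (y - z) * f1 z)%C in S2 by (unfold Cpow_rem; simpl; ring).
assert (Hb := Cseries_bound _ _
  (fun n => Cmod (y - z) ^ 2 * (PS_derive (PS_derive (fun n => Cmod (a n))) n * r ^ n)) S2).
rewrite Series_scal_l in Hb.
assert (Hh := Cmod_ge_0 (y - z)).
apply Rle_trans with (2 * (Cmod (y - z) ^ 2 * B)).
- eapply Rle_trans; [apply Hb|].
  3:{ apply Rmult_le_compat_l; [lra|]; apply Rmult_le_compat_l; [apply pow2_ge_0|apply Rle_abs]. }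
  + intros n; rewrite Cmod_mult; unfold PS_derive.
    assert (K := Cpow_rem_bound y z r n Hyr (Rlt_le _ _ (proj1 Hr))).
    apply (Rmult_le_compat_l (Cmod (a (S (S n))))) in K; [|apply Cmod_ge_0].
    apply Rle_trans with (1 := K); right; ring.
  + now apply (@ex_series_scal R_AbsRing R_NormedModule).
- apply (Rmult_lt_compat_r (2 * B + 1)) in Hy2; [|lra].
  replace (eps / (2 * B + 1) * (2 * B + 1)) with eps in Hy2 by (field; lra).
  nra.
Qed.

(** Differentiating the expansion twice makes f' differentiable, hence continuous. *)
Lemma has_expansion_C1 (f : C -> C) (a : nat -> C) : has_expansion f a ->
  forall z, disk z -> C1 f z.
Proof.
intros H; destruct (has_expansion_derive f a H) as [f1 [H1 D1]].
destruct (has_expansion_derive _ _ H1) as [f2 [_ D2]].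
intros z Hz; destruct (disk_open z Hz) as [d [Hd Ho]].
apply (C1_intro f f1 z d Hd).
- intros y Hy; now apply D1, Ho.
- now apply (Cderive_cont _ _ _ (D2 z Hz)).
Qed.

Lemma has_expansion_0 (f : C -> C) (a : nat -> C) : has_expansion f a -> f 0%C = a 0%nat.
Proof.
intros H; rewrite has_expansion_iff in H.
assert (D0 : disk 0%C) by (unfold disk; rewrite Cmod_0; lra).
apply (is_Cseries_unique _ _ _ (H _ D0)).
assert (K : is_Cseries (fun n => a n * 0 ^ n)%C (0 + a 0%nat * 0 ^ 0)%C).
{ apply (is_Cseries_unshift (fun n => a n * 0 ^ n)%C).
  apply is_Cseries_iff; split; cbn;
  (apply (is_series_ext (fun _ => 0)); [intros n; destruct (a (S n)); cbn; ring|]);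
  apply filterlim_ext with (fun _ : nat => 0); try (intros n; rewrite sum_n_const; ring);
  apply filterlim_const. }
replace (a 0%nat) with (0 + a 0%nat * 0 ^ 0)%C; [exact K|simpl; ring].
Qed.

(** * Univalent functions *)

Lemma circle_min (F : C -> C) (c : C) (r : R) :
  (forall th, cont F (c + polar r th)%C) ->
  (forall th, F (c + polar r th)%C <> 0%C) ->
  exists m, 0 < m /\ forall th, 0 <= th <= 2 * PI -> m <= Cmod (F (c + polar r th)%C).
Proof.
intros Hc H0; assert (HPI := PI_RGT_0).
destruct (continuity_ab_min (fun th => Cmod (F (c + polar r th)%C)) 0 (2 * PI)) as [t [Ht _]].
- lra.
- intros th _; apply continuity_pt_filterlim.
  apply (continuous_Cmod (fun th : R_UniformSpace => F (c + polar r th)%C)).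
  apply (contC_comp (fun th : R_UniformSpace => c + polar r th)%C F); [apply polar_cont_angular|apply Hc].
- exists (Cmod (F (c + polar r t)%C)); split; [now apply Cmod_gt_0|exact Ht].
Qed.

Lemma Cmod_polar_shift (c : C) (r th : R) : 0 <= r -> Cmod (c + polar r th - c)%C = r.
Proof. intros Hr; replace (c + polar r th - c)%C with (polar r th) by ring; now apply Cmod_polar. Qed.

Lemma disk_shift (c : C) (r th : R) : 0 <= r < 1 - Cmod c -> disk (c + polar r th)%C.
Proof.
intros Hr; unfold disk; apply Rle_lt_trans with (1 := Cmod_triangle _ _).
rewrite Cmod_polar; lra.
Qed.

Lemma polar_shift_neq (c : C) (r th : R) : 0 < r -> (c + polar r th)%C <> c.
Proof.
intros Hr E; assert (K := Cmod_polar_shift c r th ltac:(lra)); rewrite E in K.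
replace (c - c)%C with (RtoC 0) in K by ring; rewrite Cmod_0 in K; lra.
Qed.

Lemma Cplus_R_eq (z : C) (x : R) : (z + RtoC x)%C = z -> x = 0.
Proof. intros E; apply (f_equal fst) in E; cbn in E; lra. Qed.

Section Univalent.
Variable f : C -> C.
Hypothesis fC1 : forall z, disk z -> C1 f z.
Hypothesis finj : forall z w, disk z -> disk w -> f z = f w -> z = w.

(* The quotient [(z - w) / (f z - f w)], which equals [1 / f' w] at [z = w], satisfies the mean
   value property on the circle. *)
Lemma univalent_derive_lower_bound (w : C) (r m : R) :
  0 < r < 1 - Cmod w -> 0 < m -> C_derive f w <> 0%C ->
  (forall th, 0 <= th <= 2 * PI -> m <= Cmod (f (w + polar r th) - f w)) ->
  m <= r * Cmod (C_derive f w).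
Proof.
intros Hr Hm H0 Hmin.
assert (Hw : disk w) by (generalize (Cmod_ge_0 w); unfold disk; lra).
destruct (proj1 (caratheodory _ _ _) (C1_derive _ _ (fC1 _ Hw))) as [q [Hq [Eq Ef]]].
assert (Eloc : forall z : C, disk z -> z <> w -> (/ q z = (z - w) / (f z - f w))%C).
{ intros z Dz Hz.
  assert (n1 := Cminus_neq0 _ _ Hz).
  assert (n2 : (f z - f w)%C <> 0%C) by (apply Cminus_neq0; intros E; now apply Hz, finj).
  rewrite Ef; field; split; [exact n1|].
  intros E; apply n2; rewrite Ef, E; ring. }
assert (CF : forall z : C, disk z -> z <> w -> C1 (fun z => / q z)%C z).
{ intros z Dz Hz.
  destruct (disk_open z Dz) as [d1 [Hd1 o1]].
  destruct (cont_neq0 (fun z => z - w)%C z) as [d2 [Hd2 o2]].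
  { apply contC_minus; [apply contC_id|apply contC_const]. }
  { now apply Cminus_neq0. }
  apply (C1_ext_loc (fun z => (z - w) / (f z - f w))%C _ _ (Rmin d1 d2)).
  - now apply Rmin_pos.
  - intros y Hy; symmetry; apply Eloc.
    + apply o1, (Rlt_le_trans _ _ _ Hy (Rmin_l _ _)).
    + intros ->; apply (o2 w); [apply (Rlt_le_trans _ _ _ Hy (Rmin_r _ _))|ring].
  - apply C1_div.
    + apply C1_minus; [apply C1_id|apply C1_const].
    + apply C1_minus; [now apply fC1|apply C1_const].
    + apply Cminus_neq0; intros E; now apply Hz, finj. }
assert (K : Cmod (/ q w)%C <= r / m).
{ apply (mean_value_le (fun z => / q z)%C w r 0); [lra| | |].
  - intros s th Hs; destruct (Rle_lt_or_eq_dec 0 s (proj1 Hs)) as [Hs0|<-].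
    + apply C1_cont, CF; [apply disk_shift; lra|now apply polar_shift_neq].
    + rewrite polar_0, Cplus_0_r; apply contC_inv; [exact Hq|now rewrite Eq].
  - intros s th Hs _; apply CF; [apply disk_shift; lra|apply polar_shift_neq; lra].
  - intros th Hth; rewrite Eloc by (try (apply disk_shift; lra); apply polar_shift_neq; lra).
    specialize (Hmin th Hth).
    rewrite Cmod_div, Cmod_polar_shift by (try lra; intros E; rewrite E, Cmod_0 in Hmin; lra).
    apply Rmult_le_compat_l; [lra|]; apply Rinv_le_contravar; lra. }
rewrite Eq, Cmod_inv in K by exact H0.
assert (Hp := proj1 (Cmod_gt_0 _) H0).
apply (Rmult_le_compat_r (m * Cmod (C_derive f w))) in K; [|apply Rmult_le_pos; lra].
replace (/ Cmod (C_derive f w) * (m * Cmod (C_derive f w))) with m in K by (field; lra).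
replace (r / m * (m * Cmod (C_derive f w))) with (r * Cmod (C_derive f w)) in K by (field; lra).
exact K.
Qed.

(** Suppose f' z = 0. Near z the distance from f w to the image of the circle of radius r about w
    stays above m/2, so the previous lemma forces |f' w| >= m/(2r) wherever f' w is not 0, while
    continuity of f' makes |f' w| smaller than that. Hence f' vanishes on a real segment starting at
    z, f is constant there, and injectivity fails. *)
Lemma univalent_derive_neq0 (z : C) : disk z -> C_derive f z <> 0%C.
Proof.
intros Hz E0; assert (Hz' := Hz); unfold disk in Hz'.
assert (HPI := PI_RGT_0).
set (r := (1 - Cmod z) / 2).
assert (Hr : 0 < r < 1 - Cmod z) by (unfold r; lra).
destruct (circle_min (fun y => f y - f z)%C z r) as [m [Hm Hmin]].
{ intros th; apply contC_minus; [apply C1_cont, fC1, disk_shift; lra|apply contC_const]. }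
{ intros th; apply Cminus_neq0; intros E; apply finj in E; [|apply disk_shift; lra|exact Hz].
  revert E; apply polar_shift_neq; lra. }
assert (Hseg : forall s : R, Rabs s < r -> disk (z + RtoC s)%C /\ Cmod (z + RtoC s) + r < 1).
{ intros s Hs; assert (K : Cmod (z + RtoC s) <= Cmod z + Rabs s).
  { apply Rle_trans with (1 := Cmod_triangle _ _); rewrite Cmod_R; lra. }
  unfold disk, r in *; split; lra. }
assert (cR : forall s : R, @continuous R_UniformSpace C_UniformSpace (fun s => z + RtoC s)%C s).
{ intros s; apply continuous_C_iff; split; cbn.
  - apply (@continuous_plus _ R_AbsRing R_NormedModule); [apply continuous_const|apply continuous_id].
  - apply continuous_const. }
set (G := fun th s => Cmod (f ((z + RtoC s) + (0 + polar r th)) - f (z + RtoC s))%C).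
assert (HG : forall th, 0 <= th <= 2 * PI -> continuity_2d_pt (fun s th => G th s) 0 th).
{ intros th _; apply continuity_2d_pt_filterlim; unfold G.
  assert (c1 : @continuous (prod_UniformSpace R_UniformSpace R_UniformSpace) C_UniformSpace
    (fun p => z + RtoC (fst p))%C (0, th)).
  { apply (continuous_comp (fun p : R * R => fst p) (fun s => z + RtoC s)%C).
    - apply (@continuous_fst R_UniformSpace R_UniformSpace).
    - apply cR. }
  assert (c2 : @continuous (prod_UniformSpace R_UniformSpace R_UniformSpace) C_UniformSpace
    (fun p => 0 + polar r (snd p))%C (0, th)).
  { apply (continuous_comp (fun p : R * R => snd p) (fun t => 0 + polar r t)%C).
    - apply (@continuous_snd R_UniformSpace R_UniformSpace).
    - apply polar_cont_angular. }
  assert (D0 : disk (z + RtoC 0)%C) by (rewrite Cplus_0_r; exact Hz).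
  assert (D1 : disk ((z + RtoC 0) + (0 + polar r th))%C).
  { rewrite Cplus_0_r, Cplus_0_l; apply disk_shift; lra. }
  assert (c3 : @continuous (prod_UniformSpace R_UniformSpace R_UniformSpace) C_UniformSpace
    (fun p => f ((z + RtoC (fst p)) + (0 + polar r (snd p))) - f (z + RtoC (fst p)))%C (0, th)).
  { apply contC_minus.
    - apply (contC_comp (fun p : prod_UniformSpace R_UniformSpace R_UniformSpace => (z + RtoC (fst p)) + (0 + polar r (snd p)))%C f).
      + now apply contC_plus.
      + now apply C1_cont, fC1.
    - apply (contC_comp (fun p : prod_UniformSpace R_UniformSpace R_UniformSpace => z + RtoC (fst p))%C f).
      + exact c1.
      + now apply C1_cont, fC1. }
  apply continuous_Cmod in c3.
  exact c3. }
destruct (uniform_continuity_2d_1d' (fun s th => G th s) 0 (2 * PI) 0 HG (mkposreal (m / 2) ltac:(lra)))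
  as [d1 Hd1]; simpl in Hd1.
destruct (fC1 z Hz) as [_ cz]; rewrite cont_eps in cz.
destruct (cz (m / 2 / r)) as [d2 [Hd2 H2]].
{ apply Rdiv_lt_0_compat; lra. }
set (d := Rmin r (Rmin d1 d2)).
assert (Hd : 0 < d) by (repeat apply Rmin_pos; try lra; apply cond_pos).
assert (Hdr : d <= r) by apply Rmin_l.
assert (Hdd1 : d <= d1) by (apply Rle_trans with (1 := Rmin_r _ _), Rmin_l).
assert (Hdd2 : d <= d2) by (apply Rle_trans with (1 := Rmin_r _ _), Rmin_r).
assert (Hz0 : forall s, Rabs s < d -> C_derive f (z + RtoC s) = 0%C).
{ intros s Hs.
  destruct (Hseg s ltac:(lra)) as [Ds Hs1].
  destruct (excluded_middle_informative (C_derive f (z + RtoC s) = 0%C)) as [|n]; [assumption|exfalso].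
  assert (K : m / 2 <= r * Cmod (C_derive f (z + RtoC s))).
  { apply univalent_derive_lower_bound; [lra|lra|exact n|].
    intros th Hth.
    assert (Hs2 := Rabs_def2 _ _ Hs); assert (Hd1p := cond_pos d1).
    assert (U := Hd1 th 0 th s Hth ltac:(lra) Hth ltac:(lra)).
    rewrite Rminus_diag, Rabs_R0 in U; specialize (U Hd1p); apply Rabs_def2 in U.
    specialize (Hmin th Hth).
    unfold G in U; rewrite Cplus_0_r, Cplus_0_l in U; lra. }
  specialize (H2 (z + RtoC s)%C).
  replace (z + RtoC s - z)%C with (RtoC s) in H2 by ring.
  rewrite Cmod_R, E0 in H2; specialize (H2 ltac:(lra)).
  replace (C_derive f (z + RtoC s) - 0)%C with (C_derive f (z + RtoC s)) in H2 by ring.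
  apply (Rmult_lt_compat_l r) in H2; [|lra].
  replace (r * (m / 2 / r)) with (m / 2) in H2 by (field; lra); lra. }
assert (Hder : forall s, 0 <= s <= d / 2 -> is_curve_derive (fun s => f (z + RtoC s)%C) s 0%C).
{ intros s Hs; assert (Hs' : Rabs s < d) by (rewrite Rabs_right; lra).
  replace (RtoC 0) with (0 * 1)%C by ring.
  apply (curve_derive_comp f (fun s => z + RtoC s)%C).
  - rewrite <- (Hz0 s Hs'); apply C1_derive, fC1, Hseg; lra.
  - split; cbn; auto_derive; trivial; ring. }
assert (E : f (z + RtoC 0)%C = f (z + RtoC (d / 2))%C).
{ apply injective_projections.
  - apply (eq_is_derive (fun s => Re (f (z + RtoC s)%C)) 0 (d / 2)); [|lra].
    intros s Hs; apply (Hder s Hs).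
  - apply (eq_is_derive (fun s => Im (f (z + RtoC s)%C)) 0 (d / 2)); [|lra].
    intros s Hs; apply (Hder s Hs). }
rewrite Cplus_0_r in E; apply finj in E; [|exact Hz|apply Hseg; rewrite Rabs_right; lra].
symmetry in E; apply Cplus_R_eq in E; lra.
Qed.

(** If f omits w near z, the centre bound applied to 1/(f - w) makes |f z - w| at least the minimum
    of |f - w| on a small circle, which is at least m/2 when |w - f z| < m/2. *)
Lemma univalent_open (z : C) (eps : R) : disk z -> 0 < eps ->
  exists d, 0 < d /\ forall w, Cmod (w - f z) < d -> exists y, disk y /\ Cmod (y - z) < eps /\ f y = w.
Proof.
intros Hz He; assert (Hz' := Hz); unfold disk in Hz'.
set (r := Rmin eps (1 - Cmod z) / 2).
assert (Hm0 : 0 < Rmin eps (1 - Cmod z)) by (apply Rmin_pos; lra).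
assert (Hr : 0 < r < 1 - Cmod z) by (unfold r; generalize (Rmin_r eps (1 - Cmod z)); lra).
assert (Hre : r < eps) by (unfold r; generalize (Rmin_l eps (1 - Cmod z)); lra).
destruct (circle_min (fun y => f y - f z)%C z r) as [m [Hm Hmin]].
{ intros th; apply contC_minus; [apply C1_cont, fC1, disk_shift; lra|apply contC_const]. }
{ intros th; apply Cminus_neq0; intros E; apply finj in E; [|apply disk_shift; lra|exact Hz].
  revert E; apply polar_shift_neq; lra. }
exists (m / 2); split; [lra|]; intros w Hw.
destruct (excluded_middle_informative (exists y, disk y /\ Cmod (y - z) < eps /\ f y = w)) as [|n]; [assumption|exfalso].
assert (Hn : forall s th, 0 <= s <= r -> (f (z + polar s th) - w)%C <> 0%C).
{ intros s th Hs; apply Cminus_neq0; intros E; apply n; exists (z + polar s th)%C; split; [|split; [|exact E]].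
  - apply disk_shift; lra.
  - rewrite Cmod_polar_shift; lra. }
assert (K : Cmod (/ (f z - w))%C <= / (m / 2)).
{ apply (mean_value_le (fun y => / (f y - w))%C z r 0); [lra| | |].
  - intros s th Hs; apply contC_inv; [|now apply Hn].
    apply contC_minus; [apply C1_cont, fC1, disk_shift; lra|apply contC_const].
  - intros s th Hs _; apply C1_inv; [|apply Hn; lra].
    apply C1_minus; [apply fC1, disk_shift; lra|apply C1_const].
  - intros th Hth; rewrite Cmod_inv by (apply Hn; lra).
    apply Rinv_le_contravar; [lra|].
    specialize (Hmin th Hth).
    replace (f (z + polar r th) - f z)%C with ((f (z + polar r th) - w) + (w - f z))%C in Hmin by ring.
    assert (T := Cmod_triangle (f (z + polar r th) - w) (w - f z)); lra. }
assert (Hnz : (f z - w)%C <> 0%C) by (specialize (Hn 0 0); rewrite polar_0, Cplus_0_r in Hn; apply Hn; lra).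
rewrite Cmod_inv in K by exact Hnz.
apply Rinv_le_contravar in K; [|apply Rinv_0_lt_compat; now apply Cmod_gt_0].
rewrite !Rinv_inv in K.
replace (f z - w)%C with (- (w - f z))%C in K by ring; rewrite Cmod_opp in K; lra.
Qed.

(** Openness supplies, for every value near f z, a preimage y near z; the difference quotient of g
    there is 1/q y, with q the Carathéodory quotient of f, and it tends to 1/f' z. The inverse
    function theorem is thus reduced to continuity of 1/q. *)
Lemma univalent_inverse : exists g : C -> C,
  (forall z, disk z -> g (f z) = z) /\ forall z, disk z -> C1 g (f z) /\ is_Cderive g (f z) (/ C_derive f z)%C.
Proof.
assert (Eg : forall w, exists z, (exists y, disk y /\ f y = w) -> disk z /\ f z = w).
{ intros w; destruct (excluded_middle_informative (exists y, disk y /\ f y = w)) as [[y Hy]|n].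
  - exists y; intros _; exact Hy.
  - exists 0%C; intros H; contradiction. }
apply choice in Eg; destruct Eg as [g Hg]; exists g.
assert (gf : forall z, disk z -> g (f z) = z).
{ intros z Hz; destruct (Hg (f z)) as [h1 h2]; [now exists z|]; now apply finj. }
split; [exact gf|].
assert (gd : forall z, disk z -> is_Cderive g (f z) (/ C_derive f z)%C).
{ intros z Hz; assert (H0 := univalent_derive_neq0 z Hz).
  destruct (proj1 (caratheodory _ _ _) (C1_derive _ _ (fC1 _ Hz))) as [q [Hq [Eq Ef]]].
  assert (ci : cont (fun y => / q y)%C z) by (apply contC_inv; [exact Hq|now rewrite Eq]).
  rewrite cont_eps in ci.
  assert (Hq0 : q z <> 0%C) by now rewrite Eq.
  destruct (cont_neq0 q z Hq Hq0) as [d0 [Hd0 o0]].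
  apply Cderive_eps; intros eps He.
  destruct (ci eps He) as [d1 [Hd1 o1]].
  destruct (univalent_open z (Rmin d0 d1) Hz (Rmin_pos _ _ Hd0 Hd1)) as [d [Hd o]].
  exists d; split; [exact Hd|]; intros w Hw.
  destruct (o w Hw) as [y [Dy [Hy <-]]].
  rewrite !gf by assumption.
  assert (Hqy : q y <> 0%C) by (apply o0, (Rlt_le_trans _ _ _ Hy (Rmin_l _ _))).
  replace (y - z - (f y - f z) * / C_derive f z)%C with ((f y - f z) * (/ q y - / q z))%C.
  - rewrite Cmod_mult, (Rmult_comm eps); apply Rmult_le_compat_l; [apply Cmod_ge_0|].
    left; apply o1, (Rlt_le_trans _ _ _ Hy (Rmin_r _ _)).
  - rewrite Ef, Eq; field; split; assumption. }
intros z Hz; split; [|now apply gd].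
destruct (disk_open z Hz) as [d0 [Hd0 o0]].
destruct (univalent_open z d0 Hz Hd0) as [d [Hd o]].
apply (C1_intro g (fun w => / C_derive f (g w))%C (f z) d Hd).
- intros w Hw; destruct (o w Hw) as [y [Dy [_ <-]]].
  rewrite (gf y Dy); now apply gd.
- apply contC_inv.
  + apply (contC_comp g (C_derive f)); [now apply (Cderive_cont _ _ _ (gd z Hz))|].
    rewrite (gf z Hz); apply (fC1 z Hz).
  + rewrite (gf z Hz); now apply univalent_derive_neq0.
Qed.
End Univalent.

(** * Subordination and convexity *)

Lemma is_derive_nonpos (u : R -> R) (l : R) :
  is_derive u 0 l -> (forall s, 0 <= s <= 1 -> u s <= u 0) -> l <= 0.
Proof.
intros H Hu; rewrite is_derive_R_eps in H; apply Rnot_lt_le; intros Hl.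
destruct (H (l / 2)) as [d [Hd h]]; [lra|].
set (s := Rmin (d / 2) 1).
assert (Hs : 0 < s <= 1 /\ s < d).
{ unfold s; assert (h1 := Rmin_l (d / 2) 1); assert (h2 := Rmin_r (d / 2) 1).
  assert (0 < Rmin (d / 2) 1) by (apply Rmin_pos; lra); lra. }
specialize (h s); specialize (Hu s ltac:(lra)).
rewrite Rminus_0_r, (Rabs_right s) in h by lra; specialize (h ltac:(lra)).
apply Rabs_le_between in h; nra.
Qed.

Lemma disk_0 : disk 0%C.
Proof. unfold disk; rewrite Cmod_0; lra. Qed.

(** The square of the modulus is differentiable even at zeros of g, unlike the modulus itself. *)
Lemma Cmod_sqr_derive (g : R -> C) (t : R) (l : C) : is_curve_derive g t l ->
  is_derive (fun s => Cmod (g s) ^ 2) t (2 * Re (Cconj (g t) * l)%C).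
Proof.
intros [h1 h2].
apply (is_derive_ext (fun s => Re (g s) * Re (g s) + Im (g s) * Im (g s))).
{ intros s; rewrite Cmod2_alt; simpl; ring. }
replace (2 * Re (Cconj (g t) * l)%C) with
  (plus (Re l * Re (g t) + Re (g t) * Re l) (Im l * Im (g t) + Im (g t) * Im l)).
2:{ unfold plus, Re, Im; cbn; ring. }
apply (@is_derive_plus R_AbsRing R_NormedModule).
- apply (@is_derive_mult R_AbsRing (fun s => Re (g s)) (fun s => Re (g s))); [exact h1|exact h1|apply Rmult_comm].
- apply (@is_derive_mult R_AbsRing (fun s => Im (g s)) (fun s => Im (g s))); [exact h2|exact h2|apply Rmult_comm].
Qed.

Section Convex.
Variable f : C -> C.
Hypothesis fC1 : forall z, disk z -> C1 f z.
Hypothesis finj : forall z w, disk z -> disk w -> f z = f w -> z = w.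
Hypothesis f0 : f 0%C = 0%C.
Hypothesis fconv : convex_set (disk_image f).

(** Schwarz's lemma for the composition of h with the inverse of f. *)
Lemma subordination (h : C -> C) :
  (forall z, disk z -> C1 h z) -> (forall z, disk z -> disk_image f (h z)) -> h 0%C = 0%C ->
  forall z, disk z -> exists y, disk y /\ f y = h z /\ Cmod y <= Cmod z.
Proof.
intros hC hi h0 z Hz.
destruct (univalent_inverse f fC1 finj) as [g [gf Hg]].
assert (Hgd : forall w, disk w -> disk (g (h w))).
{ intros w Hw; destruct (hi w Hw) as [y [Dy <-]]; now rewrite gf. }
destruct (hi z Hz) as [y [Dy Ey]]; exists y; split; [exact Dy|split; [exact Ey|]].
rewrite <- (gf y Dy), Ey.
apply (schwarz (fun w => g (h w))); [| | |exact Hz].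
- intros w Hw; apply (C1_comp g h); [|now apply hC].
  destruct (hi w Hw) as [v [Dv <-]]; now apply Hg.
- transitivity (g (f 0%C)); [now rewrite h0, f0|apply gf, disk_0].
- intros w Hw; left; now apply Hgd.
Qed.

(** With k = f z - f (c z), the point g (f z - s k) has modulus at most |z|, with equality at s = 0,
    so its squared modulus has nonpositive derivative there. The factor conj z stands for |z|^2 / z
    and keeps the statement meaningful at z = 0. *)
Lemma convex_direction (c z : C) : Cmod c <= 1 -> disk z ->
  0 <= Re (Cconj z * ((f z - f (c * z)) / C_derive f z))%C.
Proof.
intros Hc Hz.
assert (Hcz : forall w, disk w -> disk (c * w)%C).
{ intros w Hw; unfold disk in *; rewrite Cmod_mult; generalize (Cmod_ge_0 c) (Cmod_ge_0 w); nra. }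
destruct (univalent_inverse f fC1 finj) as [g [gf Hg]].
set (k := (f z - f (c * z))%C).
assert (Hs : forall s, 0 <= s <= 1 -> Cmod (g (f z + RtoC s * - k)%C) <= Cmod z).
{ intros s Hs.
  destruct (subordination (fun w => RtoC (1 - s) * f w + RtoC s * f (c * w))%C) with (z := z) as [y [Dy [Ey Hy]]].
  - intros w Hw; apply C1_plus; (apply C1_mult; [apply C1_const|]).
    + now apply fC1.
    + apply (C1_comp f (fun w => c * w)%C); [now apply fC1, Hcz|].
      apply C1_mult; [apply C1_const|apply C1_id].
  - intros w Hw; apply fconv; [now exists w|exists (c * w)%C; split; [now apply Hcz|reflexivity]|exact Hs].
  - rewrite Cmult_0_r, f0; ring.
  - exact Hz.
  - replace (f z + RtoC s * - k)%C with (f y); [now rewrite gf|].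
    rewrite Ey; unfold k; rewrite RtoC_minus; ring. }
assert (D : is_curve_derive (fun s => g (f z + RtoC s * - k)%C) 0 (/ C_derive f z * - k)%C).
{ apply (curve_derive_comp g (fun s => f z + RtoC s * - k)%C).
  - replace (f z + RtoC 0 * - k)%C with (f z) by ring; now apply Hg.
  - split; cbn; auto_derive; trivial; ring. }
apply Cmod_sqr_derive in D; cbv beta in D.
replace (f z + RtoC 0 * - k)%C with (f z) in D by ring; rewrite (gf z Hz) in D.
apply is_derive_nonpos in D.
- replace (Cconj z * (k / C_derive f z))%C with (- (Cconj z * (/ C_derive f z * - k)))%C by (unfold Cdiv; ring).
  set (X := (Cconj z * (/ C_derive f z * - k))%C) in *; change (0 <= - Re X); lra.
- intros s H01; cbv beta.
  replace (f z + RtoC 0 * - k)%C with (f z) by ring; rewrite (gf z Hz).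
  apply pow_incr; split; [apply Cmod_ge_0|now apply Hs].
Qed.

Lemma convex_starlike (z : C) : disk z -> 0 <= Re (z * C_derive f z / f z)%C.
Proof.
intros Hz; assert (H := convex_direction 0%C z ltac:(rewrite Cmod_0; lra) Hz).
rewrite Cmult_0_l, f0 in H.
replace (f z - 0)%C with (f z) in H by ring.
destruct (excluded_middle_informative (f z = 0%C)) as [E|n].
(* Division by zero yields zero here, so the quotient contributes 0 at a zero of f. *)
{ rewrite E; unfold Cdiv, Cinv; unfold Re; cbn; unfold Rdiv; rewrite !Rmult_0_l, !Rplus_0_r, Rinv_0; right; ring. }
assert (n' := univalent_derive_neq0 f fC1 finj z Hz).
set (v := (f z / C_derive f z)%C) in *.
assert (nv : v <> 0%C).
{ intros E; apply n; replace (f z) with (v * C_derive f z)%C by (unfold v; field; exact n').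
  rewrite E; ring. }
(* With v = f z / f' z, the real part of z / v is Re (conj z v) / |v|^2: passing to the reciprocal
   keeps the sign. *)
replace (z * C_derive f z / f z)%C with (RtoC (/ Cmod v ^ 2) * (z * Cconj v))%C.
- assert (0 < / Cmod v ^ 2) by (apply Rinv_0_lt_compat, pow_lt; now apply Cmod_gt_0).
  replace (Re (RtoC (/ Cmod v ^ 2) * (z * Cconj v))%C) with (/ Cmod v ^ 2 * Re (Cconj z * v)%C).
  + apply Rmult_le_pos; lra.
  + unfold Re; destruct v as [a b], z as [x y]; cbn -[pow Cmod]; ring.
- assert (nv' := proj1 (Cmod_gt_0 _) nv).
  rewrite RtoC_inv, Cmod2_conj by (apply Rgt_not_eq, pow_lt; exact nv').
  replace (f z) with (v * C_derive f z)%C by (unfold v; field; exact n').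
  assert (Cconj v <> 0%C).
  { intros E; apply (Rlt_irrefl 0); rewrite <- Cmod_conj, E, Cmod_0 in nv'; exact nv'. }
  field; repeat split; assumption.
Qed.

Lemma convex_nonneg_derive (f2 : C -> C) (z : C) : disk z ->
  (forall w, disk w -> is_Cderive (C_derive f) w (f2 w)) ->
  0 <= Re (1 + z * f2 z / C_derive f z)%C.
Proof.
intros Hz H2.
destruct (excluded_middle_informative (z = 0%C)) as [->|nz].
{ replace (1 + 0 * f2 0%C / C_derive f 0%C)%C with (RtoC 1) by (unfold Cdiv; ring).
  unfold Re; cbn; lra. }
assert (n' := univalent_derive_neq0 f fC1 finj z Hz).
set (a := (Cconj z / C_derive f z)%C).
set (P := fun t => polar 1 t).
assert (HP : forall t, Cmod (P t) = 1) by (intros t; apply Cmod_polar; lra).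
assert (Pd : forall t, is_curve_derive P t (Ci * P t)%C).
{ intros t; unfold P; split; cbn; auto_derive; trivial; ring. }
assert (Dp : forall t, disk (P t * z)%C) by (intros t; unfold disk; rewrite Cmod_mult, HP, Rmult_1_l; exact Hz).
assert (P0 : P 0 = 1%C) by (unfold P, polar; rewrite cos_0, sin_0; apply injective_projections; cbn; ring).
set (u := fun t => Re (a * (f z - f (P t * z)))%C).
set (u1 := fun t => Re (a * - (C_derive f (P t * z) * (z * (Ci * P t))))%C).
(* D is the second derivative of u at 0 and equals |z|^2 Re (1 + z f''/f'). *)
set (D := Re (a * (f2 z * (z * z) + C_derive f z * z))%C).
assert (Hu0 : forall t, 0 <= u t).
{ intros t; assert (K := convex_direction (P t) z ltac:(rewrite HP; lra) Hz).
  unfold u, a; apply Rle_trans with (1 := K); right; f_equal; unfold Cdiv; ring. }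
assert (cw : forall (w : C) (t : R), is_curve_derive (fun t => P t * w)%C t (w * (Ci * P t))%C).
{ intros w t.
  replace (w * (Ci * P t))%C with ((1 * w + P t * 0) * (Ci * P t))%C by ring.
  apply (curve_derive_comp (fun y => y * w)%C P); [|apply Pd].
  apply Cderive_mult; [apply Cderive_id|apply Cderive_const]. }
assert (Hud : forall t, is_derive u t (u1 t)).
{ intros t.
  assert (K : is_curve_derive (fun t => a * (f z - f (P t * z)))%C t
     ((0 * (f z - f (P t * z)) + a * (0 - C_derive f (P t * z))) * (z * (Ci * P t)))%C).
  { apply (curve_derive_comp (fun y => a * (f z - f y))%C (fun t => P t * z)%C); [|apply cw].
    apply (Cderive_mult (fun _ => a) (fun y => f z - f y)%C); [apply Cderive_const|].
    apply (Cderive_minus (fun _ => f z) f); [apply Cderive_const|apply C1_derive, fC1, Dp]. }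
  destruct K as [K _]; unfold u1.
  match type of K with is_derive _ _ ?x => replace (Re (a * - (C_derive f (P t * z) * (z * (Ci * P t))))%C) with x end.
  - exact K.
  - f_equal; ring. }
assert (Hu1d : is_derive u1 0 D).
{ assert (K : is_curve_derive (fun t => (- (a * z * Ci)) * (C_derive f (P t * z) * P t))%C 0
    ((- (a * z * Ci)) * (f2 z * (z * Ci) + C_derive f z * Ci))%C).
  (* The factor P t is written as (P t z) / z, so that u1 becomes a holomorphic expression in the
     single moving point P t z. *)
  { assert (K1 := curve_derive_comp (fun y => (- (a * z * Ci)) * (C_derive f y * (y / z)))%C (fun t => P t * z)%C 0
       (0 * (C_derive f z * (z / z)) + (- (a * z * Ci)) * (f2 z * (z / z) + C_derive f z * (1 * / z + z * 0)))%C
       (z * (Ci * P 0))%C).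
    assert (K2 : is_curve_derive (fun s => - (a * z * Ci) * (C_derive f (P s * z) * (P s * z / z)))%C 0
      ((0 * (C_derive f z * (z / z)) + (- (a * z * Ci)) * (f2 z * (z / z) + C_derive f z * (1 * / z + z * 0)))
       * (z * (Ci * P 0)))%C).
    { apply K1; [|apply cw].
      rewrite P0, Cmult_1_l.
      apply (Cderive_mult (fun _ => - (a * z * Ci))%C (fun y => C_derive f y * (y / z))%C); [apply Cderive_const|].
      apply (Cderive_mult (C_derive f) (fun y => y / z)%C); [now apply H2|].
      apply (Cderive_mult (fun y => y) (fun _ => / z)%C); [apply Cderive_id|apply Cderive_const]. }
    replace ((- (a * z * Ci)) * (f2 z * (z * Ci) + C_derive f z * Ci))%C with
      ((0 * (C_derive f z * (z / z)) + (- (a * z * Ci)) * (f2 z * (z / z) + C_derive f z * (1 * / z + z * 0)))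
       * (z * (Ci * P 0)))%C.
    2:{ rewrite P0; field; exact nz. }
    destruct K2 as [k1 k2]; split.
    - eapply is_derive_ext; [|exact k1]; intros t; cbv beta; f_equal; field; exact nz.
    - eapply is_derive_ext; [|exact k2]; intros t; cbv beta; f_equal; field; exact nz. }
  destruct K as [K _].
  replace D with (Re (- (a * z * Ci) * (f2 z * (z * Ci) + C_derive f z * Ci))%C).
  - eapply is_derive_ext; [|exact K]; intros t; unfold u1; cbv beta; f_equal; ring.
  - unfold D; f_equal.
    transitivity (- (Ci * Ci) * (a * (f2 z * (z * z) + C_derive f z * z)))%C; [ring|].
    replace (Ci * Ci)%C with (- RtoC 1)%C; [ring|].
    apply injective_projections; cbn; ring. }
assert (Hu10 : u1 0 = 0).
{ unfold u1, a; rewrite P0, Cmult_1_l.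
  replace (Cconj z / C_derive f z * - (C_derive f z * (z * (Ci * 1))))%C with (- (Cconj z * z * Ci))%C
    by (field; exact n').
  destruct z as [x y]; unfold Re; cbn; ring. }
assert (Hu00 : u 0 = 0).
{ unfold u; rewrite P0, Cmult_1_l; replace (a * (f z - f z))%C with (RtoC 0) by ring; reflexivity. }
assert (HD : 0 <= D).
(* Since u and u' vanish at 0, a negative second derivative would make u' negative just to the right
   of 0, and then u itself negative. *)
{ apply Rnot_lt_le; intros HD.
  rewrite is_derive_R_eps in Hu1d.
  destruct (Hu1d (- D / 2)) as [d [Hd h]]; [lra|].
  destruct (MVT_cor2 u u1 0 (d / 2)) as [s [Es Hs]]; [lra|intros x _; apply is_derive_Reals, Hud|].
  rewrite Hu00 in Es; specialize (Hu0 (d / 2)).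
  specialize (h s); rewrite Hu10, !Rminus_0_r, (Rabs_right s) in h by lra.
  specialize (h ltac:(lra)); apply Rabs_le_between in h.
  assert (K1 : s * D < 0) by (apply Rmult_pos_neg; lra).
  assert (K2 : u1 s * (d / 2) < 0) by (apply Rmult_neg_pos; lra).
  lra. }
replace (1 + z * f2 z / C_derive f z)%C with (RtoC (/ Cmod z ^ 2) * (a * (f2 z * (z * z) + C_derive f z * z)))%C.
- replace (Re (RtoC (/ Cmod z ^ 2) * (a * (f2 z * (z * z) + C_derive f z * z)))%C) with (/ Cmod z ^ 2 * D).
  + apply Rmult_le_pos; [|exact HD].
    left; apply Rinv_0_lt_compat, pow_lt; now apply Cmod_gt_0.
  + unfold D, Re; cbn -[pow Cmod]; ring.
- unfold a; rewrite RtoC_inv, Cmod2_conj by (apply Rgt_not_eq, pow_lt; now apply Cmod_gt_0).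
  assert (Cconj z <> 0%C).
  { intros E; apply nz, Cmod_eq_0; rewrite <- Cmod_conj, E; apply Cmod_0. }
  field; repeat split; assumption.
Qed.
End Convex.

(** * Growth of convex functions *)

Lemma has_expansion_second (f : C -> C) (a : nat -> C) : has_expansion f a ->
  exists f2 : C -> C,
    (forall z, disk z -> C1 f z) /\
    (forall z, disk z -> C1 (C_derive f) z) /\
    (forall z, disk z -> C1 f2 z) /\
    (forall z, disk z -> is_Cderive (C_derive f) z (f2 z)) /\
    C_derive f 0%C = a 1%nat /\ f2 0%C = (2 * a 2%nat)%C.
Proof.
intros H0; destruct (has_expansion_derive f a H0) as [f1 [H1 D1]].
destruct (has_expansion_derive _ _ H1) as [f2 [H2 D2]].
assert (E1 : forall z, disk z -> f1 z = C_derive f z).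
{ intros z Hz; symmetry; now apply is_C_derive_unique, D1. }
exists f2; split; [|split; [|split; [|split; [|split]]]].
- exact (has_expansion_C1 _ _ H0).
- intros z Hz; destruct (disk_open z Hz) as [d [Hd o]].
  apply (C1_ext_loc f1 _ _ d Hd); [intros y Hy; now apply E1, o|now apply (has_expansion_C1 _ _ H1)].
- exact (has_expansion_C1 _ _ H2).
- intros z Hz; destruct (disk_open z Hz) as [d [Hd o]].
  apply (Cderive_ext_loc f1 _ _ _ d Hd); [intros y Hy; now apply E1, o|now apply D2].
- rewrite <- (E1 _ disk_0), (has_expansion_0 _ _ H1); simpl; ring.
- rewrite (has_expansion_0 _ _ H2); simpl; rewrite RtoC_plus; ring.
Qed.

(** Division-free form of |F z| <= (|a| + r)/(1 + |a| r) with a = F 0. It is Schwarz's lemma for (F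
    - a)/(1 - conj a F); if |a| = 1, where this denominator could vanish, the bound |F z| <= 1 is
    enough. *)
Lemma schwarz_pick_origin (F : C -> C) :
  (forall w, disk w -> C1 F w) -> (forall w, disk w -> Cmod (F w) <= 1) ->
  forall z, disk z ->
  Cmod (F z) * (1 + Cmod (F 0%C) * Cmod z) <= Cmod (F 0%C) + Cmod z.
Proof.
intros HC HB z Hz.
assert (Ha := HB _ disk_0); set (a := F 0%C) in *.
assert (HFz := HB z Hz).
assert (Hz0 := Cmod_ge_0 z); assert (Ha0 := Cmod_ge_0 a); assert (HF0 := Cmod_ge_0 (F z)).
destruct (Rle_lt_or_eq_dec _ _ Ha) as [Ha1|Ha1]; [|rewrite Ha1; nra].
assert (Hn : forall w, disk w -> (1 - Cconj a * F w)%C <> 0%C).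
{ intros w Hw E; assert (K : (Cconj a * F w)%C = 1%C).
  { replace (Cconj a * F w)%C with (1 - (1 - Cconj a * F w))%C by ring; rewrite E; ring. }
  apply (f_equal Cmod) in K; rewrite Cmod_mult, Cmod_conj, Cmod_1 in K.
  specialize (HB w Hw); generalize (Cmod_ge_0 (F w)); nra. }
assert (Hid : forall w, Cmod (1 - Cconj a * F w) ^ 2 - Cmod (F w - a) ^ 2 = (1 - Cmod a ^ 2) * (1 - Cmod (F w) ^ 2)).
{ intros w; rewrite !Cmod2_alt; unfold Re, Im; cbn; ring. }
assert (K : Cmod ((F z - a) / (1 - Cconj a * F z)) <= Cmod z).
{ apply (schwarz (fun w => (F w - a) / (1 - Cconj a * F w))%C); [| | |exact Hz].
  - intros w Hw; apply C1_div; [| |now apply Hn].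
    + apply C1_minus; [now apply HC|apply C1_const].
    + apply C1_minus; [apply C1_const|]; apply C1_mult; [apply C1_const|now apply HC].
  - fold a; replace (a - a)%C with (RtoC 0) by ring; unfold Cdiv; ring.
  - intros w Hw; rewrite Cmod_div by now apply Hn.
    assert (Hp := proj1 (Cmod_gt_0 _) (Hn w Hw)).
    apply (Rmult_le_reg_r (Cmod (1 - Cconj a * F w))); [exact Hp|].
    unfold Rdiv; rewrite Rmult_assoc, Rinv_l, Rmult_1_r, Rmult_1_l by lra.
    specialize (Hid w); specialize (HB w Hw).
    assert (0 <= (1 - Cmod a ^ 2) * (1 - Cmod (F w) ^ 2)).
    { apply Rmult_le_pos; generalize (Cmod_ge_0 (F w)); nra. }
    generalize (Cmod_ge_0 (F w - a)); nra. }
rewrite Cmod_div in K by now apply Hn.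
assert (Hp := proj1 (Cmod_gt_0 _) (Hn z Hz)).
apply (Rmult_le_compat_r (Cmod (1 - Cconj a * F z))) in K; [|lra].
unfold Rdiv in K; rewrite Rmult_assoc, Rinv_l, Rmult_1_r in K by lra.
assert (K2 : Cmod (F z - a) ^ 2 <= Cmod z ^ 2 * Cmod (1 - Cconj a * F z) ^ 2).
{ rewrite <- Rpow_mult_distr; apply pow_incr; split; [apply Cmod_ge_0|exact K]. }
assert (Hc : Re (Cconj a * F z)%C <= Cmod a * Cmod (F z)).
{ apply Rle_trans with (1 := Rle_abs _), Rle_trans with (1 := re_le_Cmod _).
  rewrite Cmod_mult, Cmod_conj; lra. }
assert (E1 : Cmod (F z - a) ^ 2 = Cmod (F z) ^ 2 + Cmod a ^ 2 - 2 * Re (Cconj a * F z)%C).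
{ rewrite !Cmod2_alt; unfold Re, Im; cbn; ring. }
assert (E2 : Cmod (1 - Cconj a * F z) ^ 2 = 1 + Cmod a ^ 2 * Cmod (F z) ^ 2 - 2 * Re (Cconj a * F z)%C).
{ rewrite !Cmod2_alt; unfold Re, Im; cbn; ring. }
rewrite E1, E2 in K2; clear E1 E2 Hid K Hp Hn.
set (x := Cmod (F z)) in *; set (al := Cmod a) in *; set (r := Cmod z) in *.
unfold disk in Hz; fold r in Hz.
set (c := Re (Cconj a * F z)%C) in *; clearbody x al r c.
assert (Hr2 : 0 <= 1 - r ^ 2) by nra.
(* The squared Schwarz inequality contains c only with the coefficient 1 - r^2 >= 0, so c may be
   replaced by its bound al x; the resulting quadratic in x factors, and its larger root is the
   desired bound. *)
assert (K3 : (x * (1 + al * r) - (al + r)) * (x * (1 - al * r) - (al - r)) <= 0).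
{ assert (c * (1 - r ^ 2) <= al * x * (1 - r ^ 2)) by (apply Rmult_le_compat_r; assumption).
  replace ((x * (1 + al * r) - (al + r)) * (x * (1 - al * r) - (al - r))) with
    (x ^ 2 - r ^ 2 * al ^ 2 * x ^ 2 - 2 * (al * x * (1 - r ^ 2)) + al ^ 2 - r ^ 2) by ring.
  lra. }
apply Rnot_lt_le; intros L.
assert (Hxr : al - r < x * (1 - al * r)).
{ assert (har : 0 <= al * r < 1) by nra.
  apply Rnot_le_lt; intros L2.
  assert (x * (1 + al * r) * (1 - al * r) <= (al - r) * (1 + al * r)) by nra.
  assert ((al + r) * (1 - al * r) < x * (1 + al * r) * (1 - al * r)) by nra.
  nra. }
nra.
Qed.

Lemma Cmod_minus1_le_plus1 (w : C) : 0 <= Re w -> Cmod (w - 1) <= Cmod (w + 1).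
Proof.
intros H; assert (E : Cmod (w + 1) ^ 2 - Cmod (w - 1) ^ 2 = 4 * Re w).
{ rewrite !Cmod2_alt; unfold Re, Im; cbn; ring. }
generalize (Cmod_ge_0 (w - 1)) (Cmod_ge_0 (w + 1)); nra.
Qed.

(* With [P = 1 + z f''/f'], the Schwarz function [(P - 1)/(P + 1)] is [z phi] with
   [phi = f''/(2 f' + z f'')] and [phi 0 = a_2]. *)
Lemma log_derivative_bound (f1 f2 : C -> C) :
  (forall z, disk z -> C1 f1 z) -> (forall z, disk z -> C1 f2 z) ->
  (forall z, disk z -> f1 z <> 0%C) -> f1 0%C = 1%C ->
  (forall z, disk z -> 0 <= Re (1 + z * f2 z / f1 z)%C) ->
  Cmod (f2 0%C / 2) <= 1 /\
  forall z, disk z -> (1 - Cmod z) * Cmod (f2 z) <= (1 + Cmod (f2 0%C / 2)) * Cmod (f1 z).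
Proof.
intros H1 H2 Hn0 E10 HP.
assert (Eden : forall z, disk z -> (2 * f1 z + z * f2 z)%C = (f1 z * ((1 + z * f2 z / f1 z) + 1))%C).
{ intros z Hz; field; now apply Hn0. }
assert (Hden : forall z, disk z -> (2 * f1 z + z * f2 z)%C <> 0%C).
{ intros z Hz; rewrite Eden by exact Hz; apply Cmult_neq_0; [now apply Hn0|].
  intros E; apply (f_equal Re) in E; specialize (HP z Hz).
  set (X := (1 + z * f2 z / f1 z)%C) in *; change (Re X + 1 = 0) in E; lra. }
set (phi := fun z => (f2 z / (2 * f1 z + z * f2 z))%C).
assert (Cphi : forall z, disk z -> C1 phi z).
{ intros z Hz; apply C1_div; [now apply H2| |now apply Hden].
  apply C1_plus; apply C1_mult; auto using C1_const, C1_id. }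
assert (Bphi : forall z, disk z -> Cmod (phi z) <= 1).
{ apply schwarz_quotient.
  - intros w Hw; now apply C1_cont, Cphi.
  - intros w Hw _; now apply Cphi.
  - intros w Hw; rewrite <- Cmod_mult; unfold phi.
    set (X := (1 + w * f2 w / f1 w)%C).
    assert (HX : (X + 1)%C <> 0%C).
    { intros E; apply (Hden w Hw); rewrite Eden by exact Hw; fold X; rewrite E; ring. }
    replace (w * (f2 w / (2 * f1 w + w * f2 w)))%C with ((X - 1) / (X + 1))%C.
    + rewrite Cmod_div by exact HX.
      assert (K := Cmod_minus1_le_plus1 X (HP w Hw)).
      assert (Hp := proj1 (Cmod_gt_0 _) HX).
      apply (Rmult_le_reg_r (Cmod (X + 1))); [exact Hp|].
      unfold Rdiv; rewrite Rmult_assoc, Rinv_l by lra; lra.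
    + rewrite (Eden w Hw); fold X.
      replace (X - 1)%C with (w * f2 w / f1 w)%C by (unfold X; ring).
      field; split; [exact HX|now apply Hn0]. }
assert (E0 : phi 0%C = (f2 0%C / 2)%C).
{ unfold phi; rewrite E10; f_equal; ring. }
split; [rewrite <- E0; apply Bphi, disk_0|].
intros z Hz.
assert (SP := schwarz_pick_origin phi Cphi Bphi z Hz); rewrite E0 in SP.
assert (Ha := Bphi _ disk_0); rewrite E0 in Ha.
set (al := Cmod (f2 0%C / 2)) in *.
assert (Hal0 : 0 <= al) by apply Cmod_ge_0.
assert (Eq : (f2 z * (1 - z * phi z))%C = (2 * phi z * f1 z)%C).
{ unfold phi; field; now apply Hden. }
apply (f_equal Cmod) in Eq; rewrite !Cmod_mult, Cmod_R, (Rabs_right 2) in Eq by lra.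
assert (L : 1 - Cmod z * Cmod (phi z) <= Cmod (1 - z * phi z)).
{ assert (T := Cmod_triangle (1 - z * phi z) (z * phi z)).
  replace (1 - z * phi z + z * phi z)%C with (RtoC 1) in T by ring.
  rewrite Cmod_1, Cmod_mult in T; lra. }
assert (Hx0 := Cmod_ge_0 (phi z)); assert (Hr0 := Cmod_ge_0 z).
assert (Hf2 := Cmod_ge_0 (f2 z)); assert (Hf1 := Cmod_ge_0 (f1 z)).
assert (Hr1 : Cmod z < 1) by exact Hz.
assert (Hx1 := Bphi z Hz).
set (x := Cmod (phi z)) in *; set (r := Cmod z) in *.
assert (Hd : 0 < 1 - r * x) by nra.
assert (M1 : Cmod (f2 z) * (1 - r * x) <= 2 * x * Cmod (f1 z)) by nra.
(* The quotient 2x(1 - r)/(1 - r x) increases with x. At the Schwarz-Pick extreme x = (al + r)/(1 +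
   al r) it equals 2(al + r)/(1 + r), and 1 + al exceeds this by (1 - al)(1 - r)/(1 + r) >= 0. *)
assert (M2 : 2 * x * (1 - r) <= (1 + al) * (1 - r * x)).
{ apply (Rmult_le_reg_r (1 + al * r)); [nra|].
  assert (0 <= (1 - al) * (1 - r) ^ 2) by (apply Rmult_le_pos; [lra|apply pow2_ge_0]).
  assert (x * (1 + al * r) * (2 - r + al * r) <= (al + r) * (2 - r + al * r)) by (apply Rmult_le_compat_r; nra).
  nra. }
apply (Rmult_le_reg_r (1 - r * x)); [exact Hd|].
apply Rle_trans with ((1 - r) * (2 * x * Cmod (f1 z))).
- rewrite Rmult_assoc; apply Rmult_le_compat_l; lra.
- replace ((1 - r) * (2 * x * Cmod (f1 z))) with (2 * x * (1 - r) * Cmod (f1 z)) by ring.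
  replace ((1 + al) * Cmod (f1 z) * (1 - r * x)) with ((1 + al) * (1 - r * x) * Cmod (f1 z)) by ring.
  now apply Rmult_le_compat_r.
Qed.

Lemma nonincreasing_of_derive (u u' : R -> R) (a b : R) : a <= b ->
  (forall s, a <= s <= b -> is_derive u s (u' s)) -> (forall s, a <= s <= b -> u' s <= 0) ->
  u b <= u a.
Proof.
intros [Hab| ->] Hd Hn; [|apply Rle_refl].
destruct (MVT_cor2 u u' a b Hab) as [s [Es Hs]]; [intros x Hx; now apply is_derive_Reals, Hd|].
specialize (Hn s ltac:(lra)); nra.
Qed.

Lemma ray_derive (z : C) (s : R) : is_curve_derive (fun s => RtoC s * z)%C s z.
Proof. destruct z as [x y]; split; unfold Re, Im; cbn; auto_derive; trivial; ring. Qed.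

Lemma ray_disk (z : C) (s : R) : disk z -> 0 <= s <= 1 -> disk (RtoC s * z)%C.
Proof.
intros Hz Hs; unfold disk in *; rewrite Cmod_mult, Cmod_R, Rabs_right by lra.
generalize (Cmod_ge_0 z); nra.
Qed.

Lemma Rpower_affine_derive (r e s : R) : 0 < 1 - s * r ->
  is_derive (fun s => Rpower (1 - s * r) e) s (Rpower (1 - s * r) e * (e * (- r / (1 - s * r)))).
Proof.
intros H; unfold Rpower; auto_derive; [exact H|].
replace (1 + - (s * r)) with (1 - s * r) by ring; field; lra.
Qed.

(** A Grönwall argument on the ray s z: the hypothesis says exactly that |h|^2 (1 - s r)^(2e) does
    not increase with s. Squaring avoids logarithms of h. *)
Lemma growth_of_log_derivative (h h' : C -> C) (e : R) :
  (forall z, disk z -> is_Cderive h z (h' z)) -> Cmod (h 0%C) = 1 ->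
  (forall z, disk z -> (1 - Cmod z) * Cmod (h' z) <= e * Cmod (h z)) ->
  forall z, disk z -> Cmod (h z) <= Rpower (1 - Cmod z) (- e).
Proof.
intros Hd H0 Hb z Hz.
assert (Hr0 := Cmod_ge_0 z); assert (Hr1 : Cmod z < 1) by exact Hz; set (r := Cmod z) in *.
assert (Hpos : forall s, 0 <= s <= 1 -> 0 < 1 - s * r) by (intros s Hs; nra).
set (u := fun s => Cmod (h (RtoC s * z)%C) ^ 2 * Rpower (1 - s * r) (2 * e)).
set (u' := fun s => (2 * Re (Cconj (h (RtoC s * z)) * (h' (RtoC s * z) * z))%C) * Rpower (1 - s * r) (2 * e)
   + Cmod (h (RtoC s * z)%C) ^ 2 * (Rpower (1 - s * r) (2 * e) * (2 * e * (- r / (1 - s * r))))).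
assert (K : u 1 <= u 0).
{ apply (nonincreasing_of_derive u u'); [lra| |].
  - intros s Hs; unfold u, u'.
    apply (@is_derive_mult R_AbsRing (fun s => Cmod (h (RtoC s * z)%C) ^ 2) (fun s => Rpower (1 - s * r) (2 * e))).
    + apply Cmod_sqr_derive, (curve_derive_comp h (fun s => RtoC s * z)%C); [now apply Hd, ray_disk|apply ray_derive].
    + now apply Rpower_affine_derive, Hpos.
    + apply Rmult_comm.
  - intros s Hs; unfold u'; specialize (Hpos s Hs).
    set (w := (RtoC s * z)%C).
    assert (Ew : Cmod w = s * r) by (unfold w; rewrite Cmod_mult, Cmod_R, Rabs_right by lra; reflexivity).
    assert (Dw : disk w) by now apply ray_disk.
    specialize (Hb w Dw); rewrite Ew in Hb.
    assert (Hre : Re (Cconj (h w) * (h' w * z))%C <= Cmod (h w) * (Cmod (h' w) * r)).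
    { apply Rle_trans with (1 := Rle_abs _), Rle_trans with (1 := re_le_Cmod _).
      rewrite !Cmod_mult, Cmod_conj; fold r; lra. }
    assert (Hp : 0 < Rpower (1 - s * r) (2 * e)) by apply exp_pos.
    set (p := Rpower (1 - s * r) (2 * e)) in *.
    replace (2 * Re (Cconj (h w) * (h' w * z))%C * p + Cmod (h w) ^ 2 * (p * (2 * e * (- r / (1 - s * r)))))
      with (2 * p * (Re (Cconj (h w) * (h' w * z))%C - Cmod (h w) ^ 2 * e * r / (1 - s * r))) by (field; lra).
    assert (Hh := Cmod_ge_0 (h w)).
    assert (Hb2 : Cmod (h' w) <= e * Cmod (h w) / (1 - s * r)).
    { apply (Rmult_le_reg_l (1 - s * r)); [exact Hpos|].
      replace ((1 - s * r) * (e * Cmod (h w) / (1 - s * r))) with (e * Cmod (h w)) by (field; lra); exact Hb. }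
    assert (Hb3 : Cmod (h w) * (Cmod (h' w) * r) <= Cmod (h w) * (e * Cmod (h w) / (1 - s * r) * r)).
    { apply Rmult_le_compat_l; [exact Hh|now apply Rmult_le_compat_r]. }
    replace (Cmod (h w) * (e * Cmod (h w) / (1 - s * r) * r)) with (Cmod (h w) ^ 2 * e * r / (1 - s * r)) in Hb3
      by (field; lra).
    nra. }
unfold u in K.
rewrite Cmult_1_l, Cmult_0_l, H0, Rmult_0_l, Rminus_0_r, Rmult_1_l in K.
unfold Rpower at 2 in K; rewrite ln_1, Rmult_0_r, exp_0 in K.
assert (Hp : 0 < Rpower (1 - r) e) by apply exp_pos.
replace (2 * e) with (e + e) in K by ring; rewrite Rpower_plus in K.
assert (Hh := Cmod_ge_0 (h z)).
assert (K2 : Cmod (h z) * Rpower (1 - r) e <= 1) by nra.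
rewrite Rpower_Ropp; apply (Rmult_le_reg_r (Rpower (1 - r) e)); [exact Hp|].
rewrite Rinv_l by lra; exact K2.
Qed.

(** Integration along the ray after rotating f z onto the positive axis; (1/b)(1 - s r)^(-b) is an
    antiderivative of the bound r (1 - s r)^(-(1 + b)). The constant 1/b is why b must stay
    positive. *)
Lemma growth_of_derivative (f f' : C -> C) (b : R) : 0 < b ->
  (forall z, disk z -> is_Cderive f z (f' z)) -> f 0%C = 0%C ->
  (forall z, disk z -> Cmod (f' z) <= Rpower (1 - Cmod z) (- (1 + b))) ->
  forall z, disk z -> Cmod (f z) <= / b * Rpower (1 - Cmod z) (- b).
Proof.
intros Hb Hd H0 HB z Hz.
assert (Hr0 := Cmod_ge_0 z); assert (Hr1 : Cmod z < 1) by exact Hz; set (r := Cmod z) in *.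
assert (Hpp : 0 < / b * Rpower (1 - r) (- b)) by (apply Rmult_lt_0_compat; [now apply Rinv_0_lt_compat|apply exp_pos]).
destruct (unimodular_phase (f z)) as [la [Hla Hlaf]]; set (m := Cmod (f z)) in *.
assert (Hpos : forall s, 0 <= s <= 1 -> 0 < 1 - s * r) by (intros s Hs; nra).
set (u := fun s => minus (Re (la * f (RtoC s * z))%C) (/ b * Rpower (1 - s * r) (- b))).
set (u' := fun s => minus (Re ((0 * f (RtoC s * z) + la * f' (RtoC s * z)) * z)%C)
   (/ b * (Rpower (1 - s * r) (- b) * (- b * (- r / (1 - s * r)))))).
assert (K : u 1 <= u 0).
{ apply (nonincreasing_of_derive u u'); [lra| |].
  - intros s Hs; unfold u, u'; apply (@is_derive_minus R_AbsRing R_NormedModule).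
    + apply (curve_derive_comp (fun y => la * f y)%C (fun s => RtoC s * z)%C); [|apply ray_derive].
      apply (Cderive_mult (fun _ => la) f); [apply Cderive_const|now apply Hd, ray_disk].
    + apply (@is_derive_scal); now apply Rpower_affine_derive, Hpos.
  - intros s Hs; unfold u'; specialize (Hpos s Hs).
    set (w := (RtoC s * z)%C).
    assert (Ew : Cmod w = s * r) by (unfold w; rewrite Cmod_mult, Cmod_R, Rabs_right by lra; reflexivity).
    specialize (HB w (ray_disk z s Hz Hs)); rewrite Ew in HB.
    assert (Hre : Re ((0 * f w + la * f' w) * z)%C <= Cmod (f' w) * r).
    { apply Rle_trans with (1 := Rle_abs _), Rle_trans with (1 := re_le_Cmod _).
      rewrite Cmult_0_l, Cplus_0_l, !Cmod_mult, Hla; fold r; lra. }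
    assert (Hre2 : Cmod (f' w) * r <= Rpower (1 - s * r) (- (1 + b)) * r) by now apply Rmult_le_compat_r.
    replace (- (1 + b)) with (- b + - (1)) in Hre2 by ring.
    rewrite Rpower_plus, (Rpower_Ropp _ 1), Rpower_1 in Hre2 by exact Hpos.
    assert (E3 : / b * (Rpower (1 - s * r) (- b) * (- b * (- r / (1 - s * r)))) = Rpower (1 - s * r) (- b) * / (1 - s * r) * r).
    { field; lra. }
    change (Re ((0 * f w + la * f' w) * z)%C + - (/ b * (Rpower (1 - s * r) (- b) * (- b * (- r / (1 - s * r))))) <= 0).
    lra. }
unfold u in K.
rewrite Cmult_1_l, Hlaf, Cmult_0_l, H0, Cmult_0_r, Rmult_0_l, Rminus_0_r, Rmult_1_l in K.
change (m + - (/ b * Rpower (1 - r) (- b)) <= 0 + - (/ b * Rpower 1 (- b))) in K.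
unfold Rpower at 2 in K; rewrite ln_1, Rmult_0_r, exp_0 in K.
assert (0 < / b) by now apply Rinv_0_lt_compat.
lra.
Qed.

(** * Integral means *)

Lemma pos_power_pos (x p : R) : 0 < x -> pos_power x p = Rpower x p.
Proof. intros H; unfold pos_power; destruct (Rle_dec x 0); [lra|reflexivity]. Qed.

Lemma pos_power_ge0 (x p : R) : 0 <= pos_power x p.
Proof. unfold pos_power; destruct (Rle_dec x 0); [lra|left; apply exp_pos]. Qed.

Lemma pos_power_le (x y p : R) : 0 <= p -> x <= y -> pos_power x p <= pos_power y p.
Proof.
intros Hp H; unfold pos_power at 1; destruct (Rle_dec x 0); [apply pos_power_ge0|].
rewrite pos_power_pos by lra; apply Rle_Rpower_l; lra.
Qed.

Lemma Rpower_le_exponent (x e e' : R) : 0 < x <= 1 -> e' <= e -> Rpower x e <= Rpower x e'.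
Proof.
intros Hx He; assert (L : ln x <= 0) by (rewrite <- ln_1; apply ln_le; lra).
unfold Rpower; destruct (Rle_lt_or_eq_dec (e * ln x) (e' * ln x)) as [K|K]; [nra| |rewrite K; lra].
left; now apply exp_increasing.
Qed.

Lemma RInt_const_R (a b c : R) : RInt (fun _ => c) a b = (b - a) * c.
Proof. rewrite (@RInt_const R_CompleteNormedModule); reflexivity. Qed.

Lemma C1_holomorphic (g : C -> C) : (forall z, disk z -> C1 g z) -> holomorphic_disk g.
Proof. intros H z Hz; exists (C_derive g z); now apply C1_derive, H. Qed.

Lemma hardy_intro (g : C -> C) (p B : R) : 0 < p -> (forall z, disk z -> C1 g z) ->
  (forall r, 0 <= r < 1 -> RInt (fun th => pos_power (Cmod (g (polar r th))) p) 0 (2 * PI) <= B) ->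
  hardy (Finite p) g.
Proof.
intros Hp Hg HB; split; [now apply C1_holomorphic|].
exists (pos_power (/ (2 * PI) * B) (/ p)); intros r Hr; cbn [integral_mean Rbar_le].
assert (HPI := PI_RGT_0).
apply pos_power_le; [left; now apply Rinv_0_lt_compat|].
apply Rmult_le_compat_l; [left; apply Rinv_0_lt_compat; lra|now apply HB].
Qed.

(* The classical bound for integral means of a starlike function by its maximum modulus:
   [r d/dr |g|^p = p |g|^p Re (z g'/g)], and the mean of [Re (z g'/g)] is independent of r. *)
Lemma hardy_of_growth (g : C -> C) (k K b p : R) :
  (forall z, disk z -> C1 g z) -> (forall z, disk z -> C1 (C_derive g) z) ->
  (forall z, disk z -> z <> 0%C -> g z <> 0%C) ->
  0 <= k -> (forall z, disk z -> z <> 0%C -> 0 <= Re (k + z * C_derive g z / g z)%C) ->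
  0 < K -> 0 <= b -> (forall z, disk z -> Cmod (g z) <= K * Rpower (1 - Cmod z) (- b)) ->
  0 < p -> p * b < 1 ->
  hardy (Finite p) g.
Proof.
intros gC1 gC2 gn0 Hk Hre HK Hb Hgr Hp Hpb.
assert (HPI := PI_RGT_0).
(* The centre 0 is kept explicit to match the circle lemmas. *)
set (z_ := fun r th => (0 + polar r th)%C).
assert (Dz : forall r th, 0 <= r < 1 -> disk (z_ r th)).
{ intros r th Hr; apply disk_shift; rewrite Cmod_0; lra. }
assert (Mz : forall r th, 0 <= r -> Cmod (z_ r th) = r).
{ intros r th Hr; unfold z_; rewrite Cplus_0_l; now apply Cmod_polar. }
assert (Nz : forall r th, 0 < r -> z_ r th <> 0%C).
{ intros r th Hr; now apply polar_shift_neq. }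
assert (Pg : forall r th, 0 < r < 1 -> 0 < Cmod (g (z_ r th))).
{ intros r th Hr; apply Cmod_gt_0, gn0; [apply Dz; lra|apply Nz; lra]. }
set (H := fun z => (k + z * C_derive g z / g z)%C).
assert (HC1 : forall z, disk z -> z <> 0%C -> C1 H z).
{ intros z D N; apply C1_plus; [apply C1_const|apply C1_div; [|now apply gC1|now apply gn0]].
  apply C1_mult; [apply C1_id|now apply gC2]. }
set (G := fun r th => Rpower (Cmod (g (z_ r th))) p).
set (D := fun r th => p * / r * (G r th * (Re (H (z_ r th)) - k))).
(* The radius 1/2 is an arbitrary base: z g'/g is controlled only away from the origin, where g may
   vanish. *)
set (c := RInt (fun th => Re (H (z_ (1 / 2) th))) 0 (2 * PI)).
assert (Ec : forall r, 1 / 2 <= r < 1 -> RInt (fun th => Re (H (z_ r th))) 0 (2 * PI) = c).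
{ intros r Hr; symmetry; apply (circle_mean_annulus H 0%C (1 / 2) r); [lra| |].
  - intros s th Hs; apply C1_cont, HC1; [apply Dz; lra|apply Nz; lra].
  - intros s th Hs; apply HC1; [apply Dz; lra|apply Nz; lra]. }
assert (cH : forall r th, 0 < r < 1 -> continuous (fun th => Re (H (z_ r th))) th).
{ intros r th Hr; apply (circle_cont H 0%C r th).
  apply C1_cont, HC1; [apply Dz; lra|apply Nz; lra]. }
assert (iH : forall r, 0 < r < 1 -> ex_RInt (fun th => Re (H (z_ r th))) 0 (2 * PI)).
{ intros r Hr; apply (@ex_RInt_continuous R_CompleteNormedModule); intros th _; now apply cH. }
assert (Hc0 : 0 <= c).
{ apply RInt_ge_0; [lra|apply iH; lra|].
  intros th _; apply Hre; [apply Dz; lra|apply Nz; lra]. }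
assert (Gpos : forall r th, 0 < G r th) by (intros; apply exp_pos).
assert (cz : forall r th, @continuous (prod_UniformSpace R_UniformSpace R_UniformSpace) C_UniformSpace
    (fun q => z_ (fst q) (snd q)) (r, th)) by (intros; apply polar_cont).
assert (cG2 : forall r th, 0 < r < 1 ->
   @continuous (prod_UniformSpace R_UniformSpace R_UniformSpace) R_UniformSpace (fun q => G (fst q) (snd q)) (r, th)).
{ intros r th Hr; unfold G, Rpower.
  apply (continuous_comp (fun q => Cmod (g (z_ (fst q) (snd q)))) (fun x => exp (p * ln x))).
  - apply continuous_Cmod.
    apply (contC_comp (fun q : prod_UniformSpace R_UniformSpace R_UniformSpace => z_ (fst q) (snd q)) g);
    [apply cz|apply C1_cont, gC1, Dz; cbn; lra].
  - apply (@ex_derive_continuous R_AbsRing R_NormedModule); auto_derive; apply Pg; exact Hr. }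
assert (cH2 : forall r th, 0 < r < 1 ->
   @continuous (prod_UniformSpace R_UniformSpace R_UniformSpace) R_UniformSpace (fun q => Re (H (z_ (fst q) (snd q)))) (r, th)).
{ intros r th Hr.
  apply (fun h => proj1 (proj1 (continuous_C_iff (fun q : prod_UniformSpace R_UniformSpace R_UniformSpace => H (z_ (fst q) (snd q))) (r, th)) h)).
  apply (contC_comp (fun q : prod_UniformSpace R_UniformSpace R_UniformSpace => z_ (fst q) (snd q)) H);
    [apply cz|apply C1_cont, HC1; [apply Dz|apply Nz]; cbn; lra]. }
assert (cD2 : forall r th, 0 < r < 1 -> continuity_2d_pt D r th).
{ intros r th Hr; apply continuity_2d_pt_filterlim.
  apply (@continuous_mult _ R_AbsRing (fun q : R * R => p * / fst q) (fun q : R * R => G (fst q) (snd q) * (Re (H (z_ (fst q) (snd q))) - k)) (r, th)).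
  - apply (continuous_comp (fun q : R * R => fst q) (fun r => p * / r)).
    + apply (@continuous_fst R_UniformSpace R_UniformSpace).
    + apply (@ex_derive_continuous R_AbsRing R_NormedModule); auto_derive; cbn; lra.
  - apply (@continuous_mult _ R_AbsRing (fun q : R * R => G (fst q) (snd q)) (fun q : R * R => Re (H (z_ (fst q) (snd q))) - k)).
    + now apply cG2.
    + apply (@continuous_minus _ R_AbsRing R_NormedModule (fun q : R * R => Re (H (z_ (fst q) (snd q)))) (fun _ => k)).
      * now apply cH2.
      * apply continuous_const. }
assert (cG : forall r th, 0 < r < 1 -> continuous (G r) th).
{ intros r th Hr; apply continuity_2d_pt_section, continuity_2d_pt_filterlim; now apply cG2. }
assert (dG : forall r th, 0 < r < 1 -> is_derive (fun r => G r th) r (D r th)).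
{ intros r th Hr.
  assert (Hz : disk (z_ r th)) by (apply Dz; lra).
  assert (d1 := curve_derive_comp g (fun s => z_ s th) r _ _ (C1_derive _ _ (gC1 _ Hz)) (polar_radial 0 r th)).
  apply Cmod_sqr_derive in d1.
  (* |g|^p is differentiated as the (p/2)-th power of the squared modulus. *)
  apply (is_derive_ext_loc (fun s => exp (p / 2 * ln (Cmod (g (z_ s th)) ^ 2)))).
  { assert (Hd : 0 < Rmin r (1 - r)) by (apply Rmin_pos; lra).
    exists (mkposreal _ Hd); intros s Hs; unfold G, Rpower; f_equal.
    assert (Hs' : Rabs (s - r) < Rmin r (1 - r)) by exact Hs.
    assert (m1 := Rmin_l r (1 - r)); assert (m2 := Rmin_r r (1 - r)); apply Rabs_def2 in Hs'.
    rewrite <- Rpower_pow by (apply Pg; lra); unfold Rpower; rewrite ln_exp; simpl; field. }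
  assert (Hpg := Pg r th Hr).
  assert (Hpg2 : 0 < Cmod (g (z_ r th)) ^ 2) by now apply pow_lt.
  assert (d2 : is_derive (fun x => exp (p / 2 * ln x)) (Cmod (g (z_ r th)) ^ 2)
     (p / 2 * / Cmod (g (z_ r th)) ^ 2 * exp (p / 2 * ln (Cmod (g (z_ r th)) ^ 2)))).
  { auto_derive; [exact Hpg2|ring]. }
  assert (d3 := is_derive_comp _ _ _ _ _ d2 d1).
  match type of d3 with is_derive _ _ ?x => replace (D r th) with x; [exact d3|] end.
  unfold D; replace (exp (p / 2 * ln (Cmod (g (z_ r th)) ^ 2))) with (G r th).
  2:{ unfold G, Rpower; f_equal; rewrite <- Rpower_pow by exact Hpg; unfold Rpower; rewrite ln_exp; simpl; field. }
  set (Gr := G r th).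
  assert (EH : Re (H (z_ r th)) - k = r * Re (Cconj (g (z_ r th)) * (C_derive g (z_ r th) * polar 1 th))%C / Cmod (g (z_ r th)) ^ 2).
  { assert (Ez : z_ r th = (RtoC r * polar 1 th)%C) by (unfold z_; rewrite Cplus_0_l; apply polar_mult).
    assert (Eg : (z_ r th * C_derive g (z_ r th) / g (z_ r th))%C =
       (RtoC (r / Cmod (g (z_ r th)) ^ 2) * (Cconj (g (z_ r th)) * (C_derive g (z_ r th) * polar 1 th)))%C).
    { rewrite RtoC_div, Cmod2_conj by lra.
      assert (n1 : g (z_ r th) <> 0%C) by (apply Cmod_gt_0; exact Hpg).
      assert (n2 : Cconj (g (z_ r th)) <> 0%C).
      { intros E; apply n1, Cmod_eq_0; rewrite <- Cmod_conj, E; apply Cmod_0. }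
      rewrite Ez at 1; field; split; assumption. }
    unfold H; rewrite Eg.
    set (X := (Cconj (g (z_ r th)) * (C_derive g (z_ r th) * polar 1 th))%C).
    set (y := r / Cmod (g (z_ r th)) ^ 2).
    replace (r * Re X / Cmod (g (z_ r th)) ^ 2) with (y * Re X) by (unfold y; field; lra).
    unfold Re; cbn; ring. }
  rewrite EH; unfold scal; cbn -[pow Cmod Re]; unfold mult; cbn -[pow Cmod Re]; field; split; lra. }
set (J := fun r => RInt (G r) 0 (2 * PI)).
assert (iG : forall r, 0 < r < 1 -> ex_RInt (G r) 0 (2 * PI)).
{ intros r Hr; apply (@ex_RInt_continuous R_CompleteNormedModule); intros th _; now apply cG. }
assert (dJ : forall r, 0 < r < 1 -> is_derive J r (RInt (D r) 0 (2 * PI))).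
{ intros r Hr.
  assert (Hd : 0 < Rmin r (1 - r)) by (apply Rmin_pos; lra).
  apply (RInt_param_derive G D 0 (2 * PI) r _ Hd); [|intros th; now apply cD2].
  intros s Hs th.
  assert (m1 := Rmin_l r (1 - r)); assert (m2 := Rmin_r r (1 - r)); apply Rabs_def2 in Hs.
  split; [apply dG; lra|apply cG; lra]. }
(* The 2 bounds 1/r on [1/2, 1), K^p comes from the growth bound, and c is the total mass of Re
   H. *)
set (A := 2 * p * Rpower K p * c).
assert (HA : 0 <= A).
{ unfold A; apply Rmult_le_pos; [|exact Hc0]; apply Rmult_le_pos; [lra|left; apply exp_pos]. }
assert (HD : forall r, 1 / 2 <= r < 1 -> RInt (D r) 0 (2 * PI) <= A * Rpower (1 - 1 * r) (- (p * b))).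
{ intros r Hr; rewrite Rmult_1_l.
  set (M := Rpower K p * Rpower (1 - r) (- (p * b))).
  assert (HM0 : 0 < M) by (apply Rmult_lt_0_compat; apply exp_pos).
  assert (HM : forall th, G r th <= M).
  { intros th; unfold G.
    assert (E := Hgr (z_ r th) (Dz r th ltac:(lra))); rewrite Mz in E by lra.
    apply Rle_trans with (Rpower (K * Rpower (1 - r) (- b)) p).
    - apply Rle_Rpower_l; [lra|]; split; [apply Pg; lra|exact E].
    - rewrite <- Rpower_mult_distr; [|exact HK|apply exp_pos].
      rewrite Rpower_mult; unfold M; right; do 2 f_equal; ring. }
  replace (A * Rpower (1 - r) (- (p * b))) with (RInt (fun th => 2 * p * M * Re (H (z_ r th))) 0 (2 * PI)).
  - apply RInt_le; [lra| | |].
    + apply (@ex_RInt_continuous R_CompleteNormedModule); intros th _.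
      apply continuity_2d_pt_section, cD2; lra.
    + apply (@ex_RInt_scal R_NormedModule), iH; lra.
    + intros th _; unfold D.
      assert (HR := Hre (z_ r th) (Dz r th ltac:(lra)) (Nz r th ltac:(lra))).
      change (0 <= Re (H (z_ r th))) in HR; set (R0 := Re (H (z_ r th))) in *.
      assert (Hri : 0 < / r <= 2).
      { split; [apply Rinv_0_lt_compat; lra|].
        replace 2 with (/ (1 / 2)) by field; apply Rinv_le_contravar; lra. }
      specialize (HM th); specialize (Gpos r th).
      (* Nonnegativity of R0 allows G to be raised to its maximum, and nonnegativity of k allows - k
         to be dropped. *)
      assert (e1 : G r th * (R0 - k) <= M * R0) by nra.
      apply Rle_trans with (p * / r * (M * R0)).
      * apply Rmult_le_compat_l; [|exact e1]; apply Rmult_le_pos; lra.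
      * assert (0 <= M * R0) by (apply Rmult_le_pos; lra).
        assert (0 <= p * (M * R0)) by (apply Rmult_le_pos; lra). nra.
  - rewrite (RInt_ext _ (fun th => scal (2 * p * M) (Re (H (z_ r th))))) by reflexivity.
    rewrite (@RInt_scal R_CompleteNormedModule) by (apply iH; lra).
    rewrite Ec by exact Hr; change (2 * p * M * c = A * Rpower (1 - r) (- (p * b))); unfold A, M; ring. }
set (q := 1 - p * b).
assert (Hq : 0 < q) by (unfold q; lra).
assert (HJ : forall r, 1 / 2 <= r < 1 -> J r <= J (1 / 2) + A / q).
{ intros r Hr.
  (* The added term has derivative - A (1 - s)^(- p b), so W does not increase; since q > 0 this
     term stays bounded up to s = 1, which is where p b < 1 enters. *)
  set (W := fun s => plus (J s) (A / q * Rpower (1 - s * 1) q)).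
  set (W' := fun s => plus (RInt (D s) 0 (2 * PI)) (A / q * (Rpower (1 - s * 1) q * (q * (- 1 / (1 - s * 1)))))).
  assert (KW : W r <= W (1 / 2)).
  { apply (nonincreasing_of_derive W W'); [lra| |].
    - intros s Hs; unfold W, W'; apply (@is_derive_plus R_AbsRing R_NormedModule); [apply dJ; lra|].
      apply is_derive_scal, Rpower_affine_derive; lra.
    - intros s Hs; unfold W'; specialize (HD s ltac:(lra)).
      replace (1 - 1 * s) with (1 - s * 1) in HD by ring.
      assert (e1 : A / q * (Rpower (1 - s * 1) q * (q * (- 1 / (1 - s * 1)))) = - (A * Rpower (1 - s * 1) (- (p * b)))).
      { replace (Rpower (1 - s * 1) q) with (Rpower (1 - s * 1) (- (p * b)) * (1 - s * 1)).
        - field; lra.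
        - rewrite <- (Rpower_1 (1 - s * 1)) at 2 by lra; rewrite <- Rpower_plus; f_equal; unfold q; ring. }
      rewrite e1; change (RInt (D s) 0 (2 * PI) + - (A * Rpower (1 - s * 1) (- (p * b))) <= 0); lra. }
  change (J r + A / q * Rpower (1 - r * 1) q <= J (1 / 2) + A / q * Rpower (1 - 1 / 2 * 1) q) in KW.
  assert (HAq : 0 <= A / q) by (apply Rmult_le_pos; [exact HA|left; now apply Rinv_0_lt_compat]).
  assert (e2 : 0 <= A / q * Rpower (1 - r * 1) q) by (apply Rmult_le_pos; [exact HAq|left; apply exp_pos]).
  assert (e3 : Rpower (1 - 1 / 2 * 1) q <= 1).
  { replace 1 with (Rpower 1 q) at 4 by (unfold Rpower; rewrite ln_1, Rmult_0_r; apply exp_0).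
    apply Rle_Rpower_l; lra. }
  assert (e4 : A / q * Rpower (1 - 1 / 2 * 1) q <= A / q * 1) by now apply Rmult_le_compat_l.
  lra. }
(* For radii below 1/2 the growth bound alone is enough. *)
set (L := Rpower (K * Rpower (1 / 2) (- b)) p).
apply (hardy_intro g p (Rmax (2 * PI * L) (J (1 / 2) + A / q)) Hp gC1).
intros r Hr.
destruct (Rle_lt_dec (1 / 2) r) as [Hr2|Hr2].
- apply Rle_trans with (2 := Rmax_r _ _); apply Rle_trans with (2 := HJ r ltac:(lra)).
  right; apply RInt_ext; intros th _; unfold G, z_; rewrite Cplus_0_l.
  apply pos_power_pos; specialize (Pg r th ltac:(lra)); unfold z_ in Pg; now rewrite Cplus_0_l in Pg.
- apply Rle_trans with (2 := Rmax_l _ _).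
  assert (Hpt : forall th, pos_power (Cmod (g (polar r th))) p <= L).
  { intros th; unfold L; assert (E := Hgr (z_ r th) (Dz r th ltac:(lra))); rewrite Mz in E by lra.
    unfold z_ in E; rewrite Cplus_0_l in E.
    assert (E2 : Rpower (1 - r) (- b) <= Rpower (1 / 2) (- b)).
    { rewrite !Rpower_Ropp; apply Rinv_le_contravar; [apply exp_pos|]; apply Rle_Rpower_l; lra. }
    rewrite <- pos_power_pos by (apply Rmult_lt_0_compat; [exact HK|apply exp_pos]).
    apply pos_power_le; [lra|]; apply Rle_trans with (1 := E), Rmult_le_compat_l; lra. }
  replace (2 * PI * L) with (RInt (fun _ => L) 0 (2 * PI)) 
    by (rewrite RInt_const_R; change ((2 * PI - 0) * L = 2 * PI * L); ring).
  apply RInt_le; [lra| |apply (@ex_RInt_const R_NormedModule)|intros th _; apply Hpt].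
  destruct (Rle_lt_or_eq_dec 0 r (proj1 Hr)) as [Hr0|<-].
  + apply (ex_RInt_ext (G r)); [|apply iG; lra].
    intros th _; unfold G, z_; rewrite Cplus_0_l; symmetry.
    apply pos_power_pos; specialize (Pg r th ltac:(lra)); unfold z_ in Pg; now rewrite Cplus_0_l in Pg.
  (* On the degenerate circle the integrand is constant, possibly with g 0 = 0. *)
  + apply (ex_RInt_ext (fun _ => pos_power (Cmod (g 0%C)) p)); [|apply (@ex_RInt_const R_NormedModule)].
    intros th _; now rewrite polar_0.
Qed.

Lemma class_C_hardy (f : C -> C) (a : nat -> C) : class_C f a ->
  (forall p : R, 0 < p < / (1 + Cmod (a 2%nat)) -> hardy (Finite p) (C_derive f)) /\
  (forall q : R, 0 < q -> Rbar_lt (Finite q) (recip_ext (Cmod (a 2%nat))) -> hardy (Finite q) f).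
Proof.
intros [[[_ finj] [Hexp [Ha0 Ha1]]] fconv].
destruct (has_expansion_second f a Hexp) as [f2 [fC1 [f1C1 [f2C1 [Df1 [E10 E20]]]]]].
assert (f0 : f 0%C = 0%C) by (rewrite (has_expansion_0 _ _ Hexp); exact Ha0).
rewrite Ha1 in E10.
assert (Hn0 := univalent_derive_neq0 f fC1 finj).
assert (HP : forall z, disk z -> 0 <= Re (1 + z * f2 z / C_derive f z)%C).
{ intros z Hz; now apply convex_nonneg_derive. }
assert (E2 : (f2 0 / 2)%C = a 2%nat).
{ rewrite E20; field; intros E; apply (f_equal fst) in E; cbn in E; lra. }
destruct (log_derivative_bound (C_derive f) f2 f1C1 f2C1 Hn0 E10 HP) as [Hal Hlog].
rewrite E2 in Hal, Hlog.
assert (Hal0 := Cmod_ge_0 (a 2%nat)); set (al := Cmod (a 2%nat)) in *.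
assert (Hgr : forall z, disk z -> Cmod (C_derive f z) <= Rpower (1 - Cmod z) (- (1 + al))).
{ apply (growth_of_log_derivative _ f2); [exact Df1|rewrite E10; apply Cmod_1|exact Hlog]. }
split.
- intros p [Hp1 Hp2]; apply (hardy_of_growth _ 1 1 (1 + al)); auto; try lra.
  + intros z Hz; destruct (disk_open z Hz) as [d [Hd o]].
    apply (C1_ext_loc f2 _ _ d Hd); [|now apply f2C1].
    intros y Hy; symmetry; now apply is_C_derive_unique, Df1, o.
  + intros z Hz _; rewrite (is_C_derive_unique _ _ _ (Df1 z Hz)); now apply HP.
  + intros z Hz; rewrite Rmult_1_l; now apply Hgr.
  + apply (Rmult_lt_compat_r (1 + al)) in Hp2; [|lra]; rewrite Rinv_l in Hp2; lra.
- intros q Hq1 Hq2.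
  (* When al = 0, b = 1/(2q) replaces the exponent 0, which [growth_of_derivative] excludes. *)
  assert (Eb : exists b, 0 < b /\ al <= b /\ q * b < 1).
  { unfold recip_ext in Hq2; destruct (Req_EM_T al 0) as [E|n].
    - exists (/ (2 * q)); split; [apply Rinv_0_lt_compat; lra|split].
      + rewrite E; left; apply Rinv_0_lt_compat; lra.
      + replace (q * / (2 * q)) with (1 / 2) by (field; lra); lra.
    - exists al; split; [lra|split; [lra|]].
      cbn in Hq2; apply (Rmult_lt_compat_r al) in Hq2; [|lra]; rewrite Rinv_l in Hq2; lra. }
  destruct Eb as [b [Hb0 [Hb1 Hb2]]].
  apply (hardy_of_growth _ 0 (/ b) b); auto; try lra.
  + intros z Hz nz E; apply nz, finj; [exact Hz|apply disk_0|now rewrite f0].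
  + intros z Hz _.
    replace (RtoC 0 + z * C_derive f z / f z)%C with (z * C_derive f z / f z)%C by ring.
    now apply convex_starlike.
  + now apply Rinv_0_lt_compat.
  + apply (growth_of_derivative f (C_derive f) b Hb0); [intros z Hz; now apply C1_derive, fC1|exact f0|].
    intros z Hz; apply Rle_trans with (1 := Hgr z Hz).
    apply Rpower_le_exponent; [assert (Hz' : Cmod z < 1) by exact Hz; generalize (Cmod_ge_0 z); lra|lra].
Qed.

(** * The complex exponential and the half-plane map *)

Definition Cexp (u : C) : C := (exp (Re u) * cos (Im u), exp (Re u) * sin (Im u)).

Lemma Cexp_plus (u v : C) : Cexp (u + v)%C = (Cexp u * Cexp v)%C.
Proof.
unfold Cexp; replace (Re (u + v)%C) with (Re u + Re v) by reflexivity.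
replace (Im (u + v)%C) with (Im u + Im v) by reflexivity.
rewrite exp_plus, cos_plus, sin_plus; apply injective_projections; cbn; ring.
Qed.

Lemma Cexp_0 : Cexp 0%C = 1%C.
Proof. unfold Cexp, Re, Im; cbn; rewrite exp_0, cos_0, sin_0; apply injective_projections; cbn; ring. Qed.

Lemma Cmod_Cexp (u : C) : Cmod (Cexp u) = exp (Re u).
Proof.
change (Cexp u) with (polar (exp (Re u)) (Im u)); apply Cmod_polar; left; apply exp_pos.
Qed.

(** The closed forms of the extremal functions are verified along rays s L, so the derivative in the
    real parameter s is the one computed. *)
Lemma Cexp_ray_derive (v : C) (s : R) : is_curve_derive (fun s => Cexp (RtoC s * v)%C) s (v * Cexp (RtoC s * v)%C)%C.
Proof.
destruct v as [x y].
assert (E : forall s, Cexp (RtoC s * (x, y))%C = (exp (s * x) * cos (s * y), exp (s * x) * sin (s * y))).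
{ intros t; unfold Cexp, Re, Im; cbn.
  replace (t * x - 0 * y) with (t * x) by ring; now replace (t * y + 0 * x) with (t * y) by ring. }
rewrite E; split.
- apply (is_derive_ext (fun s => exp (s * x) * cos (s * y))); [intros t; now rewrite E|].
  unfold Re; cbn; auto_derive; trivial; ring.
- apply (is_derive_ext (fun s => exp (s * x) * sin (s * y))); [intros t; now rewrite E|].
  unfold Im; cbn; auto_derive; trivial; ring.
Qed.

Lemma Cexp_Re_pos (u : C) : Rabs (Im u) < PI / 2 -> 0 < Re (Cexp u).
Proof.
intros H; apply Rabs_def2 in H; unfold Cexp; cbn.
apply Rmult_lt_0_compat; [apply exp_pos|apply cos_gt_0; lra].
Qed.

Lemma Cexp_surj (W : C) : 0 < Re W -> exists u, Cexp u = W /\ Rabs (Im u) < PI / 2.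
Proof.
intros H; exists (ln (Cmod W), atan (Im W / Re W)); split.
- assert (HW : 0 < Cmod W) by (apply Rlt_le_trans with (1 := H), Rle_trans with (1 := Rle_abs _), re_le_Cmod).
  change (Cexp (ln (Cmod W), atan (Im W / Re W))) with
    ((exp (ln (Cmod W)) * cos (atan (Im W / Re W)), exp (ln (Cmod W)) * sin (atan (Im W / Re W))) : C).
  rewrite exp_ln, cos_atan, sin_atan by exact HW.
  assert (E : Cmod W = Re W * sqrt (1 + (Im W / Re W)²)).
  { replace (Cmod W) with (sqrt (Cmod W ^ 2)) by (apply sqrt_pow2; lra).
    rewrite Cmod2_alt.
    rewrite <- (sqrt_pow2 (Re W)) at 2 by lra.
    rewrite <- sqrt_mult_alt by nra; f_equal; unfold Rsqr; field; lra. }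
  rewrite E; set (t := Im W / Re W) in *.
  assert (Ht : 0 < sqrt (1 + t²)) by (apply sqrt_lt_R0; generalize (Rle_0_sqr t); lra).
  apply injective_projections; cbn [fst snd].
  + change (fst W) with (Re W); field; lra.
  + change (snd W) with (Im W); unfold t; field; split; [lra|]. unfold t in Ht; lra.
- assert (K := atan_bound (Im W / Re W)); change (Rabs (atan (Im W / Re W)) < PI / 2); apply Rabs_def1; lra.
Qed.

Lemma Cexp_inj (u v : C) : Rabs (Im u) < PI / 2 -> Rabs (Im v) < PI / 2 -> Cexp u = Cexp v -> u = v.
Proof.
intros Hu Hv E.
assert (E1 : Re u = Re v) by (apply exp_inv; rewrite <- !Cmod_Cexp; now rewrite E).
apply (f_equal snd) in E; unfold Cexp in E; cbn [snd] in E; rewrite E1 in E.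
apply Rmult_eq_reg_l in E; [|apply Rgt_not_eq, exp_pos].
apply Rabs_def2 in Hu, Hv.
assert (E2 : Im u = Im v).
{ destruct (Rtotal_order (Im u) (Im v)) as [K|[K|K]]; [|exact K|];
  apply sin_increasing_1 in K; lra. }
apply injective_projections; assumption.
Qed.

(* A wedge |arg W| < b with b <= pi/2 is cut out by inequalities that are linear in W. *)
Lemma Cexp_wedge_iff (b : R) (W : C) : 0 < b <= PI / 2 ->
  (exists u, Cexp u = W /\ Rabs (Im u) < b) <->
  0 < Re W /\ 0 < sin b * Re W - cos b * Im W /\ 0 < sin b * Re W + cos b * Im W.
Proof.
intros Hb.
assert (Hs : forall u, (sin b * Re (Cexp u) - cos b * Im (Cexp u) = exp (Re u) * sin (b - Im u)) /\
   (sin b * Re (Cexp u) + cos b * Im (Cexp u) = exp (Re u) * sin (b + Im u))).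
{ intros u; rewrite sin_minus, sin_plus; unfold Cexp, Re, Im; cbn [fst snd]; split; ring. }
split.
- intros [u [<- Hu]]; destruct (Hs u) as [-> ->].
  split; [apply Cexp_Re_pos; lra|]; apply Rabs_def2 in Hu.
  split; (apply Rmult_lt_0_compat; [apply exp_pos|apply sin_gt_0; lra]).
- intros [H1 [H2 H3]]; destruct (Cexp_surj W H1) as [u [<- Hu]].
  exists u; split; [reflexivity|].
  destruct (Hs u) as [E2 E3]; rewrite E2 in H2; rewrite E3 in H3; apply Rabs_def2 in Hu.
  assert (Hp := exp_pos (Re u)).
  assert (K : forall x, - (PI / 2) < x -> 0 < exp (Re u) * sin x -> 0 < x).
  { intros x Hx Hx2; apply Rnot_le_lt; intros Hx3.
    assert (0 <= sin (- x)) by (apply sin_ge_0; lra); rewrite sin_neg in *; nra. }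
  apply Rabs_def1; [apply K in H2|apply K in H3]; lra.
Qed.

(** This is tanh(L/2), a bijection from the strip |Im L| < pi/2 onto the disk, inverse to the
    principal logarithm of (1 + z)/(1 - z). *)
Definition half_tanh (L : C) : C := ((Cexp L - 1) / (Cexp L + 1))%C.

Lemma half_plane_disk (w : C) : 0 < Re w -> (w + 1)%C <> 0%C /\ disk ((w - 1) / (w + 1))%C.
Proof.
intros H.
assert (n : (w + 1)%C <> 0%C).
{ intros E; apply (f_equal Re) in E; change (Re w + 1 = 0) in E; lra. }
split; [exact n|]; unfold disk; rewrite Cmod_div by exact n.
assert (Hp := proj1 (Cmod_gt_0 _) n).
assert (E : Cmod (w + 1) ^ 2 - Cmod (w - 1) ^ 2 = 4 * Re w).
{ rewrite !Cmod2_alt; unfold Re, Im; cbn; ring. }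
assert (K : Cmod (w - 1) < Cmod (w + 1)) by (apply Cmod_lt_sqr; lra).
apply (Rmult_lt_reg_r (Cmod (w + 1))); [exact Hp|].
unfold Rdiv; rewrite Rmult_assoc, Rinv_l; lra.
Qed.

Lemma half_tanh_surj (z : C) : disk z ->
  exists L, Rabs (Im L) < PI / 2 /\ half_tanh L = z /\ (Cexp L = (1 + z) / (1 - z))%C.
Proof.
intros Hz; unfold disk in Hz.
assert (n : (1 - z)%C <> 0%C).
{ intros E; assert (K : z = 1%C) by (replace z with (1 - (1 - z))%C by ring; rewrite E; ring).
  rewrite K, Cmod_1 in Hz; lra. }
assert (Hp : 0 < Re ((1 + z) / (1 - z))%C).
{ assert (E : Re ((1 + z) / (1 - z))%C = (1 - Cmod z ^ 2) / Cmod (1 - z) ^ 2).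
  { assert (H2 := proj1 (Cmod_gt_0 _) n).
    assert (H3 : 0 < Cmod (1 - z) ^ 2) by (apply pow_lt; exact H2).
    rewrite !Cmod2_alt in *; destruct z as [x y]; unfold Re, Im in *; cbn in *; field; lra. }
  rewrite E; apply Rdiv_lt_0_compat; [generalize (Cmod_ge_0 z); nra|].
  apply pow_lt; now apply Cmod_gt_0. }
destruct (Cexp_surj _ Hp) as [L [EL HL]]; exists L; split; [exact HL|split; [|exact EL]].
unfold half_tanh; rewrite EL; field; split; [exact n|].
intros E; apply (f_equal fst) in E; cbn in E; lra.
Qed.

Lemma half_tanh_disk (L : C) : Rabs (Im L) < PI / 2 -> disk (half_tanh L).
Proof. intros H; now apply half_plane_disk, Cexp_Re_pos. Qed.

Lemma half_tanh_ray_derive (L : C) (s : R) : Rabs (Im (RtoC s * L)%C) < PI / 2 ->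
  is_curve_derive (fun s => half_tanh (RtoC s * L)%C) s
    (L / 2 * (1 - half_tanh (RtoC s * L) * half_tanh (RtoC s * L)))%C.
Proof.
intros H; apply Cexp_Re_pos, half_plane_disk in H; destruct H as [n _].
unfold half_tanh; set (w := Cexp (RtoC s * L)) in *.
replace (L / 2 * (1 - (w - 1) / (w + 1) * ((w - 1) / (w + 1))))%C with
  (((1 - 0) * / (w + 1) + (w - 1) * (- (1 + 0) / ((w + 1) * (w + 1)))) * (L * w))%C.
2:{ field; exact n. }
apply (curve_derive_comp (fun w => (w - 1) / (w + 1))%C (fun s => Cexp (RtoC s * L))).
- apply (Cderive_mult (fun w => w - 1)%C (fun w => / (w + 1))%C).
  + apply (Cderive_minus (fun w => w) (fun _ => 1%C)); [apply Cderive_id|apply Cderive_const].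
  + apply (Cderive_inv (fun w => w + 1)%C); [|exact n].
    apply (Cderive_plus (fun w => w) (fun _ => 1%C)); [apply Cderive_id|apply Cderive_const].
- apply Cexp_ray_derive.
Qed.

Lemma curve_derive_mult (g h : R -> C) (t : R) (u v : C) :
  is_curve_derive g t u -> is_curve_derive h t v ->
  is_curve_derive (fun s => g s * h s)%C t (u * h t + g t * v)%C.
Proof.
intros [g1 g2] [h1 h2].
assert (K : forall (p q : R -> R) (a b : R), is_derive p t a -> is_derive q t b ->
  is_derive (fun s => p s * q s) t (a * q t + p t * b)).
{ intros p q a b Hp Hq; apply (@is_derive_mult R_AbsRing p q); [exact Hp|exact Hq|apply Rmult_comm]. }
split.
- replace (Re (u * h t + g t * v)%C) with
    ((Re u * Re (h t) + Re (g t) * Re v) - (Im u * Im (h t) + Im (g t) * Im v)).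
  2:{ unfold Re, Im; cbn; ring. }
  apply (@is_derive_minus R_AbsRing R_NormedModule (fun s => Re (g s) * Re (h s)) (fun s => Im (g s) * Im (h s)));
  apply K; assumption.
- replace (Im (u * h t + g t * v)%C) with
    ((Re u * Im (h t) + Re (g t) * Im v) + (Im u * Re (h t) + Im (g t) * Re v)).
  2:{ unfold Re, Im; cbn; ring. }
  apply (@is_derive_plus R_AbsRing R_NormedModule (fun s => Re (g s) * Im (h s)) (fun s => Im (g s) * Re (h s)));
  apply K; assumption.
Qed.

Lemma curve_constant (g : R -> C) (a b : R) : a < b ->
  (forall s, a <= s <= b -> is_curve_derive g s 0%C) -> g a = g b.
Proof.
intros Hab H; apply injective_projections.
- apply (eq_is_derive (fun s => Re (g s)) a b); [|exact Hab]; intros s Hs; apply (H s Hs).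
- apply (eq_is_derive (fun s => Im (g s)) a b); [|exact Hab]; intros s Hs; apply (H s Hs).
Qed.

(** * Extremal functions *)

(* [(b_n, b_(n+1))] for the Taylor coefficients b of the solution of
   [(1 - z^2) f' = 1 + 2 al f], [f 0 = 0]. *)
Fixpoint extremal_pair (al : R) (n : nat) : R * R :=
  match n with
  | O => (0, 1)
  | S m => let p := extremal_pair al m in
           (snd p, (INR m * fst p + 2 * al * snd p) / INR (S (S m)))
  end.

Definition extremal_coef (al : R) (n : nat) : R := fst (extremal_pair al n).

Lemma extremal_coef_rec (al : R) (n : nat) :
  INR (S (S n)) * extremal_coef al (S (S n)) =
  INR n * extremal_coef al n + 2 * al * extremal_coef al (S n).
Proof.
unfold extremal_coef.
change (fst (extremal_pair al (S (S n)))) with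
  ((INR n * fst (extremal_pair al n) + 2 * al * snd (extremal_pair al n)) / INR (S (S n))).
change (fst (extremal_pair al (S n))) with (snd (extremal_pair al n)).
field; apply not_0_INR; lia.
Qed.

(** In the recursion the weights n and 2 al add up to at most n + 2, so the bound propagates; it
    makes the series converge in the disk. *)
Lemma extremal_coef_bound (al : R) : 0 <= al <= 1 -> forall n, 0 <= extremal_coef al n <= 1.
Proof.
intros Ha.
assert (K : forall n, 0 <= extremal_coef al n <= 1 /\ 0 <= extremal_coef al (S n) <= 1).
{ induction n as [|n [IH1 IH2]].
  - unfold extremal_coef; cbn; lra.
  - split; [exact IH2|].
    assert (E := extremal_coef_rec al n); assert (Hn := pos_INR n).
    rewrite !S_INR in E.
    assert (0 <= INR n * extremal_coef al n <= INR n) by nra.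
    assert (0 <= al * extremal_coef al (S n) <= 1) by nra.
    nra. }
intros n; apply (K n).
Qed.

Section Extremal.
Variables (al : R) (f : C -> C).
Hypothesis Hal : 0 <= al <= 1.
Hypothesis fexp : has_expansion f (fun n => RtoC (extremal_coef al n)).

Let fC1 := has_expansion_C1 f _ fexp.

Lemma extremal_0 : f 0%C = 0%C.
Proof. apply (has_expansion_0 _ _ fexp). Qed.

Lemma extremal_ode (z : C) : disk z -> (C_derive f z * (1 - z * z) = 1 + 2 * al * f z)%C.
Proof.
intros Hz; destruct (has_expansion_derive f _ fexp) as [f1 [f1exp Df]].
rewrite (is_C_derive_unique _ _ _ (Df z Hz)).
rewrite has_expansion_iff in f1exp; assert (S1 := f1exp z Hz).
assert (S0 := proj1 (has_expansion_iff _ _) fexp z Hz).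
(* Without its terms of degree 0 and 1, the series of f' equals that of z^2 f' + 2 al (f - z) by the
   recursion at n + 1; the removed terms are 1 and 2 al z. *)
assert (T1 := is_Cseries_shift _ _ (is_Cseries_shift _ _ S1)).
assert (T2 := is_Cseries_scal (z * z)%C _ _ S1).
assert (T3 := is_Cseries_scal (2 * al)%C _ _ (is_Cseries_shift _ _ (is_Cseries_shift _ _ S0))).
cbv beta in T1, T2, T3.
assert (T4 := is_Cseries_plus _ _ _ _ T2 T3); cbv beta in T4.
assert (E2 : extremal_coef al 2 = al) by (unfold extremal_coef; cbn; field).
eapply is_Cseries_ext in T4.
- assert (E := is_Cseries_unique _ _ _ T1 T4).
  rewrite E2 in E; unfold extremal_coef in E; cbn [extremal_pair fst snd] in E.
  simpl in E; rewrite ?RtoC_plus in E.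
  transitivity ((f1 z - (1 * 1 * 1) - ((1 + 1) * al * (z * 1))) - z * z * f1 z + 1 + 2 * al * z)%C; [ring|].
  rewrite E; ring.
- intros n; cbv beta.
  assert (R := f_equal RtoC (extremal_coef_rec al (S n))).
  rewrite RtoC_plus, !RtoC_mult in R.
  change (z ^ S (S n))%C with (z * (z * z ^ n))%C.
  rewrite R; ring.
Qed.

Lemma curve_derive_minus (g h : R -> C) (t : R) (u v : C) :
  is_curve_derive g t u -> is_curve_derive h t v -> is_curve_derive (fun s => g s - h s)%C t (u - v)%C.
Proof.
intros [g1 g2] [h1 h2]; split; apply (@is_derive_minus R_AbsRing R_NormedModule); assumption.
Qed.

Lemma ray_strip (L : C) (s : R) : Rabs (Im L) < PI / 2 -> 0 <= s <= 1 -> Rabs (Im (RtoC s * L)%C) < PI / 2.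
Proof.
intros H Hs; replace (Im (RtoC s * L)%C) with (s * Im L) by (unfold Im; cbn; ring).
rewrite Rabs_mult, (Rabs_right s) by lra; generalize (Rabs_pos (Im L)); nra.
Qed.

Lemma half_tanh_0 : half_tanh 0%C = 0%C.
Proof. unfold half_tanh; rewrite Cexp_0; unfold Cdiv; ring. Qed.

(** The factor 1 - z^2 of the differential equation cancels against the derivative of tanh(s L/2),
    leaving a linear equation with constant coefficients in s. *)
Lemma extremal_ray_derive (L : C) (s : R) : Rabs (Im L) < PI / 2 -> 0 <= s <= 1 ->
  is_curve_derive (fun s => f (half_tanh (RtoC s * L)%C)) s
    (L / 2 * (1 + 2 * al * f (half_tanh (RtoC s * L))))%C.
Proof.
intros HL Hs; assert (H := ray_strip L s HL Hs).
assert (Dz := half_tanh_disk _ H).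
rewrite <- (extremal_ode _ Dz).
set (w := half_tanh (RtoC s * L)) in *.
replace (L / 2 * (C_derive f w * (1 - w * w)))%C with (C_derive f w * (L / 2 * (1 - w * w)))%C by ring.
apply (curve_derive_comp f (fun s => half_tanh (RtoC s * L)%C)).
- now apply C1_derive, fC1.
- now apply half_tanh_ray_derive.
Qed.

(** Cexp(- s al L) is an integrating factor: the product Q is constant along the ray. *)
Lemma extremal_power (L : C) : Rabs (Im L) < PI / 2 ->
  (1 + 2 * al * f (half_tanh L))%C = Cexp (al * L)%C.
Proof.
intros HL.
set (Q := fun s => ((1 + 2 * al * f (half_tanh (RtoC s * L))) * Cexp (RtoC s * (- (al * L))))%C).
assert (E : Q 0 = Q 1).
{ apply curve_constant; [lra|]; intros s Hs; unfold Q.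
  set (Y := f (half_tanh (RtoC s * L))).
  replace (RtoC 0) with ((0 + (0 * Y + 2 * al * 1)) * (L / 2 * (1 + 2 * al * Y)) * Cexp (RtoC s * (- (al * L)))
     + (1 + 2 * al * Y) * (- (al * L) * Cexp (RtoC s * (- (al * L)))))%C.
  - apply curve_derive_mult; [|apply Cexp_ray_derive].
    apply (curve_derive_comp (fun y => 1 + 2 * al * y)%C (fun s => f (half_tanh (RtoC s * L)%C))).
    + apply (Cderive_plus (fun _ => 1%C) (fun y => 2 * al * y)%C); [apply Cderive_const|].
      apply (Cderive_mult (fun _ => 2 * al)%C (fun y => y)); [apply Cderive_const|apply Cderive_id].
    + now apply extremal_ray_derive.
  - field. }
unfold Q in E; rewrite !Cmult_0_l, !Cmult_1_l, Cexp_0, half_tanh_0, extremal_0 in E.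
assert (E2 : (Cexp (al * L) * Cexp (- (al * L)) = 1)%C).
{ rewrite <- Cexp_plus; replace (al * L + - (al * L))%C with (RtoC 0) by ring; apply Cexp_0. }
transitivity ((1 + 2 * al * f (half_tanh L)) * Cexp (- (al * L)) * Cexp (al * L))%C.
- replace ((1 + 2 * al * f (half_tanh L)) * Cexp (- (al * L)) * Cexp (al * L))%C
    with ((1 + 2 * al * f (half_tanh L)) * (Cexp (al * L) * Cexp (- (al * L))))%C by ring.
  rewrite E2; ring.
- rewrite <- E; ring.
Qed.

(** Separate because at al = 0 the power formula degenerates to 1 = 1 and no longer determines f. *)
Lemma extremal_log (L : C) : al = 0 -> Rabs (Im L) < PI / 2 -> f (half_tanh L) = (L / 2)%C.
Proof.
intros H0 HL.
set (Q := fun s => (f (half_tanh (RtoC s * L)) - RtoC s * (L / 2))%C).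
assert (E : Q 0 = Q 1).
{ apply curve_constant; [lra|]; intros s Hs; unfold Q.
  set (Y := f (half_tanh (RtoC s * L))).
  replace (RtoC 0) with (L / 2 * (1 + 2 * al * Y) - L / 2)%C by (rewrite H0; ring).
  apply curve_derive_minus; [now apply extremal_ray_derive|apply ray_derive]. }
unfold Q in E; rewrite !Cmult_0_l, !Cmult_1_l, half_tanh_0, extremal_0 in E.
replace (f (half_tanh L)) with ((f (half_tanh L) - L / 2) + L / 2)%C by ring.
rewrite <- E; ring.
Qed.

Lemma al_strip (L : C) : Rabs (Im L) < PI / 2 -> Rabs (Im (RtoC al * L)%C) < PI / 2.
Proof. intros H; now apply ray_strip. Qed.

Lemma extremal_inj (z w : C) : disk z -> disk w -> f z = f w -> z = w.
Proof.
intros Hz Hw E.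
destruct (half_tanh_surj z Hz) as [L [HL [<- _]]].
destruct (half_tanh_surj w Hw) as [M [HM [<- _]]].
f_equal; destruct (Req_dec al 0) as [H0|H0].
- rewrite !extremal_log in E by assumption.
  replace L with (2 * (L / 2))%C by field; rewrite E; field.
- assert (K : Cexp (al * L)%C = Cexp (al * M)%C) by (rewrite <- !extremal_power by assumption; now rewrite E).
  apply Cexp_inj in K; [|now apply al_strip|now apply al_strip].
  assert (Hc : RtoC al <> 0%C) by (intros K2; apply (f_equal fst) in K2; cbn in K2; lra).
  replace L with (al * L / al)%C by (field; exact Hc); rewrite K; field; exact Hc.
Qed.

Lemma Im_combination (t : R) (u v : C) : Im (RtoC (1 - t) * u + RtoC t * v)%C = (1 - t) * Im u + t * Im v.
Proof. unfold Im; cbn; ring. Qed.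

Lemma Re_combination (t : R) (u v : C) : Re (RtoC (1 - t) * u + RtoC t * v)%C = (1 - t) * Re u + t * Re v.
Proof. unfold Re; cbn; ring. Qed.

Lemma convex_pos (t x y : R) : 0 <= t <= 1 -> 0 < x -> 0 < y -> 0 < (1 - t) * x + t * y.
Proof. intros Ht Hx Hy; destruct (Req_dec t 0) as [->|n]; [lra|nra]. Qed.

(** The image is the strip |Im w| < pi/4 when al = 0, and otherwise an affine image of the wedge
    |arg W| < al pi/2. The wedge is convex because al <= 1 keeps it inside the right half-plane. *)
Lemma extremal_convex : convex_set (disk_image f).
Proof.
intros u v t [z [Hz <-]] [w [Hw <-]] Ht.
destruct (half_tanh_surj z Hz) as [L [HL [<- _]]].
destruct (half_tanh_surj w Hw) as [M [HM [<- _]]].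
destruct (Req_dec al 0) as [H0|H0].
- set (N := (RtoC (1 - t) * L + RtoC t * M)%C).
  assert (HN : Rabs (Im N) < PI / 2).
  { unfold N; rewrite Im_combination; apply Rabs_def2 in HL, HM; apply Rabs_def1.
    - assert (K := convex_pos t (PI / 2 - Im L) (PI / 2 - Im M) Ht ltac:(lra) ltac:(lra)); lra.
    - assert (K := convex_pos t (PI / 2 + Im L) (PI / 2 + Im M) Ht ltac:(lra) ltac:(lra)); lra. }
  exists (half_tanh N); split; [now apply half_tanh_disk|].
  rewrite !extremal_log by assumption; unfold N; field.
- assert (HPI := PI_RGT_0).
  set (b := al * (PI / 2)).
  assert (Hb : 0 < b <= PI / 2) by (unfold b; split; [apply Rmult_lt_0_compat; lra|nra]).
  assert (Hstrip : forall X : C, Rabs (Im X) < PI / 2 -> Rabs (Im (al * X)%C) < b).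
  { intros X HX; replace (Im (al * X)%C) with (al * Im X) by (unfold Im; cbn; ring).
    rewrite Rabs_mult, (Rabs_right al) by lra; unfold b; apply Rmult_lt_compat_l; lra. }
  assert (WL := proj1 (Cexp_wedge_iff b _ Hb) (ex_intro _ (al * L)%C (conj eq_refl (Hstrip L HL)))).
  assert (WM := proj1 (Cexp_wedge_iff b _ Hb) (ex_intro _ (al * M)%C (conj eq_refl (Hstrip M HM)))).
  set (A := Cexp (al * L)) in *; set (B := Cexp (al * M)) in *.
  assert (WN : exists X, Cexp X = (RtoC (1 - t) * A + RtoC t * B)%C /\ Rabs (Im X) < b).
  { apply Cexp_wedge_iff; [exact Hb|]; rewrite Im_combination, Re_combination.
    destruct WL as [l1 [l2 l3]], WM as [m1 [m2 m3]].
    assert (k1 := convex_pos t _ _ Ht l1 m1).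
    assert (k2 := convex_pos t _ _ Ht l2 m2).
    assert (k3 := convex_pos t _ _ Ht l3 m3).
    split; [exact k1|split]; lra. }
  destruct WN as [X [EX HX]].
  assert (Hc : RtoC al <> 0%C) by (intros K2; apply (f_equal fst) in K2; cbn in K2; lra).
  assert (EaX : (al * (X / al) = X)%C) by (field; exact Hc).
  assert (HXa : Rabs (Im (X / al)%C) < PI / 2).
  { apply (Rmult_lt_reg_l al); [lra|]; fold b.
    rewrite <- (Rabs_right al) at 1 by lra; rewrite <- Rabs_mult.
    replace (al * Im (X / al)%C) with (Im (al * (X / al))%C) by (unfold Im; cbn; ring).
    rewrite EaX; exact HX. }
  exists (half_tanh (X / al)%C); split; [now apply half_tanh_disk|].
  assert (K := extremal_power _ HXa); rewrite EaX, EX in K; unfold A, B in K.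
  rewrite <- (extremal_power L HL), <- (extremal_power M HM) in K.
  assert (Hc2 : (2 * al)%C <> 0%C) by (apply Cmult_neq_0; [|exact Hc]; intros K2; apply (f_equal fst) in K2; cbn in K2; lra).
  transitivity ((1 + 2 * al * f (half_tanh (X / al)) - 1) / (2 * al))%C.
  + field; exact Hc.
  + rewrite K, RtoC_minus; field; exact Hc.
Qed.

Lemma extremal_class_C : class_C f (fun n => RtoC (extremal_coef al n)).
Proof.
split; [|apply extremal_convex].
split; [split; [now apply C1_holomorphic|exact extremal_inj]|].
split; [exact fexp|split; reflexivity].
Qed.

Lemma extremal_modulus (z : C) : disk z ->
  0 < Cmod (1 - z) /\ 0 < Cmod (1 + z) /\
  Cmod (1 + 2 * al * f z) = exp (al * (ln (Cmod (1 + z)) - ln (Cmod (1 - z)))).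
Proof.
intros Hz.
destruct (half_tanh_surj z Hz) as [L [HL [Ez EL]]].
assert (n1 : (1 - z)%C <> 0%C).
{ intros E; assert (K : z = 1%C) by (replace z with (1 - (1 - z))%C by ring; rewrite E; ring).
  unfold disk in Hz; rewrite K, Cmod_1 in Hz; lra. }
assert (n2 : (1 + z)%C <> 0%C).
{ intros E; assert (K : z = (- (1))%C) by (replace z with ((1 + z) - 1)%C by ring; rewrite E; ring).
  unfold disk in Hz; rewrite K, Cmod_opp, Cmod_1 in Hz; lra. }
assert (p1 := proj1 (Cmod_gt_0 _) n1); assert (p2 := proj1 (Cmod_gt_0 _) n2).
split; [exact p1|split; [exact p2|]].
rewrite <- Ez at 1; rewrite (extremal_power L HL), Cmod_Cexp; f_equal.
replace (Re (al * L)%C) with (al * Re L) by (unfold Re; cbn; ring); f_equal.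
apply exp_inv; rewrite <- Cmod_Cexp, EL, Cmod_div by exact n1.
unfold Rminus; rewrite exp_plus, exp_Ropp, !exp_ln by assumption; reflexivity.
Qed.
End Extremal.

Lemma extremal_exists (al : R) : 0 <= al <= 1 ->
  exists f, has_expansion f (fun n => RtoC (extremal_coef al n)).
Proof.
intros Hal.
assert (K : forall z, exists l, disk z -> is_Cseries (fun n => RtoC (extremal_coef al n) * z ^ n)%C l).
{ intros z; destruct (excluded_middle_informative (disk z)) as [Hz|Hz]; [|exists 0%C; tauto].
  destruct (ex_Cseries (fun n => RtoC (extremal_coef al n) * z ^ n)%C (fun n => Cmod z ^ n)) as [l Hl].
  - intros n; rewrite Cmod_mult, Cmod_pow, Cmod_R.
    assert (B := extremal_coef_bound al Hal n); rewrite Rabs_right by lra.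
    assert (0 <= Cmod z ^ n) by (apply pow_le, Cmod_ge_0); nra.
  - apply ex_series_geom; rewrite Rabs_right; [exact Hz|apply Rle_ge, Cmod_ge_0].
  - exists l; intros _; exact Hl. }
apply choice in K; destruct K as [f Hf]; exists f; now apply has_expansion_iff.
Qed.

(** * Divergence *)

Lemma hardy_mean_bound (g : C -> C) (p : R) : 0 < p -> hardy (Finite p) g ->
  exists B, forall r, 0 <= r < 1 -> RInt (fun th => pos_power (Cmod (g (polar r th))) p) 0 (2 * PI) <= B.
Proof.
intros Hp [_ [B HB]]; exists (2 * PI * pos_power B p); intros r Hr.
assert (HPI := PI_RGT_0).
specialize (HB r Hr); cbn [integral_mean Rbar_le] in HB.
set (I := RInt (fun th => pos_power (Cmod (g (polar r th))) p) 0 (2 * PI)) in *.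
(* The outer [pos_power] can be inverted only at a positive argument; in the other case any
   nonnegative bound works. *)
destruct (Rle_lt_dec I 0) as [HI|HI].
- apply Rle_trans with (1 := HI); apply Rmult_le_pos; [lra|apply pos_power_ge0].
- assert (HI2 : 0 < / (2 * PI) * I) by (apply Rmult_lt_0_compat; [apply Rinv_0_lt_compat; lra|exact HI]).
  rewrite pos_power_pos in HB by exact HI2.
  apply (pos_power_le _ _ p) in HB; [|lra].
  rewrite pos_power_pos, Rpower_mult, Rinv_l, Rpower_1 in HB by (try exact HI2; try lra; apply exp_pos).
  apply (Rmult_le_compat_l (2 * PI)) in HB; [|lra].
  rewrite <- Rmult_assoc, Rinv_r, Rmult_1_l in HB by lra; exact HB.
Qed.

Lemma ex_RInt_circle_power (g : C -> C) (p r a b : R) :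
  (forall th, cont g (polar r th)) -> (forall th, g (polar r th) <> 0%C) ->
  ex_RInt (fun th => pos_power (Cmod (g (polar r th))) p) a b.
Proof.
intros Hc H0.
assert (Hp : forall th, 0 < Cmod (g (polar r th))) by (intros th; now apply Cmod_gt_0).
apply (ex_RInt_ext (fun th => Rpower (Cmod (g (0 + polar r th)%C)) p)).
{ intros th _; rewrite Cplus_0_l; symmetry; apply pos_power_pos, Hp. }
apply (@ex_RInt_continuous R_CompleteNormedModule); intros th _.
apply (continuous_comp (fun th => Cmod (g (0 + polar r th)%C)) (fun x => exp (p * ln x))).
- apply continuous_Cmod, (contC_comp (fun th : R_UniformSpace => 0 + polar r th)%C g); [apply polar_cont_angular|].
  rewrite Cplus_0_l; apply Hc.
- apply (@ex_derive_continuous R_AbsRing R_NormedModule); auto_derive; rewrite Cplus_0_l; apply Hp.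
Qed.

(** Splits 1 - r e^{it} as (1 - r) + r (1 - e^{it}) and uses |1 - e^{it}| = 2 sin(t/2) <= t. *)
Lemma chord_bound (r th : R) : 0 <= r < 1 -> 0 <= th <= 1 ->
  Cmod (1 - polar r th) <= (1 - r) + th.
Proof.
intros Hr Hth.
assert (E : Cmod (1 - polar 1 th) ^ 2 = 4 * sin (th / 2) ^ 2).
{ rewrite Cmod2_alt; unfold Re, Im; cbn.
  assert (S2 := sin2_cos2 th); unfold Rsqr in S2.
  assert (Cc := cos_2a_sin (th / 2)); replace (2 * (th / 2)) with th in Cc by field.
  set (s := sin (th / 2)) in *; set (sn := sin th) in *; set (cs := cos th) in *; nra. }
assert (HPI := PI2_3_2).
assert (Hs : 0 <= sin (th / 2) <= th / 2).
{ split; [apply sin_ge_0; lra|].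
  destruct (Req_dec th 0) as [->|n]; [replace (0 / 2) with 0 by field; rewrite sin_0; lra|].
  left; apply sin_lt_x; lra. }
assert (K : Cmod (1 - polar 1 th) <= th).
{ generalize (Cmod_ge_0 (1 - polar 1 th)); nra. }
replace (1 - polar r th)%C with (RtoC (1 - r) + RtoC r * (1 - polar 1 th))%C.
2:{ rewrite (polar_mult r), RtoC_minus; ring. }
apply Rle_trans with (1 := Cmod_triangle _ _).
rewrite Cmod_mult, !Cmod_R, !Rabs_right by lra.
generalize (Cmod_ge_0 (1 - polar 1 th)); nra.
Qed.

(** The integral of c/((1 - r) + t) over [0, 1] is c ln((2 - r)/(1 - r)), unbounded as r tends to
    1. *)
Lemma log_divergence (F : R -> R -> R) (B c d : R) : 0 < c ->
  (forall r th, 0 <= F r th) ->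
  (forall r, 0 < r < 1 -> ex_RInt (F r) 0 (2 * PI)) ->
  (forall r th, 0 < r < 1 -> 0 < th < 1 -> c / ((1 - r) + th) - d <= F r th) ->
  (forall r, 0 <= r < 1 -> RInt (F r) 0 (2 * PI) <= B) -> False.
Proof.
intros Hc F0 FI Fl FB.
assert (HPI := PI2_3_2).
(* With 1 - r = exp(- x), the integral over [0, 1] is at least c x - d >= |B| + 1. *)
set (x := (Rabs B + Rabs d + 1) / c).
assert (Hx : 0 < x).
{ unfold x; apply Rdiv_lt_0_compat; [generalize (Rabs_pos B) (Rabs_pos d); lra|exact Hc]. }
set (e := exp (- x)).
assert (He : 0 < e < 1).
{ unfold e; split; [apply exp_pos|rewrite <- exp_0; apply exp_increasing; lra]. }
set (r := 1 - e).
assert (Hr : 0 < r < 1) by (unfold r; lra).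
assert (I1 : ex_RInt (F r) 0 1) by (apply (@ex_RInt_Chasles_1 R_CompleteNormedModule) with (2 * PI); [lra|now apply FI]).
assert (I2 : ex_RInt (F r) 1 (2 * PI)) by (apply (@ex_RInt_Chasles_2 R_CompleteNormedModule) with 0; [lra|now apply FI]).
assert (HI : is_RInt (fun th => c / (e + th) - d) 0 1
  (minus (c * ln (e + 1) - d * 1) (c * ln (e + 0) - d * 0))).
{ apply (is_RInt_derive (fun th => c * ln (e + th) - d * th)).
  - intros th Hth; rewrite Rmin_left, Rmax_right in Hth by lra; auto_derive; [lra|field; lra].
  - intros th Hth; rewrite Rmin_left, Rmax_right in Hth by lra.
    apply (@ex_derive_continuous R_AbsRing R_NormedModule); auto_derive; lra. }
assert (L1 : RInt (fun th => c / (e + th) - d) 0 1 <= RInt (F r) 0 1).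
{ apply RInt_le; [lra|eexists; exact HI|exact I1|].
  intros th Hth; replace e with (1 - r) by (unfold r; ring); now apply Fl. }
rewrite (is_RInt_unique _ _ _ _ HI) in L1.
assert (L2 : 0 <= RInt (F r) 1 (2 * PI)) by (apply RInt_ge_0; [lra|exact I2|intros; apply F0]).
assert (L3 : RInt (F r) 0 (2 * PI) = RInt (F r) 0 1 + RInt (F r) 1 (2 * PI)).
{ symmetry; apply (@RInt_Chasles R_CompleteNormedModule); assumption. }
specialize (FB r ltac:(lra)); rewrite L3 in FB.
change (c * ln (e + 1) - d * 1 + - (c * ln (e + 0) - d * 0) <= RInt (F r) 0 1) in L1.
rewrite Rplus_0_r in L1; unfold e at 2 in L1; rewrite ln_exp in L1.
assert (L4 : 0 <= ln (e + 1)) by (rewrite <- ln_1; apply ln_le; lra).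
assert (L5 : c * x = Rabs B + Rabs d + 1) by (unfold x; field; lra).
assert (0 <= c * ln (e + 1)) by (apply Rmult_le_pos; lra).
generalize (Rle_abs B) (Rle_abs d); lra.
Qed.

Lemma disk_polar (r th : R) : 0 <= r < 1 -> disk (polar r th).
Proof. intros Hr; unfold disk; rewrite Cmod_polar; lra. Qed.

(** * Failure at the critical exponents *)

Section ExtremalNotHardy.
Variables (al : R) (f : C -> C).
Hypothesis Hal : 0 <= al <= 1.
Hypothesis fexp : has_expansion f (fun n => RtoC (extremal_coef al n)).
Let fC1 := has_expansion_C1 f _ fexp.
Let finj := extremal_inj al f Hal fexp.

Lemma extremal_derive_not_hardy : ~ hardy (Finite (/ (1 + al))) (C_derive f).
Proof.
intros H; set (p := / (1 + al)) in *.
assert (Hp : 0 < p) by (apply Rinv_0_lt_compat; lra).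
apply hardy_mean_bound in H; [|exact Hp]; destruct H as [B HB].
apply (log_divergence (fun r th => pos_power (Cmod (C_derive f (polar r th))) p) B (1 / 2) 0); auto; try lra.
- intros r th; apply pos_power_ge0.
- intros r Hr; apply ex_RInt_circle_power; intros th.
  + apply (fC1 (polar r th)), disk_polar; lra.
  + apply univalent_derive_neq0; [exact fC1|exact finj|apply disk_polar; lra].
- intros r th Hr Hth.
  set (z := polar r th).
  assert (Dz : disk z) by (apply disk_polar; lra).
  destruct (extremal_modulus al f fexp z Dz) as [p1 [p2 E]].
  rewrite <- (extremal_ode al f fexp z Dz) in E.
  replace (1 - z * z)%C with ((1 - z) * (1 + z))%C in E by ring.
  rewrite !Cmod_mult in E.
  assert (HD : 0 < Cmod (C_derive f z)).
  { apply Cmod_gt_0, univalent_derive_neq0; [exact fC1|exact finj|exact Dz]. }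
  assert (Hch := chord_bound r th ltac:(lra) ltac:(lra)); fold z in Hch.
  assert (HA2 : Cmod (1 + z) <= 2).
  { apply Rle_trans with (1 := Cmod_triangle _ _); rewrite Cmod_1; unfold disk in Dz; lra. }
  set (A := Cmod (1 + z)) in *; set (b := Cmod (1 - z)) in *; set (D := Cmod (C_derive f z)) in *.
  assert (HlA : ln A <= ln 2) by (apply ln_le; lra).
  assert (EL : ln D + (ln b + ln A) = al * (ln A - ln b)).
  { apply (f_equal ln) in E; rewrite ln_exp, !ln_mult in E; try assumption.
    now apply Rmult_lt_0_compat. }
  assert (Hl2 : 0 < ln 2) by (rewrite <- ln_1; apply ln_increasing; lra).
  (* Here |f'| = |1 + z|^(al - 1) |1 - z|^(-(1 + al)). From |1 + z| <= 2 and 0 <= al <= 1 this is at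
     least (2 |1 - z|)^(-(1 + al)), whose p-th power is 1/(2 |1 - z|); this explains the constant
     1/2. *)
  assert (EL2 : (1 + al) * (- (ln 2 + ln b)) <= ln D) by nra.
  rewrite pos_power_pos by exact HD.
  apply Rle_trans with (1 / 2 / b).
  + rewrite Rminus_0_r; apply Rmult_le_compat_l; [lra|]; apply Rinv_le_contravar; assumption.
  + replace (1 / 2 / b) with (exp (- (ln 2 + ln b))).
    2:{ rewrite exp_Ropp, exp_plus, !exp_ln by lra; field; lra. }
    apply (Rmult_le_compat_l p) in EL2; [|lra].
    rewrite <- Rmult_assoc in EL2; unfold p at 1 in EL2; rewrite Rinv_l, Rmult_1_l in EL2 by lra.
    unfold Rpower; destruct EL2 as [EL2|EL2]; [left; now apply exp_increasing|right; now rewrite EL2].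
Qed.

Lemma extremal_not_bounded : al = 0 -> ~ hardy p_infty f.
Proof.
intros H0 [_ [B HB]].
(* At the real point tanh(x/2) the function takes the value x/2 = |B| + 1. *)
set (x := 2 * Rabs B + 2).
assert (Hx : 0 < x) by (unfold x; generalize (Rabs_pos B); lra).
assert (HPI := PI_RGT_0).
assert (HL : Rabs (Im (RtoC x)) < PI / 2) by (unfold Im; cbn; rewrite Rabs_R0; lra).
set (z := half_tanh x).
assert (Dz : disk z) by now apply half_tanh_disk.
specialize (HB (Cmod z) (conj (Cmod_ge_0 z) Dz)); cbn [integral_mean] in HB.
assert (K := proj1 (Lub_Rbar_correct (fun y => exists w, Cmod w = Cmod z /\ y = Cmod (f w)))).
specialize (K (Cmod (f z)) (ex_intro _ z (conj eq_refl eq_refl))).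
assert (K2 := Rbar_le_trans _ _ _ K HB); cbn in K2.
unfold z in K2; rewrite (extremal_log al f fexp x H0 HL) in K2.
rewrite <- RtoC_div in K2 by lra.
rewrite Cmod_R, Rabs_right in K2 by (unfold x; generalize (Rabs_pos B); lra).
unfold x in K2; generalize (Rle_abs B); lra.
Qed.

Lemma extremal_not_hardy : ~ hardy (recip_ext al) f.
Proof.
unfold recip_ext; destruct (Req_EM_T al 0) as [H0|H0]; [now apply extremal_not_bounded|].
intros H; set (p := / al) in *.
assert (Ha : 0 < al) by lra.
assert (Hp : 0 < p) by now apply Rinv_0_lt_compat.
apply hardy_mean_bound in H; [|exact Hp]; destruct H as [B HB].
(* |1 + 2 al f| is at most 2 if 2 al |f| <= 1, and at most 4 al |f| otherwise; hence its p-th power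
   is at most 2^p + M |f|^p, which gives the two constants passed to [log_divergence]. *)
set (M := Rpower (4 * al) p).
assert (HM : 0 < M) by apply exp_pos.
apply (log_divergence (fun r th => pos_power (Cmod (f (polar r th))) p) B (/ M) (Rpower 2 p / M)); auto.
- now apply Rinv_0_lt_compat.
- intros r th; apply pos_power_ge0.
- intros r Hr; apply ex_RInt_circle_power; intros th.
  + apply C1_cont, fC1, disk_polar; lra.
  + intros E; assert (Hz : polar r th = 0%C).
    { apply finj; [apply disk_polar; lra|apply disk_0|]; rewrite E; symmetry; now apply (extremal_0 al). }
    assert (K := Cmod_polar r th ltac:(lra)); rewrite Hz, Cmod_0 in K; lra.
- intros r th Hr Hth.
  set (z := polar r th).
  assert (Dz : disk z) by (apply disk_polar; lra).
  destruct (extremal_modulus al f fexp z Dz) as [p1 [p2 E]].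
  assert (Hch := chord_bound r th ltac:(lra) ltac:(lra)); fold z in Hch.
  (* Angles in (0, 1) have nonnegative cosine, so Re (1 + z) >= 1. *)
  assert (HA : 1 <= Cmod (1 + z)).
  { assert (HPI := PI2_3_2).
    assert (0 <= cos th) by (apply cos_ge_0; lra).
    apply Rle_trans with (Re (1 + z)%C).
    - unfold z, polar, Re; cbn; assert (0 <= r * cos th) by (apply Rmult_le_pos; lra); lra.
    - apply Rle_trans with (1 := Rle_abs _), re_le_Cmod. }
  set (A := Cmod (1 + z)) in *; set (b := Cmod (1 - z)) in *.
  assert (E1 : Rpower (Cmod (1 + 2 * al * f z)) p = A / b).
  { rewrite E; unfold Rpower; rewrite ln_exp, <- Rmult_assoc; unfold p; rewrite Rinv_l, Rmult_1_l by lra.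
    unfold Rminus; rewrite exp_plus, exp_Ropp, !exp_ln by assumption; reflexivity. }
  assert (T : Cmod (1 + 2 * al * f z) <= 1 + 2 * al * Cmod (f z)).
  { apply Rle_trans with (1 := Cmod_triangle _ _).
    rewrite !Cmod_mult, Cmod_1, !Cmod_R, !Rabs_right by lra; lra. }
  assert (Hw : 0 < Cmod (1 + 2 * al * f z)) by (rewrite E; apply exp_pos).
  set (X := pos_power (Cmod (f z)) p).
  assert (HX : 0 <= X) by apply pos_power_ge0.
  assert (U : A / b <= Rpower 2 p + M * X).
  { rewrite <- E1.
    assert (R2 : 0 < Rpower 2 p) by apply exp_pos.
    destruct (Rle_lt_dec (2 * al * Cmod (f z)) 1) as [L|L].
    - apply Rle_trans with (Rpower 2 p).
      + apply Rle_Rpower_l; lra.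
      + assert (0 <= M * X) by (apply Rmult_le_pos; lra); lra.
    - assert (Hf : 0 < Cmod (f z)).
      { destruct (Rle_lt_or_eq_dec _ _ (Cmod_ge_0 (f z))) as [|E0]; [assumption|rewrite <- E0 in L; lra]. }
      apply Rle_trans with (Rpower (4 * al * Cmod (f z)) p).
      + apply Rle_Rpower_l; lra.
      + rewrite <- Rpower_mult_distr by lra; unfold X; rewrite pos_power_pos by exact Hf; fold M; lra. }
  assert (V : / ((1 - r) + th) <= A / b).
  { apply Rle_trans with (/ b); [apply Rinv_le_contravar; assumption|].
    rewrite <- (Rmult_1_l (/ b)) at 1; apply Rmult_le_compat_r; [left; now apply Rinv_0_lt_compat|exact HA]. }
  apply (Rmult_le_reg_l M); [exact HM|].
  replace (M * (/ M / (1 - r + th) - Rpower 2 p / M)) with (/ (1 - r + th) - Rpower 2 p) by (field; lra).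
  lra.
Qed.
End ExtremalNotHardy.

Theorem theorem1 :
  (forall (f : C -> C) (a : nat -> C), class_C f a ->
     (forall p : R, 0 < p < / (1 + Cmod (a 2%nat)) ->
        hardy (Finite p) (C_derive f)) /\
     (forall q : R, 0 < q -> Rbar_lt (Finite q) (recip_ext (Cmod (a 2%nat))) ->
        hardy (Finite q) f)) /\
  (forall alpha : R, 0 <= alpha <= 1 ->
     (exists (f : C -> C) (a : nat -> C),
        class_C f a /\ Cmod (a 2%nat) = alpha /\
        ~ hardy (Finite (/ (1 + alpha))) (C_derive f)) /\
     (exists (f : C -> C) (a : nat -> C),
        class_C f a /\ Cmod (a 2%nat) = alpha /\
        ~ hardy (recip_ext alpha) f)).
Proof.
split; [exact class_C_hardy|]; intros al Hal.
destruct (extremal_exists al Hal) as [f Hf].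
assert (E2 : Cmod (RtoC (extremal_coef al 2)) = al).
{ replace (extremal_coef al 2) with al by (unfold extremal_coef; cbn; field).
  rewrite Cmod_R, Rabs_right; lra. }
assert (HC := extremal_class_C al f Hal Hf).
split; exists f, (fun n => RtoC (extremal_coef al n)); (split; [exact HC|split; [exact E2|]]).
- now apply extremal_derive_not_hardy.
- now apply extremal_not_hardy.
Qed.
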